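(* (Sub-Jacobi group action) For each integer $N\ne0$, each positive $d\mid N$ and each Dirichlet character $\chi$ modulo $d$, the Hilbert space $\mathcal{H}_{N,d}(\chi)$ carries, via the operators $\rho_J([t,a,c,z])$, an irreducible unitary representation of the four-dimensional solvable real Lie group $H^J$ with central character $e^{2\pi i Nz}$. Two such representations (for data $(N,d,\chi)$ and $(N',d',\chi')$) are unitarily equivalent $H^J$-modules if and only if they have the same value of $N$.
   Context: $H(\mathbb{R})$ is the real Heisenberg group of triples $[a,c,z]\in\mathbb{R}^3$ with law $[a,c,z]\circ[a',c',z']=[a+a',c+c',z+z'+ca']$; $H(\mathbb{Z})$ is the subgroup of integer triples. $\mathcal{H}_N$ is the Hilbert space of left $H(\mathbb{Z})$-invariant functions $F$ on $H(\mathbb{R})$, square-integrable over $[0,1]^3$ with respect to $da\,dc\,dz$, with $F(a,c,z)=e^{2\pi i Nz}F(a,c,0)$ a.e.; $H(\mathbb{R})$ acts by $\rho(h)(F)(g)=F(gh)$. For a (primitive or imprimitive) Dirichlet character $\chi$ mod $d$, $d\mid N$, the map $\mathcal{W}_{N,d}(\chi):L^2(\mathbb{R},dx)\to\mathcal{H}_N$ is the isometric extension of $$\mathcal{W}_{N,d}(\chi)(f)(a,c,z)=\sqrt{C_{N,d}}\,e^{2\pi i Nz}\sum_{n\in\mathbb{Z}}\chi\Big(\frac{nd}{N}\Big)f(n+Nc)e^{2\pi i na},\quad C_{N,d}=\frac{N}{\phi(d)}$$ ($f$ Schwartz; $\chi(r)=0$ if $r\notin\mathbb{Z}$; principal square root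 when $N<0$), and $\mathcal{H}_{N,d}(\chi)$ is its closed image, which is $\rho$-invariant. For $t\in\mathbb{R}^*$, $U(t)f(x)=|t|^{1/2}f(tx)$ on $L^2(\mathbb{R},dx)$ and $V(t)=\mathcal{W}_{N,d}(\chi)\circ U(t)\circ\mathcal{W}_{N,d}(\chi)^{-1}$ on $\mathcal{H}_{N,d}(\chi)$. The sub-Jacobi group $H^J$ is the set of $[t,a,c,z]\in\mathbb{R}^*\times\mathbb{R}^3$ with law $$[t,a,c,z]\circ[t',a',c',z']=[tt',\tfrac1{t'}a+a',t'c+c',z+z'+t'ca'].$$ Its action on $\mathcal{H}_{N,d}(\chi)$ is $\rho_J([t,a,c,z])=V(t)\circ\rho([a,c,z])$. ''Central character $e^{2\pi i Nz}$'' means $\rho_J([1,0,0,z])$ is multiplication by $e^{2\pi i Nz}$. *)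

(* Defs.v *)
From HB Require Import structures.
From mathcomp Require Import all_boot all_order all_algebra.
From mathcomp Require Import complex ring.
From mathcomp Require Import all_classical all_reals all_analysis.

Set Implicit Arguments.
Unset Strict Implicit.
Unset Printing Implicit Defensive.

Import Order.TTheory GRing.Theory Num.Theory numFieldNormedType.Exports.

Local Open Scope classical_set_scope.
Local Open Scope complex_scope.
Local Open Scope ring_scope.

(* Hilbert spaces are presented, as is usual for L^2 spaces, by representatives:
   [hmem] is a subspace of the vector space [hcar], carrying a positive
   semidefinite Hermitian form [hinner]; two members whose difference has norm 0
   ([heq]) represent the same vector. *)

Record hspace (R : realType) := HSpace {
  hcar : lmodType R[i];
  hmem : set hcar;
  hinner : hcar -> hcar -> R[i] }.

Section HilbertSpaces.
Variable R : realType.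
Local Notation C := R[i].
Implicit Types E F : hspace R.

Definition hnorm E (u : hcar E) : R := Num.sqrt (complex.Re (hinner u u)).

Definition heq E (u v : hcar E) : Prop :=
  [/\ hmem u, hmem v & hnorm (u - v) = 0].

Definition hsub E (S : set (hcar E)) : hspace R := HSpace S (@hinner R E).

Definition hsubspace E (S : set (hcar E)) : Prop :=
  [/\ S `<=` @hmem R E, S 0 &
      forall (a : C) u v, S u -> S v -> S (a *: u + v)].

Definition hclosed E (S : set (hcar E)) : Prop :=
  forall (u : nat -> hcar E) (v : hcar E), (forall n, S (u n)) -> hmem v ->
    hnorm (u n - v) @[n --> \oo] --> (0 : R) -> S v.

Definition hcauchy E (u : nat -> hcar E) : Prop :=
  forall eps : R, 0 < eps -> exists n0 : nat, forall m n : nat,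
    (n0 <= m)%N -> (n0 <= n)%N -> hnorm (u m - u n) < eps.

Record is_hilbert E : Prop := IsHilbert {
  hilbert_subspace : hsubspace (@hmem R E);
  hilbert_linear : forall (a : C) (u v w : hcar E),
    hmem u -> hmem v -> hmem w ->
    hinner (a *: u + v) w = a * hinner u w + hinner v w;
  hilbert_hermitian : forall u v : hcar E, hmem u -> hmem v ->
    hinner v u = (hinner u v)^*;
  hilbert_ge0 : forall u : hcar E, hmem u -> 0 <= hinner u u;
  hilbert_complete : forall u : nat -> hcar E, (forall n, hmem (u n)) ->
    hcauchy u ->
    exists2 v, hmem v & hnorm (u n - v) @[n --> \oo] --> (0 : R) }.

Record hisometry E F (T : hcar E -> hcar F) : Prop := HIsometry {
  hisometry_mem : forall u, hmem u -> hmem (T u);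
  hisometry_linear : forall (a : C) u v, hmem u -> hmem v ->
    heq (T (a *: u + v)) (a *: T u + T v);
  hisometry_inner : forall u v, hmem u -> hmem v ->
    hinner (T u) (T v) = hinner u v }.

Definition hunitary E F (T : hcar E -> hcar F) : Prop :=
  hisometry T /\ forall w, hmem w -> exists2 u, hmem u & heq (T u) w.

End HilbertSpaces.

HB.mixin Record Group_Topological_isTopologicalGroup G
    of Group G & Topological G := {
  mulg_continuous : continuous (fun p : G * G => (p.1 * p.2)%g);
  invg_continuous : continuous (fun x : G => (x^-1)%g) }.

#[short(type="topologicalGroupType")]
HB.structure Definition TopologicalGroup :=
  {G of Group_Topological_isTopologicalGroup G & Group G & Topological G}.

Section Representations.
Variables (R : realType) (G : topologicalGroupType).
Implicit Types E F : hspace R.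

(* The continuity condition is strong continuity. *)
Record unitary_rep E (pi : G -> hcar E -> hcar E) : Prop := UnitaryRep {
  unitary_rep_hilbert : is_hilbert E;
  unitary_rep_unitary : forall g, hunitary (pi g);
  unitary_rep1 : forall u, hmem u -> heq (pi 1%g u) u;
  unitary_repM : forall g h u, hmem u ->
    heq (pi (g * h)%g u) (pi g (pi h u));
  unitary_rep_continuous : forall (u : hcar E) (g0 : G), hmem u ->
    hnorm (pi g u - pi g0 u) @[g --> g0] --> (0 : R) }.

Definition hnonzero E : Prop := exists2 u : hcar E, hmem u & hnorm u <> 0.

Definition irreducible_rep E (pi : G -> hcar E -> hcar E) : Prop :=
  hnonzero E /\
  forall S : set (hcar E), hsubspace S -> hclosed S ->
    (forall g u, S u -> S (pi g u)) ->
    (forall u, S u -> hnorm u = 0) \/ S = @hmem R E.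

Definition unitarily_equivalent E F
    (pi : G -> hcar E -> hcar E) (tau : G -> hcar F -> hcar F) : Prop :=
  exists2 T : hcar E -> hcar F, hunitary T &
    forall g u, hmem u -> heq (T (pi g u)) (tau g (T u)).

End Representations.

Section SolvableGroups.
Variable G : groupType.

Definition is_subgroup (H : set G) : Prop :=
  [/\ H 1%g, forall x y, H x -> H y -> H (x * y)%g &
      forall x, H x -> H (x^-1)%g].

Definition derived_subgroup (A : set G) : set G :=
  [set x | forall H, is_subgroup H ->
    (forall a b, A a -> A b -> H (commg a b)) -> H x].

Definition solvable_group : Prop :=
  exists n, iter n derived_subgroup setT `<=` [set 1%g].

End SolvableGroups.

Record HJ (R : realType) := mkHJ {
  HJt : R;
  HJt_neq0 : HJt != 0;
  HJa : R;
  HJc : R;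
  HJz : R }.

Section SubJacobiGroup.
Variable R : realType.
Implicit Types g h : HJ R.

Definition HJcoord g : R * R * R * R := (HJt g, HJa g, HJc g, HJz g).

Lemma HJ_eq g h : HJt g = HJt h -> HJa g = HJa h -> HJc g = HJc h ->
  HJz g = HJz h -> g = h.
Proof.
case: g h => t t0 a c z [t' t0' a' c' z'] /= tt' -> -> ->.
by case: _ / tt' t0' => t0'; congr mkHJ; exact: bool_irrelevance.
Qed.

HB.instance Definition _ := gen_eqMixin (HJ R).
HB.instance Definition _ := gen_choiceMixin (HJ R).

Definition HJone : HJ R := mkHJ (oner_neq0 R) 0 0 0.

Definition HJmul g h : HJ R :=
  mkHJ (mulf_neq0 (HJt_neq0 g) (HJt_neq0 h))
    ((HJt h)^-1 * HJa g + HJa h)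
    (HJt h * HJc g + HJc h)
    (HJz g + HJz h + HJt h * HJc g * HJa h).

Definition HJinv g : HJ R :=
  mkHJ (invr_neq0 (HJt_neq0 g))
    (- (HJt g * HJa g)) (- ((HJt g)^-1 * HJc g)) (HJc g * HJa g - HJz g).

Let HJmulA : associative HJmul.
Proof.
move=> x y z; have x0 := HJt_neq0 x; have y0 := HJt_neq0 y.
have z0 := HJt_neq0 z; apply: HJ_eq => /=; first exact: mulrA.
- by field; apply/andP; split.
- by ring.
- by field.
Qed.

Let HJmul1 : left_id HJone HJmul.
Proof.
move=> x; apply: HJ_eq => /=; first exact: mul1r.
- by rewrite mulr0 add0r.
- by rewrite mulr0 add0r.
- by rewrite mulr0 mul0r add0r addr0.
Qed.

Let HJmulr1 : right_id HJone HJmul.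
Proof.
move=> x; apply: HJ_eq => /=; first exact: mulr1.
- by rewrite invr1 mul1r addr0.
- by rewrite mul1r addr0.
- by rewrite mulr0 !addr0.
Qed.

Let HJmulV : left_inverse HJone HJinv HJmul.
Proof.
move=> x; have x0 := HJt_neq0 x; apply: HJ_eq => /=.
- exact: mulVf.
- by field.
- by field.
- by field.
Qed.

Let HJmulrV : right_inverse HJone HJinv HJmul.
Proof.
move=> x; have x0 := HJt_neq0 x; apply: HJ_eq => /=.
- exact: mulfV.
- by field.
- by field.
- by field.
Qed.

HB.instance Definition _ :=
  isGroup.Build (HJ R) HJmulA HJmul1 HJmulr1 HJmulV HJmulrV.

HB.instance Definition _ :=
  Topological.copy (HJ R) (initial_topology HJcoord).

Let HJcoord_cvg (x : HJ R) : HJcoord y @[y --> x] --> HJcoord x.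
Proof. exact: initial_continuous. Qed.

Let HJt_cvg (x : HJ R) : HJt y @[y --> x] --> HJt x.
Proof.
exact: (cvg_comp _ fst (cvg_comp _ fst (cvg_comp _ fst
  (HJcoord_cvg (x := x)) cvg_fst) cvg_fst) cvg_fst).
Qed.

Let HJa_cvg (x : HJ R) : HJa y @[y --> x] --> HJa x.
Proof.
exact: (cvg_comp _ snd (cvg_comp _ fst (cvg_comp _ fst
  (HJcoord_cvg (x := x)) cvg_fst) cvg_fst) cvg_snd).
Qed.

Let HJc_cvg (x : HJ R) : HJc y @[y --> x] --> HJc x.
Proof.
exact: (cvg_comp _ snd (cvg_comp _ fst
  (HJcoord_cvg (x := x)) cvg_fst) cvg_snd).
Qed.

Let HJz_cvg (x : HJ R) : HJz y @[y --> x] --> HJz x.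
Proof. exact: (cvg_comp _ snd (HJcoord_cvg (x := x)) cvg_snd). Qed.

Let HJ_continuous (X : topologicalType) (f : X -> HJ R) :
  (forall x, HJt (f y) @[y --> x] --> HJt (f x)) ->
  (forall x, HJa (f y) @[y --> x] --> HJa (f x)) ->
  (forall x, HJc (f y) @[y --> x] --> HJc (f x)) ->
  (forall x, HJz (f y) @[y --> x] --> HJz (f x)) -> continuous f.
Proof.
move=> ft fa fc fz.
apply: (@continuous_comp_initial (HJ R) X (R * R * R * R)%type HJcoord f) => x.
exact: (cvg_pair (cvg_pair (cvg_pair (ft x) (fa x)) (fc x)) (fz x)).
Qed.

Let HJmul_continuous : continuous (fun p : HJ R * HJ R => (p.1 * p.2)%g).
Proof.
apply: HJ_continuous => -[x y].
all: have fx (p : HJ R -> R) : p z @[z --> x] --> p x ->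
    p z.1 @[z --> (x, y)] --> p x by
  move=> px; exact: (cvg_comp fst p cvg_fst px).
all: have fy (p : HJ R -> R) : p z @[z --> y] --> p y ->
    p z.2 @[z --> (x, y)] --> p y by
  move=> py; exact: (cvg_comp snd p cvg_snd py).
all: have tx := fx _ (@HJt_cvg x).
all: have ax := fx _ (@HJa_cvg x).
all: have cx := fx _ (@HJc_cvg x).
all: have zx := fx _ (@HJz_cvg x).
all: have ty := fy _ (@HJt_cvg y).
all: have ay := fy _ (@HJa_cvg y).
all: have cy := fy _ (@HJc_cvg y).
all: have zy := fy _ (@HJz_cvg y).
- exact: cvgM tx ty.
- exact: cvgD (cvgM (cvgV (HJt_neq0 y) ty) ax) ay.
- exact: cvgD (cvgM ty cx) cy.
- exact: cvgD (cvgD zx zy) (cvgM (cvgM ty cx) ay).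
Qed.

Let HJinv_continuous : continuous (fun x : HJ R => (x^-1)%g).
Proof.
apply: HJ_continuous => x.
- exact: cvgV (HJt_neq0 x) (@HJt_cvg x).
- exact: cvgN (cvgM (@HJt_cvg x) (@HJa_cvg x)).
- exact: cvgN (cvgM (cvgV (HJt_neq0 x) (@HJt_cvg x)) (@HJc_cvg x)).
- exact: cvgB (cvgM (@HJc_cvg x) (@HJa_cvg x)) (@HJz_cvg x).
Qed.

HB.instance Definition _ :=
  Group_Topological_isTopologicalGroup.Build (HJ R)
    HJmul_continuous HJinv_continuous.

Lemma HJ_solvable : solvable_group (HJ R).
Proof.
have ME (x y : HJ R) : (x * y)%g = HJmul x y by [].
have VE (x : HJ R) : (x^-1)%g = HJinv x by [].
have RE (x y : HJ R) :
    commg x y = HJmul (HJinv x) (HJmul (HJinv y) (HJmul x y)) by [].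
pose A1 := [set x : HJ R | HJt x = 1].
pose A2 := [set x : HJ R | [/\ HJt x = 1, HJa x = 0 & HJc x = 0]].
have s1 : is_subgroup A1.
  split=> [//|x y|x]; rewrite /A1/= ?ME ?VE/=.
    by move=> -> ->; exact: mulr1.
  by move=> ->; exact: invr1.
have s2 : is_subgroup A2.
  split=> [//|x y [xt xa xc] [yt ya yc]|x [xt xa xc]].
    by rewrite ME; split; rewrite /= ?xt ?xa ?xc ?yt ?ya ?yc; field.
  by rewrite VE; split; rewrite /= ?xt ?xa ?xc; field.
have s3 : is_subgroup [set 1%g : HJ R].
  by split=> [//|x y -> ->|x ->]; rewrite /= ?mulg1 ?invg1.
have sub n (A H : set (HJ R)) : is_subgroup H ->
    iter n (@derived_subgroup (HJ R)) setT `<=` A ->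
    (forall a b, A a -> A b -> H (commg a b)) ->
    iter n.+1 (@derived_subgroup (HJ R)) setT `<=` H.
  by move=> sH sA AH x; apply=> // a b /sA Aa /sA Ab; exact: AH.
have d1 : iter 1 (@derived_subgroup (HJ R)) setT `<=` A1.
  apply: (sub 0%N setT) => // x y _ _; rewrite RE /A1 /=.
  have x0 := HJt_neq0 x; have y0 := HJt_neq0 y.
  by field; apply/andP; split.
have d2 : iter 2 (@derived_subgroup (HJ R)) setT `<=` A2.
  apply: (sub 1%N A1) => // x y; rewrite /A1 RE /= => xt yt.
  by split=> /=; rewrite xt yt; field.
exists 3%N; apply: (sub 2%N A2) => // x y [xt xa xc] [yt ya yc].
by rewrite RE; apply: HJ_eq; rewrite /= xt yt ?xa ?ya ?xc ?yc; field.
Qed.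

End SubJacobiGroup.

Section ComplexL2.
Variable R : realType.
Local Notation C := R[i].

Definition e2pi (x : R) : C := cos (2 * pi * x) +i* sin (2 * pi * x).

Definition cmeasurable d (X : measurableType d) (f : X -> C) : Prop :=
  measurable_fun setT (fun x => complex.Re (f x)) /\
  measurable_fun setT (fun x => complex.Im (f x)).

Definition cintegral d (X : measurableType d)
    (mu : {measure set X -> \bar R}) (D : set X) (f : X -> C) : C :=
  (\int[mu]_(x in D) complex.Re (f x)) +i*
  (\int[mu]_(x in D) complex.Im (f x)).

Definition square_integrable d (X : measurableType d)
    (mu : {measure set X -> \bar R}) (D : set X) (f : X -> C) : Prop :=
  cmeasurable f /\
  mu.-integrable D (fun x => (ComplexField.Normc.normc (f x) ^+ 2)%:E).

Definition L2space d (X : measurableType d)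
    (mu : {measure set X -> \bar R}) (D : set X) : hspace R :=
  @HSpace R (X -> C^o) (@square_integrable d X mu D)
    (fun f g => cintegral mu D (fun x => f x * (g x)^*)).

(* The sum over Z, as the limit of the symmetric partial sums; it is only used
   for absolutely convergent families. *)
Definition sumZ (u : int -> C) : C :=
  let s (n : nat) := u 0 + \sum_(0 <= k < n) (u k.+1%:Z + u (- k.+1%:Z)) in
  limn (fun n => complex.Re (s n)) +i* limn (fun n => complex.Im (s n)).

Definition rschwartz (f : R -> R) : Prop :=
  forall n : nat, (forall x, derivable (derive1n n f) x 1) /\
    forall m : nat, exists B : R, forall x, `|x| ^+ m * `|derive1n n f x| <= B.

Definition schwartz (f : R -> C) : Prop :=
  rschwartz (fun x => complex.Re (f x)) /\
  rschwartz (fun x => complex.Im (f x)).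

End ComplexL2.

Section HeisenbergSpaces.
Variable R : realType.
Local Notation C := R[i].
Local Notation R3 := (R * R * R)%type.

Definition heis_mul (g h : R3) : R3 :=
  let: (a, c, z) := g in let: (a', c', z') := h in
  (a + a', c + c', z + z' + c * a').

Definition heisZ (m n k : int) : R3 := (m%:~R, n%:~R, k%:~R).

Definition leb3 :=
  ((@lebesgue_measure R \x @lebesgue_measure R) \x @lebesgue_measure R)%E.

Definition cube : set R3 := (`[0, 1] `*` `[0, 1]) `*` `[0, 1].

Definition L2R : hspace R := L2space (@lebesgue_measure R) setT.

Definition invariant_form (N : int) (F : R3 -> C) : Prop :=
  [/\ forall m n k g, F (heis_mul (heisZ m n k) g) = F g,
      square_integrable leb3 cube F &
      {ae leb3, forall g : R3, F g = e2pi (N%:~R * g.2) * F (g.1, 0)}].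

(* The equivariance condition refers to the null set z = 0, so it does not
   depend only on the class of F; the members of H_N are the measurable
   functions whose class contains a function as in [invariant_form]. *)
Definition HN (N : int) : hspace R :=
  @hsub R (L2space leb3 cube)
    [set F | cmeasurable (F : R3 -> C) /\
       exists2 F' : R3 -> C, invariant_form N F' &
         {ae leb3, forall g : R3, F g = F' g}].

Definition rho (h : R3) (F : R3 -> C) : R3 -> C := fun g => F (heis_mul g h).

Record dirichlet_character (d : nat) (chi : int -> C) : Prop :=
  DirichletCharacter {
  dirichlet1 : chi 1 = 1;
  dirichletM : forall m n, chi (m * n) = chi m * chi n;
  dirichlet_periodic : forall n, chi (n + d%:Z) = chi n;
  dirichlet_neq0 : forall n, (chi n != 0) = coprimez n d%:Z }.

(* chi (n d / N), with value 0 when n d / N is not an integer *)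
Definition chi_frac (N : int) (d : nat) (chi : int -> C) (n : int) : C :=
  if (N %| n * d%:Z)%Z then chi ((n * d%:Z) %/ N)%Z else 0.

Definition W_schwartz (N : int) (d : nat) (chi : int -> C) (f : R -> C)
    (g : R3) : C :=
  let: (a, c, z) := g in
  sqrtC (N%:~R / (totient d)%:R) * e2pi (N%:~R * z) *
  sumZ (fun n => chi_frac N d chi n * f (n%:~R + N%:~R * c) *
                 e2pi (n%:~R * a)).

Definition isometric_extension (N : int) (d : nat) (chi : int -> C)
    (T : (R -> C) -> R3 -> C) : Prop :=
  @hisometry R L2R (HN N) T /\
  forall f, schwartz f -> @heq R (HN N) (T f) (W_schwartz N d chi f).

(* The isometric extension, which is unique up to a.e. equality. *)
Definition W (N : int) (d : nat) (chi : int -> C) : (R -> C) -> R3 -> C :=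
  xget (fun _ _ => 0) (isometric_extension N d chi).

Definition HNd (N : int) (d : nat) (chi : int -> C) : hspace R :=
  @hsub R (HN N)
    [set F | exists2 f, @hmem R L2R f & @heq R (HN N) (W N d chi f) F].

Definition Winv (N : int) (d : nat) (chi : int -> C) (F : R3 -> C) : R -> C :=
  xget (fun _ => 0)
    [set f | @hmem R L2R f /\ @heq R (HN N) (W N d chi f) F].

Definition U (t : R) (f : R -> C) : R -> C :=
  fun x => (`|t| `^ 2^-1)%:C * f (t * x).

Definition V (N : int) (d : nat) (chi : int -> C) (t : R) (F : R3 -> C) :
    R3 -> C :=
  W N d chi (U t (Winv N d chi F)).

Definition rhoJ (N : int) (d : nat) (chi : int -> C) (g : HJ R)
    (F : hcar (HNd N d chi)) : hcar (HNd N d chi) :=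
  V N d chi (HJt g) (rho (HJa g, HJc g, HJz g) F).

Definition has_central_character (N : int) (d : nat) (chi : int -> C) : Prop :=
  forall (z : R) (F : hcar (HNd N d chi)), hmem F ->
    heq (rhoJ (mkHJ (oner_neq0 R) 0 0 z) F) (e2pi (N%:~R * z) *: F).

End HeisenbergSpaces.

(* Main.v *)
From HB Require Import structures.
Require Import Defs.
From mathcomp Require Import all_boot all_order all_algebra.
From mathcomp Require Import complex ring lra zify finmap.
From mathcomp Require Import all_classical all_reals all_analysis.
From mathcomp Require Import measurable_realfun.
From mathcomp Require cyclic.

Set Implicit Arguments.
Unset Strict Implicit.
Unset Printing Implicit Defensive.

Import Order.TTheory GRing.Theory Num.Theory numFieldNormedType.Exports.

Local Open Scope classical_set_scope.
Local Open Scope complex_scope.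
Local Open Scope ring_scope.

(** Write e(x) for exp(2 pi i x). Everything is transported to L^2(R) by the isometry [W]. Under it
    [1, a, c, z] becomes f |-> e(N z + a x) f(x + N c), because a right translation by the
    Heisenberg group acts on the defining series term by term ([W_schwartz_intertwine], [W_rho]),
    and V(t) becomes U(t) by definition. Hence [rhoJ] corresponds to the operators [schr N], f |->
    |t|^(1/2) e(N z + a t x) f(t x + N c), in which neither d nor chi occurs ([rhoJ_W]). Unitarity,
    strong continuity and irreducibility are proved for [schr N] and carried over ([transport_rep],
    [transport_irreducible]); two representations with the same N are equivalent because both are
    equivalent to [schr N] ([transport_equivalent]). Conversely, an equivalence preserves the
    central character e(N z), and z = 1 / (2 (N - N')) tells N from N'.

    Irreducibility ([schr_irreducible]). A closed invariant subspace S is stable under f |-> e(a x)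
    f. Polynomials in sines and pointwise limits then make it stable under multiplication by sgn(x -
    s), hence by the indicator of any measurable set ([S_restr]). It is also stable under f |-> f(t
    x + b) with t <> 0. If f in S does not vanish almost everywhere, take a Lebesgue point x0 of its
    truncations with f(x0) <> 0: zooming in at x0 yields the constant f(x0) on every bounded
    interval ([S_dilate_limit]), and indicators of intervals are total ([S_full], [L2R_total]).

    Isometry of [W] ([W_schwartz_norm]). Parseval in a turns the squared norm of the series into |N|
    / phi(d) times the integral over c in [0, 1] of the sum over n of |chi(n d / N)|^2 |f(n + N
    c)|^2. After the substitution x = n + N c almost every x is reached from |N| consecutive
    integers n, and in such a window chi(n d / N) has modulus 1 exactly phi(d) times and is 0
    otherwise ([chi_frac_window]), so the constants cancel.

    Existence of [W]. The series is studied on the class [decaying], which is dense in L^2(R), and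
    extended by pointwise limits along rapidly convergent sequences ([Wext]); such limits keep
    invariance and equivariance valid at every point. Density of the Schwartz functions
    ([schwartz_total]) identifies [W] with this extension ([W_Wext]). *)

Local Notation normc := ComplexField.Normc.normc.

(** * Complex numbers through their real and imaginary parts *)

Section ComplexParts.
Variable R : realType.
Implicit Types z w : R[i].

Lemma conjcE z : z^* = conjc z. Proof. by []. Qed.

Lemma Re_conj z : complex.Re z^* = complex.Re z.
Proof. by rewrite conjcE; case: z. Qed.

Lemma Im_conj z : complex.Im z^* = - complex.Im z.
Proof. by rewrite conjcE; case: z. Qed.

Lemma ReD z w : complex.Re (z + w) = complex.Re z + complex.Re w.
Proof. by case: z w => ? ? []. Qed.

Lemma ImD z w : complex.Im (z + w) = complex.Im z + complex.Im w.
Proof. by case: z w => ? ? []. Qed.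

Lemma ReN z : complex.Re (- z) = - complex.Re z.
Proof. by case: z. Qed.

Lemma ImN z : complex.Im (- z) = - complex.Im z.
Proof. by case: z. Qed.

Lemma ReM z w : complex.Re (z * w) =
  complex.Re z * complex.Re w - complex.Im z * complex.Im w.
Proof. by case: z w => ? ? []. Qed.

Lemma ImM z w : complex.Im (z * w) =
  complex.Re z * complex.Im w + complex.Im z * complex.Re w.
Proof. by case: z w => ? ? []. Qed.

Lemma ReZr (a : R) z : complex.Re (a%:C * z) = a * complex.Re z.
Proof. by case: z => x y /=; rewrite mul0r subr0. Qed.

Lemma ImZr (a : R) z : complex.Im (a%:C * z) = a * complex.Im z.
Proof. by case: z => x y /=; rewrite mul0r addr0. Qed.

Lemma complex_eq z w : complex.Re z = complex.Re w ->
  complex.Im z = complex.Im w -> z = w.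
Proof. by case: z w => ? ? [? ?] /= -> ->. Qed.

Lemma normc_sqr z : ComplexField.Normc.normc z ^+ 2 =
  complex.Re z ^+ 2 + complex.Im z ^+ 2.
Proof. by case: z => x y /=; rewrite sqr_sqrtr// addr_ge0// sqr_ge0. Qed.

Lemma normc_ge0 z : 0 <= ComplexField.Normc.normc z.
Proof. by case: z => x y; exact: sqrtr_ge0. Qed.

Lemma mulc_conj z : z * z^* = (ComplexField.Normc.normc z ^+ 2)%:C.
Proof.
rewrite conjcE normc_sqr; case: z => x y.
by apply: complex_eq => /=; ring.
Qed.

End ComplexParts.

(** * Semidefinite inner product spaces and isometries *)

(** [is_hilbert] without completeness. It passes to every subspace, whereas completeness of [HNd] is
    obtained only late, by transport along [W]. *)
Record prehilbert (R : realType) (E : hspace R) : Prop := PreHilbert {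
  ph_subspace : hsubspace (@hmem R E);
  ph_linear : forall (a : R[i]) (u v w : hcar E),
    hmem u -> hmem v -> hmem w ->
    hinner (a *: u + v) w = a * hinner u w + hinner v w;
  ph_hermitian : forall u v : hcar E, hmem u -> hmem v ->
    hinner v u = (hinner u v)^*;
  ph_ge0 : forall u : hcar E, hmem u -> 0 <= hinner u u }.

Lemma prehilbert_hilbert (R : realType) (E : hspace R) :
  is_hilbert E -> prehilbert E.
Proof. by case=> *; split. Qed.

Lemma prehilbert_hsub (R : realType) (E : hspace R) (S : set (hcar E)) :
  prehilbert E -> hsubspace S -> prehilbert (hsub S).
Proof.
move=> [Es El Eh Eg] Ss; have [SE S0 Sl] := Ss; split.
- by split.
- by move=> a u v w /SE ? /SE ? /SE ?; exact: El.
- by move=> u v /SE ? /SE ?; exact: Eh.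
- by move=> u /SE ?; exact: Eg.
Qed.

Section PreHilbertTheory.
Variables (R : realType) (E : hspace R).
Hypothesis EP : prehilbert E.
Implicit Types u v w : hcar E.
Local Notation C := R[i].

Lemma hmem0 : @hmem R E 0.
Proof. by case: (ph_subspace EP). Qed.

Lemma hmemZD (a : C) u v : hmem u -> hmem v -> hmem (a *: u + v).
Proof. by case: (ph_subspace EP) => _ _; exact. Qed.

Lemma hmemD u v : hmem u -> hmem v -> hmem (u + v).
Proof. by move=> hu hv; rewrite -[u]scale1r; exact: hmemZD. Qed.

Lemma hmemZ (a : C) u : hmem u -> hmem (a *: u).
Proof. by move=> hu; rewrite -[_ *: _]addr0; exact: hmemZD hu hmem0. Qed.

Lemma hmemN u : hmem u -> hmem (- u).
Proof. by rewrite -scaleN1r; exact: hmemZ. Qed.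

Lemma hmemB u v : hmem u -> hmem v -> hmem (u - v).
Proof. by move=> hu /hmemN; exact: hmemD. Qed.

Lemma hinnerDl u v w : hmem u -> hmem v -> hmem w ->
  hinner (u + v) w = hinner u w + hinner v w.
Proof.
by move=> hu hv hw; have := ph_linear EP 1 hu hv hw; rewrite scale1r mul1r.
Qed.

Lemma hinner0l w : hmem w -> hinner 0 w = 0.
Proof.
move=> hw; have := hinnerDl hmem0 hmem0 hw; rewrite addr0 => /eqP.
by rewrite -subr_eq subrr => /eqP.
Qed.

Lemma hinnerZl (a : C) u w : hmem u -> hmem w ->
  hinner (a *: u) w = a * hinner u w.
Proof.
move=> hu hw; have := ph_linear EP a hu hmem0 hw.
by rewrite addr0 hinner0l// addr0.
Qed.

Lemma hinnerNl u w : hmem u -> hmem w -> hinner (- u) w = - hinner u w.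
Proof. by move=> hu hw; rewrite -scaleN1r hinnerZl// mulN1r. Qed.

Lemma hinnerBl u v w : hmem u -> hmem v -> hmem w ->
  hinner (u - v) w = hinner u w - hinner v w.
Proof. by move=> hu hv hw; rewrite hinnerDl ?hinnerNl//; exact: hmemN. Qed.

Lemma hinnerBr u v w : hmem u -> hmem v -> hmem w ->
  hinner w (u - v) = hinner w u - hinner w v.
Proof.
move=> hu hv hw; rewrite (ph_hermitian EP (hmemB hu hv) hw) hinnerBl// rmorphB/=.
by rewrite -!(ph_hermitian EP).
Qed.

Lemma hinnerDr u v w : hmem u -> hmem v -> hmem w ->
  hinner w (u + v) = hinner w u + hinner w v.
Proof.
move=> hu hv hw; rewrite (ph_hermitian EP (hmemD hu hv) hw) hinnerDl// rmorphD/=.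
by rewrite -!(ph_hermitian EP).
Qed.

Lemma hinnerZr (a : C) u w : hmem u -> hmem w ->
  hinner w (a *: u) = a^* * hinner w u.
Proof.
move=> hu hw; rewrite (ph_hermitian EP (hmemZ a hu) hw) hinnerZl// rmorphM/=.
by rewrite -!(ph_hermitian EP).
Qed.

Lemma hnorm_ge0 u : 0 <= hnorm u.
Proof. exact: sqrtr_ge0. Qed.

Lemma hinnerE u : hmem u -> hinner u u = (hnorm u ^+ 2)%:C.
Proof.
move=> hu; have := ph_ge0 EP hu; rewrite /hnorm.
case: (hinner u u) => a b /=; rewrite lecE/= => /andP[/eqP -> a0].
by rewrite sqr_sqrtr.
Qed.

Lemma hnorm_sqr u : hmem u -> hnorm u ^+ 2 = complex.Re (hinner u u).
Proof. by move=> hu; rewrite hinnerE. Qed.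

Lemma hnorm_addZ_sqr u v (s : R) : hmem u -> hmem v ->
  hnorm (u + s%:C *: v) ^+ 2 =
  hnorm u ^+ 2 + 2 * s * complex.Re (hinner u v) + s ^+ 2 * hnorm v ^+ 2.
Proof.
move=> hu hv; have hsv := hmemZ s%:C hv.
rewrite !hnorm_sqr ?hinnerDl ?hinnerDr//; try exact: hmemD.
rewrite !(hinnerZl, hinnerZr)//.
have -> : (s%:C^* = s%:C :> C) by exact: conjc_real.
rewrite (ph_hermitian EP hu hv) !ReD !ReZr Re_conj; ring.
Qed.

(** Cauchy-Schwarz: the quadratic s |-> |u + s v|^2 is nonnegative. The form is only semidefinite,
    so the case |v| = 0 is separate. *)
Lemma Re_hinner_le u v : hmem u -> hmem v ->
  complex.Re (hinner u v) <= hnorm u * hnorm v.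
Proof.
move=> hu hv; set r := complex.Re _.
have H (s : R) : 0 <= hnorm u ^+ 2 + 2 * s * r + s ^+ 2 * hnorm v ^+ 2.
  by rewrite -hnorm_addZ_sqr// sqr_ge0.
have u0 := hnorm_ge0 u; have v0 := hnorm_ge0 v.
have [v00|vn0] := eqVneq (hnorm v) 0.
  rewrite v00 mulr0 leNgt; apply/negP => r0.
  (* For |v| = 0 the quadratic is affine in s; at this s it equals -1. *)
  have := H (- (hnorm u ^+ 2 + 1) / (2 * r)).
  rewrite v00 expr0n mulr0 addr0 leNgt => /negP; apply.
  have -> : 2 * (- (hnorm u ^+ 2 + 1) / (2 * r)) * r = - (hnorm u ^+ 2 + 1).
    by field; rewrite gt_eqF.
  lra.
have vp : 0 < hnorm v by rewrite lt0r vn0.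
have [r0|r0] := lerP r 0; first by rewrite (le_trans r0)// mulr_ge0.
rewrite -(@ler_pXn2r _ 2) ?nnegrE ?(ltW r0) ?mulr_ge0//.
(* The minimum of the quadratic. *)
have := H (- r / hnorm v ^+ 2).
have -> : hnorm u ^+ 2 + 2 * (- r / hnorm v ^+ 2) * r +
   (- r / hnorm v ^+ 2) ^+ 2 * hnorm v ^+ 2 =
   hnorm u ^+ 2 - r ^+ 2 / hnorm v ^+ 2 by field.
rewrite subr_ge0 ler_pdivrMr ?exprn_gt0//.
by rewrite exprMn.
Qed.

Lemma hnormZ (a : C) u : hmem u -> hnorm (a *: u) = ComplexField.Normc.normc a * hnorm u.
Proof.
move=> hu; apply/eqP.
rewrite -(@eqrXn2 _ 2) ?mulr_ge0 ?normc_ge0 ?hnorm_ge0//.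
rewrite hnorm_sqr; last exact: hmemZ.
rewrite hinnerZl//; last exact: hmemZ.
rewrite hinnerZr// hinnerE//.
rewrite mulrA.
by rewrite mulc_conj ReZr /= exprMn.
Qed.

Lemma hnormN u : hmem u -> hnorm (- u) = hnorm u.
Proof.
move=> hu; rewrite -scaleN1r hnormZ// /ComplexField.Normc.normc /=.
by rewrite oppr0 expr0n addr0 sqrrN expr1n sqrtr1 mul1r.
Qed.

Lemma hnormD u v : hmem u -> hmem v -> hnorm (u + v) <= hnorm u + hnorm v.
Proof.
move=> hu hv.
rewrite -(@ler_pXn2r _ 2) ?nnegrE ?addr_ge0 ?hnorm_ge0//.
rewrite -[v in X in X <= _]scale1r (_ : 1 = 1%:C)// hnorm_addZ_sqr//.
have := Re_hinner_le hu hv; rewrite sqrrD expr1n; lra.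
Qed.

Lemma hnormB_sym u v : hmem u -> hmem v -> hnorm (u - v) = hnorm (v - u).
Proof. by move=> hu hv; rewrite -opprB hnormN//; exact: hmemB. Qed.

Lemma hnormB_le u v w : hmem u -> hmem v -> hmem w ->
  hnorm (u - w) <= hnorm (u - v) + hnorm (v - w).
Proof.
move=> hu hv hw; have -> : u - w = (u - v) + (v - w) by rewrite addrA subrK.
by apply: hnormD; exact: hmemB.
Qed.

Lemma hnorm0 : hnorm (0 : hcar E) = 0.
Proof. by rewrite /hnorm hinner0l ?sqrtr0//; exact: hmem0. Qed.

Lemma hnormB_sub u v : hmem u -> hmem v -> hnorm u - hnorm v <= hnorm (u - v).
Proof.
move=> hu hv; rewrite lerBlDr -[u in X in X <= _](subrK v).
by apply: hnormD => //; exact: hmemB.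
Qed.

Lemma heq_refl u : hmem u -> heq u u.
Proof. by move=> hu; split; rewrite ?subrr ?hnorm0. Qed.

Lemma heq_sym u v : heq u v -> heq v u.
Proof. by move=> [hu hv uv]; split=> //; rewrite hnormB_sym. Qed.

Lemma heq_trans u v w : heq u v -> heq v w -> heq u w.
Proof.
move=> [hu hv uv] [_ hw vw]; split=> //; apply/eqP.
rewrite eq_le hnorm_ge0 andbT (le_trans (hnormB_le hu hv hw))//.
by rewrite uv vw addr0.
Qed.

Lemma heqZD (a : C) u u' v v' : heq u u' -> heq v v' ->
  heq (a *: u + v) (a *: u' + v').
Proof.
move=> [hu hu' uu'] [hv hv' vv']; split; rewrite ?hmemZD//; try exact: hmemZD.
rewrite opprD addrACA -scalerBr; apply/eqP.
rewrite eq_le hnorm_ge0 andbT (le_trans (hnormD _ _))//.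
- by apply/hmemZ/hmemB.
- exact: hmemB.
- by rewrite hnormZ ?uu' ?vv' ?mulr0 ?addr0//; exact: hmemB.
Qed.

Lemma heqZ (a : C) u u' : heq u u' -> heq (a *: u) (a *: u').
Proof.
move=> uu'; rewrite -[a *: u]addr0 -[a *: u']addr0; apply: heqZD => //.
exact/heq_refl/hmem0.
Qed.

Lemma heqB u u' v v' : heq u u' -> heq v v' -> heq (u - v) (u' - v').
Proof.
move=> uu' vv'; rewrite -(scale1r u) -(scale1r u'); apply: heqZD => //.
by rewrite -(scaleN1r v) -(scaleN1r v'); exact: heqZ.
Qed.

Lemma heq_hnorm u v : heq u v -> hnorm u = hnorm v.
Proof.
move=> [hu hv uv]; apply/eqP; rewrite eq_le.
have := hnormB_sub hu hv; have := hnormB_sub hv hu.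
by rewrite -(hnormB_sym hu hv) uv !subr_le0 => -> ->.
Qed.

Lemma heq_cvgB (u : nat -> hcar E) v w : (forall n, hmem (u n)) -> heq v w ->
  hnorm (u n - v) @[n --> \oo] --> (0 : R) ->
  hnorm (u n - w) @[n --> \oo] --> (0 : R).
Proof.
move=> hu vw; have [hv hw _] := vw.
suff -> : (fun n => hnorm (u n - v)) = (fun n => hnorm (u n - w)) by [].
by apply/funext => n; apply/heq_hnorm/heqB => //; exact/heq_refl.
Qed.

Lemma hlim_unique (u : nat -> hcar E) v w : (forall n, hmem (u n)) ->
  hmem v -> hmem w ->
  hnorm (u n - v) @[n --> \oo] --> (0 : R) ->
  hnorm (u n - w) @[n --> \oo] --> (0 : R) -> heq v w.
Proof.
move=> hu hv hw uv uw; split => //; apply/eqP; rewrite eq_le hnorm_ge0 andbT.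
have : hnorm (u n - v) + hnorm (u n - w) @[n --> \oo] --> (0 : R).
  by rewrite -[0]addr0; exact: cvgD.
move/(ler_cvg_to (@cvg_cst _ (hnorm (v - w)) _ \oo _)); apply.
apply: nearW => n; rewrite (le_trans (hnormB_le hv (hu n) hw))//.
by rewrite hnormB_sym.
Qed.

Lemma abs_Re_hinner u v : hmem u -> hmem v ->
  `|complex.Re (hinner u v)| <= hnorm u * hnorm v.
Proof.
move=> hu hv; rewrite ler_norml Re_hinner_le// andbT.
have := Re_hinner_le (hmemN hu) hv; rewrite hnormN// hinnerNl//.
by rewrite ReN lerNl.
Qed.

Lemma abs_Im_hinner u v : hmem u -> hmem v ->
  `|complex.Im (hinner u v)| <= hnorm u * hnorm v.
Proof.
move=> hu hv; have := abs_Re_hinner (hmemZ (0 +i* 1) hu) hv.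
rewrite hinnerZl// hnormZ// /= expr0n expr1n add0r sqrtr1 mul1r.
by rewrite ReM mul0r mul1r sub0r normrN.
Qed.

Lemma cvg_hinner (u v : nat -> hcar E) f g :
  (forall n, hmem (u n)) -> (forall n, hmem (v n)) -> hmem f -> hmem g ->
  hnorm (u n - f) @[n --> \oo] --> (0 : R) ->
  hnorm (v n - g) @[n --> \oo] --> (0 : R) ->
  complex.Re (hinner (u n) (v n)) @[n --> \oo] --> complex.Re (hinner f g) /\
  complex.Im (hinner (u n) (v n)) @[n --> \oo] --> complex.Im (hinner f g).
Proof.
move=> hu hv hf hg uf vg.
have B n : hinner (u n) (v n) - hinner f g =
    hinner (u n - f) (v n - g) + hinner f (v n - g) + hinner (u n - f) g.
  have h1 := hmemB (hu n) hf; have h2 := hmemB (hv n) hg.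
  rewrite hinnerBl// !hinnerBr// hinnerBl//; ring.
have L : hnorm (u n - f) * hnorm (v n - g) + hnorm f * hnorm (v n - g) +
    hnorm (u n - f) * hnorm g @[n --> \oo] --> (0 : R).
  rewrite (_ : 0 = 0 * 0 + hnorm f * 0 + 0 * hnorm g); last first.
    by rewrite !(mulr0, mul0r) !addr0.
  by apply: cvgD; [apply: cvgD; [exact: cvgM|exact: cvgMr]|exact: cvgMl].
by split; apply/cvgrPdist_le => e e0; near=> n;
  rewrite distrC -?(ReN, ImN) -?(ReD, ImD) B ?(ReD, ImD);
  rewrite (le_trans (ler_normD _ _))// (le_trans (lerD (ler_normD _ _) (lexx _)))//;
  (apply: (@le_trans _ _ (hnorm (u n - f) * hnorm (v n - g) + hnorm f * hnorm (v n - g) +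
    hnorm (u n - f) * hnorm g));
   [by rewrite !lerD// (abs_Re_hinner, abs_Im_hinner)//; exact: hmemB|
    apply: le_trans (ler_norm _) _; near: n; move/cvgr0Pnorm_le : L; exact]).
Unshelve. all: end_near. Qed.

End PreHilbertTheory.

Section IsometryTheory.
Variables (R : realType) (E F : hspace R).
Hypotheses (EP : prehilbert E) (FP : prehilbert F).
Variable T : hcar E -> hcar F.
Hypothesis TI : hisometry T.
Implicit Types u v w : hcar E.

Lemma iso_hnorm u : hmem u -> hnorm (T u) = hnorm u.
Proof. by move=> hu; rewrite /hnorm (hisometry_inner TI). Qed.

Lemma iso_heqB u v : hmem u -> hmem v -> heq (T (u - v)) (T u - T v).
Proof.
move=> hu hv; have := hisometry_linear TI (-1) hv hu.
by rewrite !scaleN1r [- v + u]addrC [- T v + T u]addrC.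
Qed.

Lemma iso_hnormB u v : hmem u -> hmem v -> hnorm (T u - T v) = hnorm (u - v).
Proof.
move=> hu hv; rewrite -(heq_hnorm FP (iso_heqB hu hv)) iso_hnorm//.
exact: hmemB.
Qed.

Lemma iso_heq u v : heq u v -> heq (T u) (T v).
Proof.
move=> [hu hv uv]; split; [exact: hisometry_mem|exact: hisometry_mem|].
by rewrite iso_hnormB.
Qed.

Lemma iso_heq_inj u v : hmem u -> hmem v -> heq (T u) (T v) -> heq u v.
Proof. by move=> hu hv [_ _ uv]; split=> //; rewrite -iso_hnormB. Qed.

(** [hisometry_linear] speaks of a u + v, so T 0 ~ 0 is needed; it is the case -1 of 0 + 0. *)
Lemma iso_heqZ (a : R[i]) u : hmem u -> heq (T (a *: u)) (a *: T u).
Proof.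
move=> hu; have h0 := hmem0 EP.
have T00 : heq (T 0) 0.
  have := hisometry_linear TI (-1) h0 h0.
  by rewrite !scaleN1r oppr0 addr0 addNr.
have := hisometry_linear TI a hu h0; rewrite addr0 => /(heq_trans FP); apply.
rewrite -[X in heq _ X]addr0; apply: (heqZD FP) => //.
exact/(heq_refl FP)/(hisometry_mem TI).
Qed.

End IsometryTheory.

(** * Measurable complex functions and their pointwise limits *)

Section CMeasurable.
Variables (R : realType) (d : measure_display) (X : measurableType d).
Implicit Types f g : X -> R[i].

Lemma cmeasurable_cst (a : R[i]) : cmeasurable (fun _ : X => a).
Proof. by split; exact: measurable_cst. Qed.

Lemma cmeasurableD f g : cmeasurable f -> cmeasurable g ->
  cmeasurable (fun x => f x + g x).
Proof.
move=> [f1 f2] [g1 g2]; split.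
  by under eq_fun do rewrite ReD; exact: measurable_funD.
by under eq_fun do rewrite ImD; exact: measurable_funD.
Qed.

Lemma cmeasurableM f g : cmeasurable f -> cmeasurable g ->
  cmeasurable (fun x => f x * g x).
Proof.
move=> [f1 f2] [g1 g2]; split.
  by under eq_fun do rewrite ReM; apply: measurable_funB; exact: measurable_funM.
by under eq_fun do rewrite ImM; apply: measurable_funD; exact: measurable_funM.
Qed.

Lemma cmeasurableZ (a : R[i]) f : cmeasurable f -> cmeasurable (fun x => a * f x).
Proof. by apply: cmeasurableM; exact: cmeasurable_cst. Qed.

Lemma cmeasurableN f : cmeasurable f -> cmeasurable (fun x => - f x).
Proof.
by move=> /(cmeasurableZ (-1)); under eq_fun do rewrite mulN1r.
Qed.

Lemma cmeasurableB f g : cmeasurable f -> cmeasurable g ->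
  cmeasurable (fun x => f x - g x).
Proof. by move=> mf /cmeasurableN; exact: cmeasurableD. Qed.

Lemma cmeasurable_conj f : cmeasurable f -> cmeasurable (fun x => (f x)^*).
Proof.
move=> [f1 f2]; split; first by under eq_fun do rewrite Re_conj.
by under eq_fun do rewrite Im_conj; exact: measurable_funN.
Qed.

Lemma cmeasurable_real (f : X -> R) : measurable_fun setT f ->
  cmeasurable (fun x => (f x)%:C).
Proof. by split => //; exact: measurable_cst. Qed.

Lemma cmeasurable_sum (I : Type) (s : seq I) (f : I -> X -> R[i]) :
  (forall i, cmeasurable (f i)) -> cmeasurable (fun x => \sum_(i <- s) f i x).
Proof.
move=> mf; elim: s => [|i s IH].
  by under eq_fun do rewrite big_nil; exact: cmeasurable_cst.
by under eq_fun do rewrite big_cons; exact: cmeasurableD.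
Qed.

Lemma cmeasurable_comp d' (Y : measurableType d') (h : Y -> X) f :
  measurable_fun setT h -> cmeasurable f -> cmeasurable (f \o h).
Proof. by move=> mh [f1 f2]; split; [exact: (measurableT_comp f1 mh)|exact: (measurableT_comp f2 mh)]. Qed.

Lemma measurable_normc_sqr f : cmeasurable f ->
  measurable_fun setT (fun x => ComplexField.Normc.normc (f x) ^+ 2).
Proof.
move=> [f1 f2]; under eq_fun do rewrite normc_sqr.
by apply: measurable_funD; exact: measurable_funX.
Qed.

End CMeasurable.

(* The pointwise limit, with the junk value 0 where the sequence diverges. *)
Definition clim (R : realType) (s : nat -> R[i]) : R[i] :=
  if `[< cvgn (fun n => complex.Re (s n)) /\ cvgn (fun n => complex.Im (s n)) >]
  then limn (fun n => complex.Re (s n)) +i* limn (fun n => complex.Im (s n))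
  else 0.

Section MeasurableLimits.
Variables (R : realType) (d : measure_display) (X : measurableType d).

(** Cauchy's criterion builds the convergence set from countable unions and intersections of
    measurable sets. *)
Lemma measurable_cvg_set (h : nat -> X -> R) :
  (forall n, measurable_fun setT (h n)) -> measurable [set x | cvgn (h ^~ x)].
Proof.
move=> mh.
have -> : [set x | cvgn (h ^~ x)] =
    \bigcap_k \bigcup_m \bigcap_i \bigcap_j
      [set x | `|h (m + i)%N x - h (m + j)%N x| < k.+1%:R^-1].
  apply/seteqP; split=> x /=.
    move=> /cauchy_cvgP /cauchyP /= hc k _.
    have /hc[y] : 0 < (k.+1%:R^-1 / 2 : R) by rewrite divr_gt0 ?invr_gt0.
    move=> [m _ hm]; exists m => // i _ j _ /=.
    have Hi : `|y - h (m + i)%N x| < k.+1%:R^-1 / 2 by apply: hm; exact: leq_addr.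
    have Hj : `|y - h (m + j)%N x| < k.+1%:R^-1 / 2 by apply: hm; exact: leq_addr.
    rewrite (_ : h (m + i)%N x - h (m + j)%N x =
      (y - h (m + j)%N x) - (y - h (m + i)%N x)); last by ring.
    by rewrite (le_lt_trans (ler_normB _ _))// [ltRHS]splitr ltrD.
  move=> H; apply/cauchy_cvgP/cauchyP => e e0 /=.
  have [k ke] : exists k : nat, k.+1%:R^-1 < e.
    exists (Num.trunc e^-1); rewrite invf_plt ?posrE//.
    exact: truncnS_gt.
  have [m _ hm] := H k I; exists (h m x); exists m => // j /= mj.
  rewrite /ball/= (lt_trans _ ke)//.
  by have := hm 0%N I (j - m)%N I; rewrite /= addn0 subnKC.
apply: bigcapT_measurable => k; apply: bigcup_measurable => m _.
apply: bigcapT_measurable => i; apply: bigcapT_measurable => j.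
have mf : measurable_fun setT (fun x => `|h (m + i)%N x - h (m + j)%N x|).
  by apply: measurableT_comp => //; exact: measurable_funB.
have := mf measurableT `]-oo, k.+1%:R^-1[%classic (measurable_itv _).
by rewrite setTI preimage_itvNyo.
Qed.

(** Multiplied by the indicator of the convergence set, the sequence converges everywhere, with
    limit 0 where [clim] takes its default value. *)
Lemma cmeasurable_clim (u : nat -> X -> R[i]) :
  (forall n, cmeasurable (u n)) -> cmeasurable (fun x => clim (u ^~ x)).
Proof.
move=> mu; pose A := [set x | cvgn (fun n => complex.Re (u n x))] `&`
  [set x | cvgn (fun n => complex.Im (u n x))].
have mA : measurable A.
  by apply: measurableI; apply: measurable_cvg_set => n; case: (mu n).
have mi : measurable_fun setT (\1_A : X -> R) by exact: measurable_indic.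
split.
- apply: (@measurable_realfun.measurable_fun_cvg _ _ _ _
    (fun n x => \1_A x * complex.Re (u n x))).
    by move=> n; apply: measurable_funM => //; case: (mu n).
  move=> x _; rewrite /clim indicE; case: asboolP => /= cv.
    by rewrite mem_set//; under eq_fun do rewrite mul1r; case: cv.
  by rewrite memNset//; under eq_fun do rewrite mul0r; exact: cvg_cst.
- apply: (@measurable_realfun.measurable_fun_cvg _ _ _ _
    (fun n x => \1_A x * complex.Im (u n x))).
    by move=> n; apply: measurable_funM => //; case: (mu n).
  move=> x _; rewrite /clim indicE; case: asboolP => /= cv.
    by rewrite mem_set//; under eq_fun do rewrite mul1r; case: cv.
  by rewrite memNset//; under eq_fun do rewrite mul0r; exact: cvg_cst.
Qed.

End MeasurableLimits.

(** * Square-integrable functions and the Riesz-Fischer theorem *)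

Lemma rapid_cvg (R : realType) (a : nat -> R) (s : R) :
  (forall k, `|a k.+1 - a k| <= s * 2^-1 ^+ k) ->
  cvgn a /\ forall n, `|a n - limn a| <= 2 * s * 2^-1 ^+ n.
Proof.
move=> ha.
have s0 : 0 <= s by have := le_trans (normr_ge0 _) (ha 0%N); rewrite mulr1.
(* Keeping the exact geometric partial sum 1 - 2^-k makes the induction close. *)
have H n k : `|a (n + k)%N - a n| <= 2 * s * 2^-1 ^+ n * (1 - 2^-1 ^+ k).
  elim: k => [|k IH]; first by rewrite addn0 subrr normr0 expr0 subrr mulr0.
  rewrite addnS -(subrK (a (n + k)%N) (a (n + k).+1)) -addrA.
  rewrite (le_trans (ler_normD _ _))//.
  rewrite (le_trans (lerD (ha _) IH))// exprD exprS; lra.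
have H' n m : (n <= m)%N -> `|a m - a n| <= 2 * s * 2^-1 ^+ n.
  move=> nm; rewrite -(subnKC nm) (le_trans (H _ _))//.
  rewrite ler_piMr ?mulr_ge0 ?exprn_ge0// gerBl exprn_ge0//.
have g0 : 2 * s * 2^-1 ^+ n @[n --> \oo] --> (0 : R).
  rewrite -(mulr0 (2 * s)); apply: cvgMr; apply: cvg_expr.
  by rewrite ger0_norm//; lra.
have ca : cvgn a.
  apply/cauchy_cvgP/cauchyP => e e0.
  move/cvgr0Pnorm_lt: g0 => /(_ _ e0)[n _ hn].
  exists (a n), n => // m /= nm; rewrite /ball /= distrC.
  rewrite (le_lt_trans (H' _ _ nm))// (le_lt_trans (ler_norm _))//.
  by apply: hn => /=.
split => // n.
have : `|a n - a m| @[m --> \oo] --> `|a n - limn a|.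
  by apply: cvg_norm; apply: cvgB => //; exact: cvg_cst.
move/(fun h => ler_cvg_to h (@cvg_cst _ (2 * s * 2^-1 ^+ n) _ \oo _)); apply.
exists n => // m /= nm; rewrite distrC; exact: H'.
Qed.

Lemma abs_mulD_le (R : realType) (a b c e : R) :
  `|a * c + b * e| <= a ^+ 2 + b ^+ 2 + (c ^+ 2 + e ^+ 2).
Proof.
have := sqr_ge0 (a + c); have := sqr_ge0 (a - c).
have := sqr_ge0 (b + e); have := sqr_ge0 (b - e).
rewrite ler_norml !sqrrD !sqrrN !mulrN; move=> *; apply/andP; split; nra.
Qed.

Section L2Basics.
Variables (R : realType) (d : measure_display) (X : measurableType d).
Variables (mu : {measure set X -> \bar R}) (D : set X).
Hypothesis mD : measurable D.
Implicit Types f g h : X -> R[i].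
Local Notation L2 := (L2space mu D).

Lemma square_integrable_le f (h : X -> R) : cmeasurable f ->
  mu.-integrable D (EFin \o h) ->
  (forall x, D x -> normc (f x) ^+ 2 <= h x) ->
  square_integrable mu D f.
Proof.
move=> mf ih fh; split=> //.
apply: le_integrable ih => //.
  apply/measurable_EFinP; apply: measurable_funTS; exact: measurable_normc_sqr.
move=> x Dx /=; rewrite lee_fin ger0_norm ?sqr_ge0//.
by rewrite (le_trans (fh _ Dx))// ler_norm.
Qed.

Lemma cprod_integrable f g : square_integrable mu D f -> square_integrable mu D g ->
  mu.-integrable D (fun x => (complex.Re (f x * (g x)^*))%:E) /\
  mu.-integrable D (fun x => (complex.Im (f x * (g x)^*))%:E).
Proof.
move=> [mf fi] [mg gi].
have [m1 m2] := cmeasurableM mf (cmeasurable_conj mg).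
have ifg := integrableD mD fi gi.
split; apply: le_integrable ifg => //; first 1 [exact/measurable_EFinP/measurable_funTS|idtac].
- move=> x Dx /=; rewrite lee_fin !normc_sqr ReM Re_conj Im_conj.
  move: (complex.Re (f x)) (complex.Im (f x)) (complex.Re (g x)) (complex.Im (g x)) => a b c e.
  rewrite [leRHS]ger0_norm ?addr_ge0 ?sqr_ge0//.
  rewrite mulrN opprK; exact: abs_mulD_le.
- exact/measurable_EFinP/measurable_funTS.
- move=> x Dx /=; rewrite lee_fin !normc_sqr ImM Re_conj Im_conj.
  move: (complex.Re (f x)) (complex.Im (f x)) (complex.Re (g x)) (complex.Im (g x)) => a b c e.
  rewrite [leRHS]ger0_norm ?addr_ge0 ?sqr_ge0//.
  rewrite mulrN addrC -mulNr (le_trans (abs_mulD_le _ _ _ _))// sqrrN; lra.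
Qed.

Lemma square_integrableZD (a : R[i]) f g :
  square_integrable mu D f -> square_integrable mu D g ->
  square_integrable mu D (fun x => a * f x + g x).
Proof.
move=> [mf fi] [mg gi].
apply: (@square_integrable_le _
  (fun x => 2 * normc a ^+ 2 * normc (f x) ^+ 2 + 2 * normc (g x) ^+ 2)).
- by apply: cmeasurableD => //; exact: cmeasurableZ.
- apply: eq_integrable (integrableD mD (integrableZl mD (2 * normc a ^+ 2) fi)
    (integrableZl mD 2 gi)) => // x _ /=.
- move=> x _; rewrite !normc_sqr ReD ImD ReM ImM.
  move: (complex.Re a) (complex.Im a) (complex.Re (f x)) (complex.Im (f x))
    (complex.Re (g x)) (complex.Im (g x)) => b c e k u v.
  rewrite -subr_ge0 (_ : _ - _ = ((b * e - c * k) - u) ^+ 2 +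
    ((b * k + c * e) - v) ^+ 2); first by rewrite addr_ge0 ?sqr_ge0.
  ring.
Qed.

Lemma square_integrable0 : square_integrable mu D (fun _ => 0).
Proof.
apply: (@square_integrable_le _ (cst 0)); first exact: cmeasurable_cst.
  exact: integrable0.
by move=> x _; rewrite normc_sqr /= expr0n addr0.
Qed.

Lemma L2_prehilbert : prehilbert L2.
Proof.
split=> /=.
- split=> //; first exact: square_integrable0.
  by move=> a u v hu hv; exact: square_integrableZD.
- move=> a u v w hu hv hw; rewrite /cintegral.
  have [r1 i1] := cprod_integrable hu hw; have [r2 i2] := cprod_integrable hv hw.
  have ZE (b : R) (k : X -> R) : mu.-integrable D (EFin \o k) ->
      mu.-integrable D (EFin \o (fun x => b * k x)).
    by move=> /(integrableZl mD b).
  apply: complex_eq; rewrite ?(ReD, ImD) ?(ReM, ImM) /=.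
  + rewrite -RintegralZl// -RintegralZl// -RintegralB//; try exact: ZE.
    rewrite -RintegralD//; last first.
      by have := integrableB mD (ZE (complex.Re a) _ r1) (ZE (complex.Im a) _ i1).
    apply: eq_Rintegral => x _ /=.
    have -> : (a *: u + v) x = a * u x + v x by [].
    rewrite !(ReM, ImM, ReD, ImD, Re_conj, Im_conj); ring.
  + rewrite -RintegralZl// -RintegralZl// -RintegralD//; try exact: ZE.
    rewrite -RintegralD//; last first.
      by have := integrableD mD (ZE (complex.Re a) _ i1) (ZE (complex.Im a) _ r1).
    apply: eq_Rintegral => x _ /=.
    have -> : (a *: u + v) x = a * u x + v x by [].
    rewrite !(ReM, ImM, ReD, ImD, Re_conj, Im_conj); ring.
- move=> u v hu hv; rewrite /cintegral conjcE /=.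
  have [r1 i1] := cprod_integrable hu hv.
  apply: complex_eq => /=.
    by apply: eq_Rintegral => x _; rewrite !(ReM, Re_conj, Im_conj); ring.
  rewrite -[RHS]mulN1r -RintegralZl//.
  by apply: eq_Rintegral => x _; rewrite !(ImM, Re_conj, Im_conj); ring.
- move=> u hu; rewrite /cintegral lecE /=; apply/andP; split.
    apply/eqP; rewrite (_ : (fun x => complex.Im _) = cst 0).
      by rewrite Rintegral_cst// mul0r.
    by apply/funext => x; rewrite mulc_conj.
  by apply: Rintegral_ge0 => x _; rewrite mulc_conj /= sqr_ge0.
Qed.

Lemma L2_hnorm_sqr f : square_integrable mu D f ->
  @hnorm R L2 f ^+ 2 = \int[mu]_(x in D) (normc (f x) ^+ 2).
Proof.
move=> hf; rewrite (@hnorm_sqr _ L2 L2_prehilbert)//= /cintegral /=.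
by apply: eq_Rintegral => x _; rewrite mulc_conj.
Qed.

Lemma L2_hnorm_sqrE f : square_integrable mu D f ->
  (@hnorm R L2 f ^+ 2)%:E = (\int[mu]_(x in D) (normc (f x) ^+ 2)%:E)%E.
Proof.
move=> hf; rewrite L2_hnorm_sqr// fineK//; apply: integrable_fin_num => //.
by case: hf.
Qed.

Lemma L2_hnorm_ae f : square_integrable mu D f ->
  @hnorm R L2 f = 0 <-> {ae mu, forall x, D x -> f x = 0}.
Proof.
move=> hf; have -> : @hnorm R L2 f = 0 <->
    (\int[mu]_(x in D) `|(normc (f x) ^+ 2)%:E| = 0)%E.
  rewrite (_ : (fun x => `|(normc (f x) ^+ 2)%:E|%E) =
     (fun x => (normc (f x) ^+ 2)%:E)); last first.
    by apply/funext => x; rewrite gee0_abs// lee_fin sqr_ge0.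
  rewrite -L2_hnorm_sqrE//; split=> [->|/eqP]; first by rewrite expr0n.
  by rewrite eqe sqrf_eq0 => /eqP.
have mf : measurable_fun D (fun x => (normc (f x) ^+ 2)%:E).
  by apply/measurable_EFinP/measurable_funTS/measurable_normc_sqr; case: hf.
have [H1 H2] := ae_eq_integral_abs mu mD mf.
split=> [/H1|H].
  apply: filterS => x H Dx.
  have := H Dx => /eqP; rewrite /cst eqe sqrf_eq0 => /eqP.
  exact: ComplexField.Normc.eq0_normc.
by apply: H2; apply: filterS H => x H Dx; rewrite H// /cst normc_sqr /= expr0n addr0.
Qed.

Lemma L2_heqP f g : square_integrable mu D f -> square_integrable mu D g ->
  @heq R L2 f g <-> {ae mu, forall x, D x -> f x = g x}.
Proof.
move=> hf hg.
have hfg : square_integrable mu D (f - g : X -> R[i]^o).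
  exact: (@hmemB _ _ L2_prehilbert).
have [H1 H2] := L2_hnorm_ae hfg.
split=> [[_ _ /H1]|H].
  by apply: filterS => x H Dx; apply/eqP; rewrite -subr_eq0; apply/eqP; exact: H.
split=> //; apply: H2; apply: filterS H => x H Dx.
by rewrite (_ : (f - g : X -> R[i]^o) x = f x - g x)// H// subrr.
Qed.

End L2Basics.

Section RieszFischer.
Variables (R : realType) (d : measure_display) (X : measurableType d).
Variables (mu : {measure set X -> \bar R}) (D : set X).
Hypothesis mD : measurable D.
Local Notation L2 := (L2space mu D).
Let LP := L2_prehilbert mu mD.

(** Real and imaginary part each move by at most sqrt(h) 2^-k at step k, so [rapid_cvg] applies to
    both; each contributes half of the constant 8. *)
Lemma clim_rapid (s : nat -> R[i]) (h : R) :
  (forall k, normc (s k.+1 - s k) ^+ 2 <= h * 4^-1 ^+ k) ->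
  forall n, normc (s n - clim s) ^+ 2 <= 8 * h * 4^-1 ^+ n.
Proof.
move=> hs n.
have h0 : 0 <= h.
  by have := le_trans (sqr_ge0 _) (hs 0%N); rewrite mulr1.
have e4 k : 4^-1 ^+ k = (2^-1 ^+ k) ^+ 2 :> R.
  by rewrite -exprM mulnC exprM; congr (_ ^+ _); field.
have bnd (x y : R) k : x ^+ 2 + y ^+ 2 <= h * 4^-1 ^+ k ->
    `|x| <= Num.sqrt h * 2^-1 ^+ k.
  move=> xy; rewrite -(@ler_pXn2r _ 2) ?nnegrE ?mulr_ge0 ?sqrtr_ge0 ?exprn_ge0//.
  rewrite real_normK ?num_real// exprMn sqr_sqrtr// -e4 (le_trans _ xy)//.
  by rewrite lerDl sqr_ge0.
have hr k : `|complex.Re (s k.+1) - complex.Re (s k)| <= Num.sqrt h * 2^-1 ^+ k.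
  by apply: bnd (le_trans _ (hs k)); rewrite normc_sqr ReD ImD ReN ImN.
have hi k : `|complex.Im (s k.+1) - complex.Im (s k)| <= Num.sqrt h * 2^-1 ^+ k.
  by apply: bnd (le_trans _ (hs k)); rewrite normc_sqr ReD ImD ReN ImN addrC.
have [cr br] := rapid_cvg hr; have [ci bi] := rapid_cvg hi.
rewrite /clim asboolT// normc_sqr ReD ImD ReN ImN /=.
have sq (x : R) : `|x| <= 2 * Num.sqrt h * 2^-1 ^+ n ->
    x ^+ 2 <= 4 * h * 4^-1 ^+ n.
  move=> hx; rewrite -[x ^+ 2]real_normK ?num_real//.
  have -> : 4 * h * 4^-1 ^+ n = (2 * Num.sqrt h * 2^-1 ^+ n) ^+ 2.
    by rewrite !exprMn sqr_sqrtr// -e4; ring.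
  by rewrite ler_pXn2r ?nnegrE ?mulr_ge0 ?sqrtr_ge0 ?exprn_ge0.
by have := sq _ (br n); have := sq _ (bi n); lra.
Qed.

(** The squared increments weighted by 4^k have integral at most 2^-k, so their sum [H] is
    integrable and finite almost everywhere; there [clim_rapid] applies with h = [H x]. The limit is
    the pointwise [clim], an explicit representative, so identities valid at every point for the
    sequence survive in the limit. *)
Lemma L2_rapid (u : nat -> X -> R[i]) :
  (forall n, square_integrable mu D (u n)) ->
  (forall k, @hnorm R L2 (u k.+1 - u k : hcar L2) ^+ 2 <= 8^-1 ^+ k) ->
  square_integrable mu D (fun x => clim (u ^~ x)) /\
  @hnorm R L2 (u n - (fun x => clim (u ^~ x)) : hcar L2) @[n --> \oo] --> (0 : R).
Proof.
move=> hu hr; set v := fun x => clim (u ^~ x).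
have mv : cmeasurable v by apply: cmeasurable_clim => n; case: (hu n).
have hd k : square_integrable mu D (u k.+1 - u k : hcar L2).
  exact: (@hmemB _ _ LP _ _ (hu k.+1) (hu k)).
pose e k x := 4 ^+ k * normc (u k.+1 x - u k x) ^+ 2.
have e0 k x : 0 <= e k x by rewrite /e; apply: mulr_ge0; [exact: exprn_ge0|exact: sqr_ge0].
have me k : measurable_fun D (fun x => (e k x)%:E).
  apply/measurable_EFinP/measurable_funTS/measurable_funM; first exact: measurable_cst.
  by apply: measurable_normc_sqr; case: (hd k).
pose H x := (\sum_(0 <= k <oo) (e k x)%:E)%E.
have H0 x : (0 <= H x)%E by apply: nneseries_ge0 => k _ _; rewrite lee_fin.
have mH : measurable_fun D H.
  by apply: (@ge0_emeasurable_sum _ _ _ _ (fun k x => (e k x)%:E) xpredT) => // k x _ _; rewrite lee_fin.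
have intH : (\int[mu]_(x in D) H x <= 2%:E)%E.
  rewrite /H integral_nneseries//; last by move=> k x _; rewrite lee_fin.
  have ik k : (\int[mu]_(x in D) (e k x)%:E <= ((1 / 2 : R) ^+ k)%:E)%E.
    rewrite /e; under eq_integral do rewrite EFinM.
    rewrite ge0_integralZl_EFin//; first last.
    - apply/measurable_EFinP/measurable_funTS.
      by apply: measurable_normc_sqr; case: (hd k).
    - by move=> x _; rewrite lee_fin sqr_ge0.
    have := L2_hnorm_sqrE mD (hd k); rewrite /= => <-.
    rewrite -EFinM lee_fin (le_trans (ler_wpM2l _ (hr k))) ?exprn_ge0//.
    rewrite -exprMn; have -> : 4 * 8^-1 = 1 / 2 :> R by field.
    by [].
  apply: lime_le.
    by apply: is_cvg_nneseries => k _ _; apply: integral_ge0 => x _; rewrite lee_fin.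
  apply: nearW => n.
  apply: (@le_trans _ _ (2 - 2 * (1 / 2) ^+ n)%:E); last first.
    by rewrite lee_fin gerBl mulr_ge0// exprn_ge0.
  elim: n => [|n IH]; first by rewrite big_nil lee_fin expr0 mulr1 subrr.
  rewrite big_nat_recr//= (le_trans (leeD IH (ik n)))// -EFinD lee_fin exprS; lra.
have iH : mu.-integrable D H.
  apply/integrableP; split=> //.
  rewrite (le_lt_trans _ (ltry 2))// (le_trans _ intH)//.
  by under eq_integral do rewrite gee0_abs//.
have aeH := integrable_ae mD iH.
have B n : (\int[mu]_(x in D) (normc (u n x - v x) ^+ 2)%:E <= (16 * 4^-1 ^+ n)%:E)%E.
  apply: (@le_trans _ _ (\int[mu]_(x in D) ((8 * 4^-1 ^+ n)%:E * H x))%E).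
    apply: ae_ge0_le_integral => //.
    - by move=> x _; rewrite lee_fin sqr_ge0.
    - apply/measurable_EFinP/measurable_funTS/measurable_normc_sqr.
      by apply: cmeasurableB => //; case: (hu n).
    - by move=> x _; rewrite mule_ge0// lee_fin mulr_ge0// exprn_ge0.
    - by apply: emeasurable_funM => //; exact: measurable_cst.
    apply: filterS aeH => x Hx Dx; have /fineK {}Hx := Hx Dx.
    rewrite -Hx -EFinM lee_fin.
    rewrite (le_trans (@clim_rapid (u ^~ x) (fine (H x)) _ n))//; last by lra.
    move=> k; have : ((e k x)%:E <= H x)%E.
      rewrite /H (nneseries_split 0 k.+1); last by move=> j _; rewrite lee_fin.
      rewrite add0n big_nat_recr//= -[leLHS]add0e -addeA leeD//.
        by apply: sume_ge0 => i _; rewrite lee_fin.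
      by rewrite leeDl//; apply: nneseries_ge0 => j _ _; rewrite lee_fin.
    rewrite -Hx lee_fin /e => hk.
    by rewrite exprVn ler_pdivlMr ?exprn_gt0// mulrC.
  rewrite ge0_integralZl_EFin// ?mulr_ge0 ?exprn_ge0//.
  rewrite (le_trans (lee_wpmul2l _ intH)) ?lee_fin ?mulr_ge0 ?exprn_ge0//; lra.
have hB n : square_integrable mu D (fun x => u n x - v x).
  have mB : cmeasurable (fun x => u n x - v x).
    by apply: cmeasurableB => //; case: (hu n).
  split=> //; apply/integrableP; split.
    exact/measurable_EFinP/measurable_funTS/measurable_normc_sqr.
  under eq_integral do rewrite gee0_abs ?lee_fin ?sqr_ge0//.
  exact: le_lt_trans (B n) (ltry _).
split.
  have := @hmemB _ _ LP _ _ (hu 0%N) (hB 0%N); rewrite /= => h.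
  rewrite (_ : v = (u 0%N - (fun x => u 0%N x - v x) : hcar L2))//.
  by apply/funext => x; rewrite /= opprB addrC subrK.
have Bn n : @hnorm R L2 (u n - v : hcar L2) <= 4 * 2^-1 ^+ n.
  rewrite -(@ler_pXn2r _ 2) ?nnegrE ?mulr_ge0 ?sqrtr_ge0 ?exprn_ge0//.
  rewrite -lee_fin (L2_hnorm_sqrE mD (hB n)) (le_trans (B n))// lee_fin.
  rewrite exprMn -exprM mulnC exprM; have -> : (2^-1) ^+ 2 = 4^-1 :> R by field.
  lra.
apply: (@squeeze_cvgr _ _ _ _ (cst 0) (fun n => 4 * 2^-1 ^+ n)).
- by apply: nearW => n; rewrite sqrtr_ge0/= Bn.
- exact: cvg_cst.
- rewrite -(mulr0 4); apply: cvgMr; apply: cvg_expr.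
  by rewrite ger0_norm//; lra.
Qed.

Lemma L2_complete (u : nat -> X -> R[i]) :
  (forall n, square_integrable mu D (u n)) -> @hcauchy R L2 u ->
  exists2 v, square_integrable mu D v &
    @hnorm R L2 (u n - v : hcar L2) @[n --> \oo] --> (0 : R).
Proof.
move=> hu cu.
have eps0 k : 0 < Num.sqrt (8^-1 ^+ k) :> R by rewrite sqrtr_gt0 exprn_gt0.
pose m k := sval (cid (cu _ (eps0 k))).
have mP k i j : (m k <= i)%N -> (m k <= j)%N ->
    @hnorm R L2 (u i - u j : hcar L2) < Num.sqrt (8^-1 ^+ k).
  by rewrite /m; case: cid => /= n; exact.
(* The summand k makes [phi] unbounded; the sum makes it monotone and at least [m k]. *)
pose phi k := (k + \sum_(i < k.+1) m i)%N.
have mphi k : (m k <= phi k)%N by rewrite /phi big_ord_recr/= addnA leq_addl.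
have phiS k : (phi k <= phi k.+1)%N by rewrite /phi [in leqRHS]big_ord_recr/= addnA (leq_trans _ (leq_addr _ _))// leq_add2r.
have [hv uv] : square_integrable mu D (fun x => clim (fun k => u (phi k) x)) /\
  @hnorm R L2 (u (phi n) - (fun x => clim (fun k => u (phi k) x)) : hcar L2)
    @[n --> \oo] --> (0 : R).
  apply: L2_rapid => // k; rewrite -[leRHS]sqr_sqrtr ?exprn_ge0//.
  rewrite ler_pXn2r ?nnegrE ?sqrtr_ge0// ltW// mP// (leq_trans (mphi k))//.
eexists; first exact: hv.
apply/cvgr0Pnorm_lt => e e0.
have e20 : 0 < e / 2 by rewrite divr_gt0.
have [n0 hn0] := cu _ e20.
have [k [kn0 hk]] : exists k, (n0 <= phi k)%N /\
    @hnorm R L2 (u (phi k) - (fun x => clim (fun k => u (phi k) x)) : hcar L2) < e / 2.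
  move/cvgr0Pnorm_lt: uv => /(_ _ e20)[k1 _ hk1].
  exists (maxn k1 n0); split.
    by rewrite /phi (leq_trans (leq_maxr k1 n0))// leq_addr.
  by have := hk1 (maxn k1 n0) (leq_maxl _ _); rewrite ger0_norm// sqrtr_ge0.
exists n0 => // n /= nn0; rewrite ger0_norm ?sqrtr_ge0//.
apply: le_lt_trans (@hnormB_le _ _ LP _ _ _ (hu n) (hu (phi k)) hv) _.
by rewrite [ltRHS]splitr ltrD// hn0.
Qed.

End RieszFischer.

(** * Affine change of variable for Lebesgue measure *)

Section AffineChange.
Variable R : realType.
Local Notation mu := (@lebesgue_measure R).

Lemma measurable_affine (t b : R) : measurable_fun setT (fun x : R => t * x + b).
Proof.
apply: measurable_funD; last exact: measurable_cst.
by apply: measurable_funM => //; exact: measurable_cst.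
Qed.

(** By uniqueness of Lebesgue measure it is enough to compare on intervals ]x, y]. For t < 0 the
    preimage is closed on the left and open on the right, which has the same measure. *)
Lemma lebesgue_measure_affine (t b : R) (A : set R) : t != 0 -> measurable A ->
  (`|t|%:E * mu ((fun x => (t * x + b)%R) @^-1` A) = mu A)%E.
Proof.
move=> t0 mA; pose phi : R -> measurableTypeR R := fun x => t * x + b.
have mphi : measurable_fun setT phi := measurable_affine t b.
have -> : (`|t|%:E * mu ((fun x => (t * x + b)%R) @^-1` A))%E =
  mscale `|t|%:nng (pushforward mu phi) A by [].
apply/esym/lebesgue_measure_unique => // _ [[x y] _ <-] /=.
rewrite /= /mscale /= /pushforward.
have [xy|yx] := ltP x y; last first.
  rewrite set_itv_ge ?preimage_set0 ?measure0 ?mule0//.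
  by rewrite bnd_simp -leNgt.
have T0 : 0 < `|t| by rewrite normr_gt0.
have [tp|tn] := ltP 0 t.
- have -> : phi @^-1` `]x, y] = `](x - b) / t, (y - b) / t]%classic.
    apply/seteqP; split => u /=; rewrite /phi !in_itv/= ltr_pdivrMr// ler_pdivlMr// ltrBlDr lerBrDr (mulrC u) ?(addrC b)//.
  rewrite !lebesgue_measure_itv/= !lte_fin xy ltr_pM2r ?invr_gt0// ltrD2r xy.
  by rewrite -!EFinD -EFinM gtr0_norm//; congr EFin; field.
- have {}tn : t < 0 by rewrite lt_neqAle t0.
  have -> : phi @^-1` `]x, y] = `[(y - b) / t, (x - b) / t[%classic.
    apply/seteqP; split => u /=; rewrite /phi !in_itv/= ltr_ndivlMr// ler_ndivrMr// ltrBlDr lerBrDr (mulrC u) ?(addrC b) andbC//.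
  rewrite !lebesgue_measure_itv/= !lte_fin xy ltr_nM2r ?invr_lt0// ltrD2r xy.
  by rewrite -!EFinD -EFinM ltr0_norm//; congr EFin; field.
Qed.

Lemma ge0_integral_affine (t b : R) (f : R -> \bar R) : t != 0 ->
  measurable_fun setT f -> (forall x, 0 <= f x)%E ->
  (\int[mu]_x f x = `|t|%:E * \int[mu]_x f (t * x + b)%R)%E.
Proof.
move=> t0 mf f0; pose phi : R -> measurableTypeR R := fun x => t * x + b.
have mphi : measurable_fun setT phi := measurable_affine t b.
rewrite (@eq_measure_integral _ _ _ _ (mscale `|t|%:nng (pushforward mu phi))); last first.
  move=> A mA _; have H := lebesgue_measure_affine b t0 mA. exact: (esym H).
rewrite ge0_integral_mscale//=.
by rewrite ge0_integral_pushforward//.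
Qed.

Lemma Rintegral_affine (t b : R) (f : R -> R) : t != 0 ->
  measurable_fun setT f -> mu.-integrable setT (EFin \o f) ->
  mu.-integrable setT (EFin \o (fun x => f (t * x + b))) /\
  \int[mu]_x f x = `|t| * \int[mu]_x f (t * x + b).
Proof.
move=> t0 mf fi.
have T0 : 0 < `|t| by rewrite normr_gt0.
have mfp : measurable_fun setT (fun x => f (t * x + b)).
  exact: (measurableT_comp mf (measurable_affine t b)).
have H : mu.-integrable setT (EFin \o (fun x => f (t * x + b))).
  apply/integrableP; split; first exact/measurable_EFinP.
  have /integrableP[_] := fi; rewrite /= (ge0_integral_affine b t0); last 2 first.
  - by apply/measurable_EFinP; exact: measurableT_comp.
  - by move=> x; rewrite lee_fin.
  move=> H; rewrite ltey; apply/eqP => E; move: H.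
  by rewrite E gt0_muley ?lte_fin// ltxx.
split => //; apply: EFin_inj.
have F g : mu.-integrable setT (EFin \o g) -> (\int[mu]_x g x)%:E = (\int[mu]_x (g x)%:E)%E.
  by move=> gi; rewrite /Rintegral fineK//; exact: integrable_fin_num.
rewrite EFinM !F// integralE [in RHS]integralE.
rewrite (ge0_integral_affine b t0)//; last first.
  exact/measurable_funepos/measurable_EFinP.
rewrite [X in (_ - X)%E](ge0_integral_affine b t0)//; last first.
  exact/measurable_funeneg/measurable_EFinP.
rewrite [RHS]muleBr//; first by congr (_ * _ - _ * _)%E; apply: eq_integral => x _; rewrite ?funeposE ?funenegE.
exact: (integrable_add_def measurableT H).
Qed.

End AffineChange.

Lemma normc_sqrB_le (R : realType) (z w : R[i]) :
  normc (z - w) ^+ 2 <= 2 * normc z ^+ 2 + 2 * normc w ^+ 2.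
Proof.
rewrite !normc_sqr ReD ImD ReN ImN.
move: (complex.Re z) (complex.Im z) (complex.Re w) (complex.Im w) => a b c e.
rewrite -subr_ge0 (_ : _ - _ = (a + c) ^+ 2 + (b + e) ^+ 2); last by ring.
by rewrite addr_ge0 ?sqr_ge0.
Qed.

(** * Closed subspaces and dominated convergence in L^2 *)

Section SubspaceTheory.
Variables (R : realType) (E : hspace R) (S : set (hcar E)).
Hypothesis SS : hsubspace S.

Lemma hsub0 : S 0. Proof. by case: SS. Qed.

Lemma hsubZD (a : R[i]) u v : S u -> S v -> S (a *: u + v).
Proof. by case: SS => _ _; exact. Qed.

Lemma hsubZ (a : R[i]) u : S u -> S (a *: u).
Proof. by move=> Su; rewrite -[_ *: _]addr0; exact: hsubZD Su hsub0. Qed.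

Lemma hsubD u v : S u -> S v -> S (u + v).
Proof. by move=> Su Sv; rewrite -[u]scale1r; exact: hsubZD. Qed.

Lemma hsubB u v : S u -> S v -> S (u - v).
Proof. by move=> Su Sv; rewrite addrC -scaleN1r; exact: hsubZD. Qed.

Lemma hsub_sum (I : Type) (r : seq I) (F : I -> hcar E) :
  (forall i, S (F i)) -> S (\sum_(i <- r) F i).
Proof.
move=> SF; elim: r => [|i r IH]; first by rewrite big_nil; exact: hsub0.
by rewrite big_cons; exact: hsubD.
Qed.

(** The constant sequence u converges to every representative of its class, so a closed subspace is
    a union of classes. *)
Lemma hclosed_heq u v : prehilbert E -> hclosed S -> S u -> heq u v -> S v.
Proof.
move=> EP Sc Su [_ hv uv]; apply: (Sc (fun _ => u)) => //.
by rewrite uv; exact: cvg_cst.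
Qed.

End SubspaceTheory.

Section L2Dominated.
Variables (R : realType) (d : measure_display) (X : measurableType d).
Variables (mu : {measure set X -> \bar R}) (D : set X).
Hypothesis mD : measurable D.
Local Notation L2 := (L2space mu D).

Lemma L2_dominated (u : nat -> X -> R[i]) (v : X -> R[i]) (h : X -> R) :
  (forall n, cmeasurable (u n)) -> cmeasurable v ->
  mu.-integrable D (EFin \o h) ->
  (forall n x, D x -> normc (u n x) ^+ 2 <= h x) ->
  (forall x, D x -> normc (v x) ^+ 2 <= h x) ->
  {ae mu, forall x, D x -> normc (u n x - v x) ^+ 2 @[n --> \oo] --> (0 : R)} ->
  [/\ forall n, square_integrable mu D (u n), square_integrable mu D v &
  @hnorm R L2 (u n - v : hcar L2) @[n --> \oo] --> (0 : R)].
Proof.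
move=> mu_ mv ih uh vh cv.
have hu n : square_integrable mu D (u n) by exact: square_integrable_le (uh n).
have hv : square_integrable mu D v by exact: square_integrable_le vh.
split => //.
have hB n : square_integrable mu D (fun x => u n x - v x).
  exact: (@hmemB _ _ (L2_prehilbert mu mD) _ _ (hu n) hv).
have mB n : measurable_fun D (fun x => (normc (u n x - v x) ^+ 2)%:E).
  by apply/measurable_EFinP/measurable_funTS/measurable_normc_sqr; case: (hB n).
have m0 : measurable_fun D (fun _ : X => 0%:E : \bar R) by exact: measurable_cst.
have cvE : {ae mu, forall x, D x ->
    (normc (u n x - v x) ^+ 2)%:E @[n --> \oo] --> (0%:E : \bar R)}.
  by apply: filterS cv => x cv Dx; apply: cvg_EFin; [exact: nearW|exact: cv].
have [|_ _ ] := @dominated_convergence _ _ _ mu _ mD _ _ _ mB m0 cvE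
    (integrableZl mD 4 ih).
  apply: aeW => x n Dx; rewrite gee0_abs ?lee_fin ?sqr_ge0//=.
  rewrite (le_trans (normc_sqrB_le _ _))//.
  by have := uh n _ Dx; have := vh _ Dx; lra.
rewrite integral0 => H.
have {}H : @hnorm R L2 (u n - v : hcar L2) ^+ 2 @[n --> \oo] --> (0 : R).
  move: H; rewrite [X in X @ _](_ : _ = fun n =>
    (@hnorm R L2 (u n - v : hcar L2) ^+ 2)%:E).
    by move/fine_cvg.
  by apply/funext => n; rewrite (L2_hnorm_sqrE mD (hB n)).
have := cvg_comp _ _ H (@sqrt_continuous R 0); rewrite sqrtr0.
by apply: cvg_trans; apply: near_eq_cvg; apply: nearW => n /=;
  rewrite sqrtr_sqr ger0_norm// sqrtr_ge0.
Qed.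

End L2Dominated.

Import HBNNSimple.

(** * Indicators of intervals are total in L^2(R) *)

Section Totality.
Variable R : realType.
Local Notation mu := (@lebesgue_measure R).
Local Notation L := (L2R R).
Local Notation hmemL f := (@hmem R L f).

Definition restr (D : set R) (f : R -> R[i]) : R -> R[i] :=
  fun x => (\1_D x)%:C * f x.

Lemma restrT f : restr setT f = f.
Proof. by apply/funext => x; rewrite /restr indicT mul1r. Qed.

Lemma restr_restr A B f : restr A (restr B f) = restr (A `&` B) f.
Proof.
by apply/funext => x; rewrite /restr mulrA indicI -rmorphM.
Qed.

Lemma L2R_prehilbert : prehilbert L.
Proof. exact: L2_prehilbert. Qed.

Lemma normc_real (a : R) : normc a%:C ^+ 2 = a ^+ 2.
Proof. by rewrite normc_sqr /= expr0n addr0. Qed.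

Lemma normc_sqrM (z w : R[i]) : normc (z * w) ^+ 2 = normc z ^+ 2 * normc w ^+ 2.
Proof. by rewrite ComplexField.Normc.normcM exprMn. Qed.

Lemma indic_sqr_le1 (A : set R) x : (\1_A x : R) ^+ 2 <= 1.
Proof. by rewrite indicE; case: (_ \in _); rewrite /= ?expr1n ?expr0n. Qed.

Lemma restr_le A f x : normc (restr A f x) ^+ 2 <= normc (f x) ^+ 2.
Proof. by rewrite normc_sqrM normc_real ler_piMl ?sqr_ge0// indic_sqr_le1. Qed.

Lemma cmeasurable_restr A f : measurable A -> cmeasurable f -> cmeasurable (restr A f).
Proof.
by move=> mA mf; apply: cmeasurableM => //; exact/cmeasurable_real/measurable_indic.
Qed.

Lemma restr_mem A f : measurable A -> hmemL f -> hmemL (restr A f).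
Proof.
move=> mA [mf fi]; apply: square_integrable_le fi _ => //.
  exact: cmeasurable_restr.
by move=> x _; exact: restr_le.
Qed.

(** The sets D with [restr D f] in S form a Dynkin system: complements by subtraction, disjoint
    unions by dominated convergence. The half-open intervals generate and are stable under
    intersection. *)
Lemma measurable_mult (S : set (hcar L)) (f : R -> R[i]) :
  hsubspace S -> hclosed S -> S f ->
  (forall a b, S (restr `]a, b] f)) ->
  forall D, measurable D -> S (restr D f).
Proof.
move=> Ss Sc Sf Sitv D mD.
have hf : hmemL f by case: Ss => SL _ _; exact: SL.
have [mf fi] := hf.
suff : forall S' : set R, <<s @ocitv R >> S' -> S (restr S' f) by apply; exact: mD.
move=> S'; apply: (@dynkin_induction _ (measurableTypeR R) (@ocitv R) (fun A => S (restr A f))).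
- by [].
- by move=> A B hA hB; exact: (@measurableI _ (ocitv_type R)).
- by rewrite restrT.
- by move=> _ [[a b] _ <-]; exact: Sitv.
- move=> A mA SA; rewrite (_ : restr _ _ = (f : hcar L) - (restr A f : hcar L)).
    exact: (hsubB Ss).
  apply/funext => x.
  rewrite /restr [RHS](_ : _ = f x - (\1_A x)%:C * f x)// indicC /= indicE.
  by case: (_ \in A); rewrite /= ?mul1r ?mul0r ?subrr ?subr0.
- move=> F mF tF SF; apply: (Sc (fun n => restr (\bigcup_(k < n) F k) f)).
  + elim=> [|n IH].
      rewrite (_ : restr _ _ = 0); first exact: (hsub0 Ss).
      by apply/funext => x; rewrite /restr bigcup_mkord big_ord0 indic0 mul0r.
    rewrite (_ : restr _ _ = (restr (\bigcup_(k < n) F k) f : hcar L) + (restr (F n) f : hcar L)).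
      exact: (hsubD Ss).
    apply/funext => x; rewrite /restr !bigcup_mkord big_ord_recr /=.
    rewrite [X in _ = X](_ : _ = (\1_(\big[setU/set0]_(i < n) F i) x)%:C * f x + (\1_(F n) x)%:C * f x)//.
    rewrite -mulrDl -rmorphD; congr (_%:C * _).
    rewrite !indicE in_setU.
    case: (boolP (x \in F n)) => xn; last by rewrite orbF addr0.
    rewrite orbT.
    case: (boolP (x \in _)) => xm; last by rewrite add0r.
    exfalso.
    move: xn xm; rewrite -bigcup_mkord !inE => xn [k /= kn xk].
    move/trivIsetP : tF => /(_ k n Logic.I Logic.I).
    have kn' : k != n by rewrite ltn_eqF.
    move=> /(_ kn') H; have : (F k `&` F n) x by [].
    by rewrite H.
  + by apply: restr_mem => //; apply: bigcup_measurable => ? _; exact: mF.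
  + have [] := @L2_dominated _ _ _ mu setT measurableT
      (fun n => restr (\bigcup_(k < n) F k) f)
      (restr (\bigcup_k F k) f) (fun x => normc (f x) ^+ 2).
    * by move=> n; apply: cmeasurable_restr => //; apply: bigcup_measurable => ? _; exact: mF.
    * by apply: cmeasurable_restr => //; apply: bigcup_measurable => ? _; exact: mF.
    * exact: fi.
    * by move=> n x _; exact: restr_le.
    * by move=> x _; exact: restr_le.
    * apply: aeW => x _; apply: cvg_near_cst.
      have [[n _ xn]|xF] := pselect ((\bigcup_k F k) x).
        exists n.+1 => // m /= nm; apply/eqP.
        rewrite /restr !indicE !mem_set ?subrr ?normc_sqr /= ?expr0n ?addr0//.
          by exists n.
        by exists n.
      exists 0%N => // m /= nm; apply/eqP.
      rewrite /restr !indicE !memNset ?subrr ?normc_sqr /= ?expr0n ?addr0//.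
      by move=> [k _ xk]; apply: xF; exists k.
    by move=> _ _; exact.
Qed.

(** [measurable_mult] yields the indicators of bounded measurable sets, hence truncated simple
    functions. These increase to any nonnegative function, and positive and negative parts of the
    real and imaginary parts give the rest. *)
Lemma L2R_total (S : set (hcar L)) : hsubspace S -> hclosed S ->
  (forall (a b : R) , S (restr `]a, b] (fun _ => 1))) -> S = @hmem R L.
Proof.
move=> Ss Sc Sitv.
have SD (n : nat) D : measurable D -> S (restr D (restr `](- n%:R), n%:R] (fun _ => 1))).
  move=> mD; apply: measurable_mult => // a b; rewrite restr_restr.
  rewrite (_ : _ `&` _ = `]Num.max a (- n%:R), Num.min b n%:R]%classic)//.
  apply/seteqP; split=> x /=; rewrite !in_itv/= gt_max le_min.
    by case=> /andP[-> ->] /andP[-> ->].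
  by move=> /andP[/andP[-> ->] /andP[-> ->]].
have Spos (g : R -> R) : measurable_fun setT g -> (forall x, 0 <= g x) ->
    hmemL (fun x => (g x)%:C) -> S (fun x => (g x)%:C).
  move=> mg g0 hg.
  have mg' : measurable_fun setT (EFin \o g) by exact/measurable_EFinP.
  pose s n : {nnsfun _ >-> R} := nnsfun_approx measurableT mg' n.
  have scv x : s n x @[n --> \oo] --> g x.
    have := @cvg_nnsfun_approx _ _ _ _ measurableT _ mg' _ x Logic.I.
    by move=> /(_ (fun x _ => g0 x)) /fine_cvg.
  have sle n x : s n x <= g x.
    have nd : nondecreasing_seq (fun n => s n x).
      by move=> i j ij; have /lefP := nd_nnsfun_approx measurableT mg' ij; exact.
    have := nondecreasing_cvgn_le nd (cvgP _ (scv x)) n.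
    by rewrite (cvg_lim _ (scv x)).
  apply: (Sc (fun n => restr `](- n%:R), n%:R] (fun x => (s n x)%:C))) => //.
    move=> n.
    have -> : restr `](- n%:R), n%:R] (fun x => (s n x)%:C) =
      \sum_(y <- fset_set (range (s n)))
        y%:C *: (restr (s n @^-1` [set y]) (restr `](- n%:R), n%:R] (fun _ => 1)) : hcar L).
      apply/funext => x; rewrite fct_sumE /restr.
      rewrite [in LHS](fimfunE (s n) x) fsbig_finite//= rmorph_sum mulr_sumr.
      apply: eq_bigr => y _; rewrite rmorphM mulrCA [RHS](_ : _ = y%:C *
        ((\1_(s n @^-1` [set y]) x)%:C * ((\1_`]- n%:R, n%:R] x)%:C * 1)))//.
      by rewrite mulr1 [X in _ * X]mulrC.
    apply: (hsub_sum Ss) => y; apply: (hsubZ Ss); exact: SD.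
  have [] := @L2_dominated _ _ _ mu setT measurableT
      (fun n => restr `](- n%:R), n%:R] (fun x => (s n x)%:C))
      (fun x => (g x)%:C) (fun x => g x ^+ 2).
  * by move=> n; apply: cmeasurable_restr => //; exact: cmeasurable_real.
  * exact: cmeasurable_real.
  * case: hg => _; apply: eq_integrable => // x _.
    by rewrite normc_real.
  * move=> n x _; rewrite (le_trans (restr_le _ _ _))// normc_real.
    by rewrite ler_pXn2r ?nnegrE.
  * by move=> x _; rewrite normc_real.
  * apply: aeW => x _.
    have : (s n x - g x) ^+ 2 @[n --> \oo] --> (0 : R).
      rewrite -[0](_ : (g x - g x) ^+ 2 = _); last by rewrite subrr expr0n.
      by apply: cvgM; apply: cvgB => //; exact: cvg_cst.
    apply: cvg_trans; apply: near_eq_cvg.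
    exists (Num.trunc `|x|).+1 => // m /= nm.
    rewrite /restr indicE mem_set.
      rewrite sqr_sqrtr ?addr_ge0 ?sqr_ge0//=; ring.
    have : `|x| < m%:R by rewrite (lt_le_trans (truncnS_gt _))// ler_nat.
    by rewrite /= in_itv/= ltr_norml => /andP[-> /ltW].
  by [].
apply/seteqP; split; first by case: Ss.
move=> f hf; have [[mr mi] fi] := hf.
have Spart (g : R -> R) : measurable_fun setT g ->
    (forall x, g x ^+ 2 <= normc (f x) ^+ 2) -> S (fun x => (g x)%:C).
  move=> mg gf.
  have mem (k : R -> R) : measurable_fun setT k -> (forall x, k x ^+ 2 <= g x ^+ 2) ->
      hmemL (fun x => (k x)%:C).
    move=> mk kg; apply: square_integrable_le fi _ => //.
    by move=> x _; rewrite normc_real (le_trans (kg x)).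
  have Sp : S (fun x => (g^\+ x)%:C).
    apply: Spos => //; first exact: measurable_funrpos.
    apply: mem; first exact: measurable_funrpos.
    move=> x; rewrite /funrpos; have [x0|x0] := leP (g x) 0; last by [].
    by rewrite expr0n sqr_ge0.
  have Sn : S (fun x => (g^\- x)%:C).
    apply: Spos => //; first exact: measurable_funrneg.
    apply: mem; first exact: measurable_funrneg.
    move=> x; rewrite /funrneg; have [x0|x0] := leP (- g x) 0.
      by rewrite expr0n sqr_ge0.
    by rewrite sqrrN.
  rewrite (_ : (fun x => (g x)%:C) = ((fun x => (g^\+ x)%:C) : hcar L) - ((fun x => (g^\- x)%:C) : hcar L)).
    exact: (hsubB Ss).
  apply/funext => x; rewrite -{1}[g]funrposBneg.
  by rewrite rmorphB.
rewrite (_ : f = 'i%C *: ((fun x => (complex.Im (f x))%:C) : hcar L) +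
   ((fun x => (complex.Re (f x))%:C) : hcar L)).
  apply: (hsubZD Ss); apply: Spart => // x; rewrite normc_sqr.
    by rewrite lerDr sqr_ge0.
  by rewrite lerDl sqr_ge0.
apply/funext => x; rewrite [RHS](_ : _ = 'i%C * (complex.Im (f x))%:C + (complex.Re (f x))%:C)//.
by apply: complex_eq; rewrite ?(ReD, ImD, ReM, ImM)/=; ring.
Qed.

End Totality.

(** * The exponential e(x) *)

Section Exponential.
Variable R : realType.
Implicit Types x y : R.

Lemma e2pi0 : e2pi (0 : R) = 1.
Proof. by rewrite /e2pi mulr0 cos0 sin0. Qed.

Lemma e2piD x y : e2pi (x + y) = e2pi x * e2pi y.
Proof.
apply: complex_eq; rewrite ?(ReM, ImM) /= mulrDr ?cosD ?sinD//.
by rewrite addrC.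
Qed.

Lemma conj_e2pi x : (e2pi x)^* = e2pi (- x).
Proof. by apply: complex_eq; rewrite ?(Re_conj, Im_conj) /= mulrN ?cosN ?sinN. Qed.

Lemma e2piN x : e2pi x * e2pi (- x) = 1.
Proof. by rewrite -e2piD subrr e2pi0. Qed.

Lemma normc_e2pi x : normc (e2pi x) ^+ 2 = 1.
Proof. by rewrite normc_sqr /= cos2Dsin2. Qed.

Lemma e2pi_nat (n : nat) : e2pi (n%:R : R) = 1.
Proof.
elim: n => [|n IH]; first exact: e2pi0.
rewrite -natr1 e2piD IH mul1r /e2pi mulr1 [2 * _]mulrC mulr_natr.
by rewrite cos2pi sin2pi.
Qed.

Lemma e2pi_int (n : int) : e2pi (n%:~R : R) = 1.
Proof.
case: n => n; first exact: e2pi_nat.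
by rewrite NegzE mulrNz -conj_e2pi e2pi_nat conjcE conjc1.
Qed.

Lemma continuous_cos2pi : continuous (fun x => cos (2 * pi * x)).
Proof.
move=> x; apply: (@continuous_comp _ _ _ (fun x => 2 * pi * x) cos).
  by apply: cvgMr; exact: cvg_id.
exact: continuous_cos.
Qed.

Lemma continuous_sin2pi : continuous (fun x => sin (2 * pi * x)).
Proof.
move=> x; apply: (@continuous_comp _ _ _ (fun x => 2 * pi * x) sin).
  by apply: cvgMr; exact: cvg_id.
exact: continuous_sin.
Qed.

Lemma cmeasurable_e2pi : cmeasurable (@e2pi R).
Proof.
split; apply: continuous_measurable_fun;
  [exact: continuous_cos2pi|exact: continuous_sin2pi].
Qed.

Lemma cmeasurable_e2pi_comp d (X : measurableType d) (h : X -> R) :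
  measurable_fun setT h -> cmeasurable (fun w => e2pi (h w)).
Proof. by move=> mh; exact: (cmeasurable_comp mh cmeasurable_e2pi). Qed.

End Exponential.

(** * The model operators on L^2(R) and their strong continuity *)

Section WeightedComposition.
Variable R : realType.
Local Notation L := (L2R R).
Local Notation hmemL f := (@hmem R L f).

(** For a weight [p] of modulus one the factor |t|^(1/2) compensates the Jacobian and the operator
    is isometric. Dilations, translations and modulations are all of this form. *)
Definition wop (t b : R) (p : R -> R[i]) (f : R -> R[i]) : R -> R[i] :=
  fun x => (`|t| `^ 2^-1)%:C * (p x * f (t * x + b)).

Lemma powR_half_sqr (t : R) : (`|t| `^ 2^-1) ^+ 2 = `|t|.
Proof. by rewrite -powR_mulrn ?powR_ge0// -powRrM mulVf// powRr1. Qed.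

Variables (t b : R) (p : R -> R[i]).
Hypotheses (t0 : t != 0) (mp : cmeasurable p).
Hypothesis p1 : forall x, normc (p x) ^+ 2 = 1.

Lemma cmeasurable_wop f : cmeasurable f -> cmeasurable (wop t b p f).
Proof.
move=> mf; apply/cmeasurableZ/cmeasurableM => //.
exact: (cmeasurable_comp (measurable_affine t b) mf).
Qed.

Lemma wop_conjM f g x : wop t b p f x * (wop t b p g x)^* =
  `|t|%:C * (f (t * x + b) * (g (t * x + b))^*).
Proof.
rewrite /wop !rmorphM /=.
have -> : Num.conj (`|t| `^ 2^-1)%:C = (`|t| `^ 2^-1)%:C :> R[i].
  by apply: complex_eq; rewrite ?(Re_conj, Im_conj)/= ?oppr0.
rewrite -[in RHS](powR_half_sqr t) rmorphXn /=.
have := mulc_conj (p x); rewrite p1 => pp.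
have -> : (`|t| `^ 2^-1)%:C * (p x * f (t * x + b)) *
  ((`|t| `^ 2^-1)%:C * ((p x)^* * (g (t * x + b))^*)) =
  (p x * (p x)^*) * ((`|t| `^ 2^-1)%:C ^+ 2 * (f (t * x + b) * (g (t * x + b))^*)).
  by ring.
by rewrite pp mul1r.
Qed.

Lemma wop_normc f x :
  normc (wop t b p f x) ^+ 2 = `|t| * normc (f (t * x + b)) ^+ 2.
Proof.
by rewrite /wop !normc_sqrM p1 mul1r normc_real powR_half_sqr.
Qed.

Lemma wop_mem f : hmemL f -> hmemL (wop t b p f).
Proof.
move=> [mf fi]; split; first exact: cmeasurable_wop.
have [fi' _] := Rintegral_affine b t0 (measurable_normc_sqr mf) fi.
have := integrableZl measurableT `|t| fi'.
by apply: eq_integrable => // x _ /=; rewrite wop_normc EFinM.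
Qed.

Lemma wop_linear (a : R[i]) (u v : hcar L) :
  wop t b p (a *: u + v) = a *: (wop t b p u : hcar L) + (wop t b p v : hcar L).
Proof.
apply/funext => x; rewrite [RHS](_ : _ = a * wop t b p u x + wop t b p v x)// /wop.
have -> : (a *: u + v) (t * x + b) = a * u (t * x + b) + v (t * x + b) by [].
by ring.
Qed.

Lemma wop_isometry : @hisometry R L L (wop t b p).
Proof.
split; first exact: wop_mem.
- move=> a u v hu hv; have LP := L2R_prehilbert R.
  rewrite wop_linear; apply: (heq_refl LP); apply: (hmemZD LP); exact: wop_mem.
- move=> u v hu hv.
  have [ir ii] := cprod_integrable measurableT hu hv.
  have [mr mi] := cmeasurableM (proj1 hu) (cmeasurable_conj (proj1 hv)).
  have [ir' Er] := Rintegral_affine b t0 mr ir.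
  have [ii' Ei] := Rintegral_affine b t0 mi ii.
  rewrite /hinner /= /cintegral Er Ei.
  apply: complex_eq => /=.
    rewrite -RintegralZl//; apply: eq_Rintegral => x _.
    by rewrite wop_conjM ReZr.
  rewrite -RintegralZl//; apply: eq_Rintegral => x _.
  by rewrite wop_conjM ImZr.
Qed.

End WeightedComposition.

Section Schroedinger.
Variables (R : realType) (N : int).
Local Notation L := (L2R R).
Local Notation hmemL f := (@hmem R L f).
Local Notation NR := (N%:~R : R).

(** The Heisenberg element acts before the dilation, so its phase is evaluated at t x. *)
Definition schr_phase (g : HJ R) : R -> R[i] :=
  fun x => e2pi (NR * HJz g + HJa g * (HJt g * x)).

(* [schr] is the transport of [rhoJ] to L^2(R) *)
Definition schr (g : HJ R) : (R -> R[i]) -> R -> R[i] :=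
  wop (HJt g) (NR * HJc g) (schr_phase g).

Lemma cmeasurable_schr_phase g : cmeasurable (schr_phase g).
Proof.
apply: cmeasurable_e2pi_comp.
rewrite (_ : (fun x => _) = (fun x => HJa g * HJt g * x + NR * HJz g)).
  exact: measurable_affine.
by apply/funext => x; ring.
Qed.

Lemma schr_isometry g : @hisometry R L L (schr g).
Proof.
apply: wop_isometry; first exact: HJt_neq0.
  exact: cmeasurable_schr_phase.
by move=> x; exact: normc_e2pi.
Qed.

Lemma schrM g h f : schr (g * h)%g f = schr g (schr h f).
Proof.
apply/funext => x; rewrite /schr /wop /schr_phase.
have -> : (g * h)%g = HJmul g h by [].
have := HJt_neq0 g; have := HJt_neq0 h.
case: g h => t t0 a c z [t' t0' a' c' z'] /= _ _.
rewrite normrM powRM ?normr_ge0// rmorphM.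
have -> : t * t' * x + NR * (t' * c + c') = t' * (t * x + NR * c) + NR * c'.
  by ring.
have -> : NR * (z + z' + t' * c * a') + (t'^-1 * a + a') * (t * t' * x) =
   (NR * z + a * (t * x)) + (NR * z' + a' * (t' * (t * x + NR * c))).
  by field.
by rewrite e2piD; ring.
Qed.

Lemma schr1 f : schr 1%g f = f.
Proof.
apply/funext => x; rewrite /schr /wop /schr_phase /=.
by rewrite normr1 powR1 !mulr0 mul0r addr0 e2pi0 !mul1r addr0.
Qed.

End Schroedinger.

(** Dominated convergence speaks of sequences. If convergence failed, points of [A] in balls of
    radius 1/(n+1) would form a bad sequence; [A] is the neighbourhood on which a common dominating
    function is available. *)
Lemma cvg_of_seq (R : realType) (V : pseudoMetricType R) (p : V) (A : set V)
    (F : V -> R) (l : R) : nbhs p A ->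
  (forall u : nat -> V, (forall n, A (u n)) -> u n @[n --> \oo] --> p ->
    F (u n) @[n --> \oo] --> l) ->
  F x @[x --> p] --> l.
Proof.
move=> pA H; apply/cvgrPdist_lt => e e0; apply: contrapT => nF.
have /choice[u uP] : forall n : nat, exists x, [/\ A x, ball p n.+1%:R^-1 x & e <= `|l - F x|].
  move=> n; apply: contrapT => nx; apply: nF.
  have : nbhs p (A `&` ball p (n.+1%:R^-1 : R)).
    by apply: filterI => //; apply: nbhsx_ballx; rewrite invr_gt0.
  apply: filterS => x [Ax bx]; rewrite ltNge; apply/negP => ex.
  by apply: nx; exists x.
have up : u n @[n --> \oo] --> p.
  apply/cvg_ballP => d d0.
  exists (Num.trunc d^-1) => // n /= nd.
  have [_ + _] := uP n; apply: le_ball.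
  rewrite invf_ple ?posrE// ltW// (lt_le_trans (truncnS_gt _))//.
  by rewrite ler_nat.
have uA n : A (u n) by case: (uP n).
have /cvgrPdist_lt/(_ _ e0)[n _ /(_ n (leqnn n))] := H u uA up.
by rewrite /= ltNge; case: (uP n) => _ _ ->.
Qed.

Section ComplexConvergence.
Variable R : realType.
Implicit Types u v : nat -> R[i].

Definition ccvg (u : nat -> R[i]) (l : R[i]) : Prop :=
  complex.Re (u n) @[n --> \oo] --> complex.Re l /\
  complex.Im (u n) @[n --> \oo] --> complex.Im l.

Lemma ccvg_cst (a : R[i]) : ccvg (fun _ => a) a.
Proof. by split; exact: cvg_cst. Qed.

Lemma ccvgD u v a b : ccvg u a -> ccvg v b -> ccvg (fun n => u n + v n) (a + b).
Proof.
move=> [u1 u2] [v1 v2]; split.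
  by rewrite ReD; under eq_fun do rewrite ReD; exact: cvgD.
by rewrite ImD; under eq_fun do rewrite ImD; exact: cvgD.
Qed.

Lemma ccvgM u v a b : ccvg u a -> ccvg v b -> ccvg (fun n => u n * v n) (a * b).
Proof.
move=> [u1 u2] [v1 v2]; split.
  by rewrite ReM; under eq_fun do rewrite ReM; apply: cvgB; exact: cvgM.
by rewrite ImM; under eq_fun do rewrite ImM; apply: cvgD; exact: cvgM.
Qed.

Lemma ccvg_real (u : nat -> R) (a : R) : u n @[n --> \oo] --> a ->
  ccvg (fun n => (u n)%:C) a%:C.
Proof. by move=> ua; split => //=; exact: cvg_cst. Qed.

Lemma ccvg_e2pi (u : nat -> R) (a : R) : u n @[n --> \oo] --> a ->
  ccvg (fun n => e2pi (u n)) (e2pi a).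
Proof.
move=> ua; split => /=.
  exact: (cvg_comp _ _ ua (@continuous_cos2pi R a)).
exact: (cvg_comp _ _ ua (@continuous_sin2pi R a)).
Qed.

Lemma ccvg_normc u a : ccvg u a -> normc (u n - a) ^+ 2 @[n --> \oo] --> (0 : R).
Proof.
move=> [u1 u2]; under eq_fun do rewrite normc_sqr ReD ImD ReN ImN.
rewrite (_ : 0 = (complex.Re a - complex.Re a) ^+ 2 + (complex.Im a - complex.Im a) ^+ 2); last first.
  by rewrite !subrr expr0n addr0.
by apply: cvgD; apply: cvgM; apply: cvgB => //; exact: cvg_cst.
Qed.

End ComplexConvergence.

Section StrongContinuity.
Variables (R : realType) (N : int).
Local Notation mu := (@lebesgue_measure R).
Local Notation L := (L2R R).
Local Notation hmemL f := (@hmem R L f).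
Local Notation NR := (N%:~R : R).
Local Notation R4 := (R * R * R * R)%type.
Let LP := L2R_prehilbert R.

(** [schr] as a function of the four coordinates, defined also at t = 0, so that limits are taken in
    a metric space and pulled back along [HJcoord]. *)
Let schrc (q : R4) : (R -> R[i]) -> R -> R[i] :=
  wop q.1.1.1 (NR * q.1.2) (fun x => e2pi (NR * q.2 + q.1.1.2 * (q.1.1.1 * x))).

Let schrcE g f : schr N g f = schrc (HJcoord g) f.
Proof. by []. Qed.

Lemma indic_itv_cvg (a b x : R) (y : nat -> R) : x != a -> x != b ->
  y n @[n --> \oo] --> x ->
  \1_`]a, b] (y n) @[n --> \oo] --> (\1_`]a, b] x : R).
Proof.
move=> xa xb yx; apply: cvg_near_cst.
have [xI|xI] := boolP (x \in `]a, b]).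
  have {}xI : x \in `]a, b[.
    by move: xI; rewrite !in_itv/= => /andP[-> xleb]; rewrite lt_neqAle xb.
  have : \forall n \near \oo, y n \in `]a, b[.
    exact: (yx _ (near_in_itvoo xI)).
  apply: filterS => n yn; apply/eqP; rewrite !indicE.
  rewrite !mem_set//=; move: xI yn; rewrite !in_itv/=.
    by move=> /andP[-> /ltW ->].
  by move=> _ /andP[-> /ltW ->].
have : (x \in `]-oo, a[) \/ (x \in `]b, +oo[).
  move: xI; rewrite !in_itv/= andbT negb_and -leNgt -ltNge le_eqVlt (negbTE xa)/=.
  by move/orP.
case=> xI'.
  have : \forall n \near \oo, y n \in `]-oo, a[.
    exact: (yx _ (near_in_itvNyo xI')).
  apply: filterS => n yn; apply/eqP; rewrite !indicE !memNset//=; first exact/negP.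
  move: yn; rewrite !in_itv/= => yn /andP[]; rewrite ltNge.
  by rewrite (ltW yn).
have : \forall n \near \oo, y n \in `]b, +oo[.
  exact: (yx _ (near_in_itvoy xI')).
apply: filterS => n yn; apply/eqP; rewrite !indicE !memNset//=; first exact/negP.
by move: yn; rewrite !in_itv/= andbT => yn /andP[_]; rewrite leNgt yn.
Qed.

(** Pointwise convergence can fail only at the two points sent to a or b. Near g0 all the functions
    are supported in one interval [-M, M] and bounded, hence dominated. *)
Lemma schr_cvg_indic (a b : R) (g0 : HJ R) :
  let f := restr `]a, b] (fun _ => 1) in
  @hnorm R L (schr N g f - schr N g0 f : hcar L) @[g --> g0] --> (0 : R).
Proof.
move=> f; set t0 := HJt g0; set c0 := HJc g0; have t00 : t0 != 0 := HJt_neq0 g0.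
have T0 : 0 < `|t0| by rewrite normr_gt0.
suff H : @hnorm R L (schrc q f - schrc (HJcoord g0) f : hcar L)
    @[q --> HJcoord g0] --> (0 : R).
  exact: (cvg_comp (@HJcoord R) _ (@initial_continuous _ _ (@HJcoord R) g0) H).
(* On [A] one has |t0| / 2 <= |t| <= 2 |t0| and |c| <= |c0| + 1. *)
pose A : set R4 := [set q | `|t0 - q.1.1.1| < `|t0| / 2 /\ `|c0 - q.1.2| < 1].
apply: (@cvg_of_seq _ _ _ A).
  have c1 : q.1.1.1 @[q --> HJcoord g0] --> t0.
    exact: (cvg_comp _ fst (cvg_comp _ fst cvg_fst cvg_fst) cvg_fst).
  have c2 : q.1.2 @[q --> HJcoord g0] --> c0.
    exact: (cvg_comp _ snd cvg_fst cvg_snd).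
  apply: filterI.
    by move/cvgrPdist_lt : c1; apply; rewrite divr_gt0.
  by move/cvgrPdist_lt : c2; apply.
move=> u uA ug.
have ug1 : (u n).1.1.1 @[n --> \oo] --> t0.
  exact: (cvg_comp _ fst (cvg_comp _ fst (cvg_comp _ fst ug cvg_fst) cvg_fst) cvg_fst).
have ug2 : (u n).1.1.2 @[n --> \oo] --> HJa g0.
  exact: (cvg_comp _ snd (cvg_comp _ fst (cvg_comp _ fst ug cvg_fst) cvg_fst) cvg_snd).
have ug3 : (u n).1.2 @[n --> \oo] --> c0.
  exact: (cvg_comp _ snd (cvg_comp _ fst ug cvg_fst) cvg_snd).
have ug4 : (u n).2 @[n --> \oo] --> HJz g0.
  exact: (cvg_comp _ snd ug cvg_snd).
have Ag0 : A (HJcoord g0) by split; rewrite /= subrr normr0 ?divr_gt0.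
(* If t x + N c lies in ]a, b] then |t x| <= [K]; dividing by |t| >= |t0| / 2 gives [M]. *)
pose K := `|a| + `|b| + `|NR| * (`|c0| + 1).
pose M := 2 * K / `|t0|.
have mf : cmeasurable f by apply: cmeasurable_restr => //; exact: cmeasurable_cst.
have ms q : cmeasurable (schrc q f).
  apply: cmeasurable_wop => //; apply: cmeasurable_e2pi_comp.
  rewrite (_ : (fun x => _) = (fun x => q.1.1.2 * q.1.1.1 * x + NR * q.2)).
    exact: measurable_affine.
  by apply/funext => x; ring.
have bnd q : A q -> forall x, normc (schrc q f x) ^+ 2 <= 2 * `|t0| * \1_`[- M, M] x.
  move=> [q1 q2] x; rewrite wop_normc; last by move=> y; exact: normc_e2pi.
  set t := q.1.1.1; set y := t * x + _.
  have tt : `|t| <= 2 * `|t0|.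
    have -> : t = t0 - (t0 - t) by ring.
    rewrite (le_trans (ler_normB _ _))//; move: q1; rewrite -/t; lra.
  have tt' : `|t0| / 2 <= `|t|.
    have : `|t0| <= `|t0 - t| + `|t| by rewrite -{1}(subrK t t0) ler_normD.
    move: q1; rewrite -/t; lra.
  rewrite /f /restr mulr1 normc_real.
  have [yI|yI] := boolP (y \in `]a, b]); last first.
    rewrite !indicE memNset; last exact/negP.
    by rewrite expr0n mulr0 mulr_ge0// mulr_ge0.
  have xM : x \in `[- M, M].
    rewrite in_itv/= -ler_norml ler_pdivlMr//.
    have yab : `|y| <= `|a| + `|b|.
      move: yI; rewrite in_itv/= ler_norml => /andP[ay yb].
      have := ler_norm (- a); have := ler_norm b; rewrite normrN.
      have := normr_ge0 a; have := normr_ge0 b => *; apply/andP; split; lra.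
    have cc : `|NR * q.1.2| <= `|NR| * (`|c0| + 1).
      rewrite normrM ler_wpM2l//.
      have -> : q.1.2 = c0 - (c0 - q.1.2) by ring.
      by rewrite (le_trans (ler_normB _ _))// lerD// ltW.
    have : `|t * x| <= K.
      have -> : t * x = y - NR * q.1.2 by rewrite /y addrK.
      by rewrite (le_trans (ler_normB _ _))// lerD.
    rewrite normrM => tx.
    have := ler_wpM2r (normr_ge0 x) tt'; nra.
  rewrite !indicE !mem_set//= expr1n !mulr1//.
have ih : mu.-integrable setT (EFin \o (fun x => 2 * `|t0| * \1_`[- M, M] x : R)).
  apply: (@integrableZl _ _ _ mu setT measurableT (2 * `|t0|) (EFin \o \1_`[- M, M])).
  exact: (@integrable_indic_itv R (- M) M true false).
have [] := @L2_dominated _ _ _ mu setT measurableT (fun n => schrc (u n) f)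
    (schrc (HJcoord g0) f) _ (fun n => ms _) (ms _) ih
    (fun n x _ => bnd _ (uA n) x) (fun x _ => bnd _ Ag0 x); last by [].
have neg : mu.-negligible ([set (a - NR * c0) / t0] `|` [set (b - NR * c0) / t0]).
  apply: negligibleU; apply/negligibleP => //; exact: lebesgue_measure_set1.
apply: negligibleS neg => x nx; apply: contrapT => /not_orP[xa xb].
apply: nx => _; apply: (@ccvg_normc R (fun n => schrc (u n) f x)); rewrite /schrc /wop.
have step : (u n).1.1.1 * x + NR * (u n).1.2 @[n --> \oo] --> t0 * x + NR * c0.
  by apply: cvgD; [exact: cvgMl|exact: cvgMr].
apply: ccvgM.
  apply: ccvg_real; rewrite powR12_sqrt//.
  under eq_fun do rewrite powR12_sqrt//.
  have /(cvg_comp _ _ (cvg_norm ug1)) := @sqrt_continuous R `|t0|.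
  exact.
apply: ccvgM.
  apply: ccvg_e2pi; apply: cvgD; first exact: cvgMr.
  by apply: cvgM => //; exact: cvgMl.
rewrite /f /restr; apply: ccvgM; last exact: ccvg_cst.
apply: ccvg_real; apply: indic_itv_cvg => //.
- apply/eqP => E; apply: xa; by rewrite /= -E addrK [t0 * x]mulrC mulfK.
- apply/eqP => E; apply: xb; by rewrite /= -E addrK [t0 * x]mulrC mulfK.
Qed.

(** The operators are isometric, so by a three-epsilon argument the vectors with continuous orbit
    form a closed subspace; it contains the indicators of intervals, which are total. *)
Theorem schr_continuous (f : hcar L) (g0 : HJ R) : hmemL f ->
  @hnorm R L (schr N g f - schr N g0 f : hcar L) @[g --> g0] --> (0 : R).
Proof.
pose S : set (hcar L) := [set f | hmemL f /\ forall g0 : HJ R,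
  @hnorm R L (schr N g f - schr N g0 f : hcar L) @[g --> g0] --> (0 : R)].
have smem g (u : hcar L) : hmemL u -> hmemL (schr N g u).
  exact: (hisometry_mem (schr_isometry N g)).
suff -> : hmemL f = S f by case.
congr (_ f); apply/esym/L2R_total.
- split; first by move=> h [].
    split; first exact: (hmem0 LP).
    move=> g.
    suff -> : (fun h => @hnorm R L (schr N h 0 - schr N g 0 : hcar L)) = cst 0.
      exact: (@cvg_cst R (0 : R) (HJ R) (nbhs g) _).
    apply/funext => h.
    have sz k : schr N k (0 : hcar L) = 0.
      apply/funext => x; rewrite /schr /wop. by rewrite [X in _ * (_ * X)](_ : _ = 0)// !mulr0.
    by rewrite !sz subrr (hnorm0 LP).
  move=> a u v [hu cu] [hv cv]; split; first exact: (hmemZD LP).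
  move=> g; apply: (@squeeze_cvgr _ (nbhs g) _ _ (cst 0) (fun h =>
     normc a * @hnorm R L (schr N h u - schr N g u : hcar L) +
     @hnorm R L (schr N h v - schr N g v : hcar L))).
  + apply: nearW => h; rewrite hnorm_ge0/= /schr !wop_linear opprD addrACA -scalerBr.
    have hB w : hmemL w -> hmemL (schr N h w - schr N g w : hcar L).
      by move=> hw; apply: (hmemB LP); exact: smem.
    apply: le_trans (hnormD LP (hmemZ LP _ (hB _ hu)) (hB _ hv)) _.
    by rewrite (hnormZ LP _ (hB _ hu)).
  + exact: (@cvg_cst R (0 : R) (HJ R) (nbhs g) _).
  + rewrite (_ : 0 = normc a * 0 + 0); last by rewrite mulr0 addr0.
    by apply: cvgD; [apply: cvgMr; exact: cu|exact: cv].
- move=> u v uS hv uv; split=> // g.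
  apply/(@cvgr0Pnorm_lt _ _ _ _ (nbhs_filter g)) => e e0.
  have e3 : 0 < e / 3 by rewrite divr_gt0.
  have /cvgr0Pnorm_lt/(_ _ e3)[n _ /(_ n (leqnn n)) /=] := uv.
  rewrite ger0_norm ?hnorm_ge0// => un.
  have [hu cu] := uS n.
  have /(@cvgr0Pnorm_lt _ _ _ _ (nbhs_filter g))/(_ _ e3) := cu g.
  apply: (@filterS _ _ (nbhs_filter g)) => h; rewrite !ger0_norm ?hnorm_ge0// => H.
  have hs k w := smem k w.
  apply: le_lt_trans (hnormB_le LP (hs h _ hv) (hs h _ hu) (hs g _ hv)) _.
  apply: le_lt_trans (lerD (lexx _) (hnormB_le LP (hs h _ hu) (hs g _ hu) (hs g _ hv))) _.
  rewrite !(iso_hnormB LP LP (schr_isometry N _))// (hnormB_sym LP hv hu).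
  lra.
- move=> a b; split; last by move=> g; exact: schr_cvg_indic.
  apply: (@square_integrable_le R _ _ mu setT measurableT _ (\1_`]a, b])).
  - by apply: cmeasurable_restr => //; exact: cmeasurable_cst.
  - exact: (@integrable_indic_itv R a b false false).
  - move=> x _; rewrite /restr mulr1 normc_real indicE.
    by case: (_ \in _); rewrite /= ?expr1n ?expr0n.
Qed.

End StrongContinuity.

(** * From modulations to multiplication by indicators *)

Section SignIteration.
Variable R : realType.
Implicit Types y : R.

(** The Newton-Schulz iteration for the sign: an odd polynomial that maps [-1, 1] into itself and
    fixes -1, 0 and 1. It reaches sgn by polynomials, under which multipliers of a subspace can be
    followed. *)
Definition sgn_step y : R := (3 * y - y ^+ 3) / 2.

Lemma sgn_step_bound y : `|y| <= 1 -> `|sgn_step y| <= 1.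
Proof.
rewrite /sgn_step !ler_norml => /andP[y1 y2].
have A : 0 <= (y - 1) ^+ 2 * (y + 2) by rewrite mulr_ge0 ?sqr_ge0//; lra.
have B : 0 <= (y + 1) ^+ 2 * (2 - y) by rewrite mulr_ge0 ?sqr_ge0//; lra.
have A' : (y - 1) ^+ 2 * (y + 2) = y ^+ 3 - 3 * y + 2 by ring.
have B' : (y + 1) ^+ 2 * (2 - y) = - y ^+ 3 + 3 * y + 2 by ring.
rewrite A' in A; rewrite B' in B.
by apply/andP; split; lra.
Qed.

(** The iterates increase, since one step adds u (1 - u^2) / 2, and stay at most 1; the limit is a
    fixed point at least y > 0, so it is 1. *)
Lemma iter_sgn_step_cvg_pos y : 0 < y -> y <= 1 ->
  iter n sgn_step y @[n --> \oo] --> (1 : R).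
Proof.
move=> y0 y1; pose u n := iter n sgn_step y.
have ub n : 0 < u n <= 1.
  elim: n => [|n /andP[u0 u1]]; first by rewrite /u /= y0.
  have : `|sgn_step (u n)| <= 1 by apply: sgn_step_bound; rewrite gtr0_norm.
  rewrite ler_norml => /andP[_ s1]; apply/andP; split; last exact: s1.
  rewrite /u /= -/(u n) /sgn_step (_ : 3 * u n - u n ^+ 3 = u n * (3 - u n ^+ 2)); last by ring.
  rewrite divr_gt0// mulr_gt0// subr_gt0 (le_lt_trans (_ : _ <= 1))//.
    by rewrite expr_le1// ltW.
  by lra.
have nd : nondecreasing_seq u.
  apply/nondecreasing_seqP => n; have /andP[u0 u1] := ub n.
  rewrite [leRHS]/u /= -/(u n) /sgn_step -subr_ge0.
  have -> : (3 * u n - u n ^+ 3) / 2 - u n = u n * (1 - u n ^+ 2) / 2 by field.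
  by rewrite divr_ge0// mulr_ge0 ?(ltW u0)// subr_ge0 expr_le1// ltW.
have cu : cvgn u.
  apply: nondecreasing_is_cvgn => //; exists 1 => _ [n _ <-].
  by case/andP: (ub n).
have lim1 : sgn_step (limn u) = limn u.
  have : u n.+1 @[n --> \oo] --> limn u by rewrite (@cvg_shiftS R u).
  have : u n.+1 @[n --> \oo] --> sgn_step (limn u).
    rewrite (_ : (fun n => u n.+1) = (fun n => sgn_step (u n)))//.
    apply: cvgMl; apply: cvgB; first exact: cvgMr.
    by apply: cvgM => //; apply: cvgM.
  by move=> h1 h2; exact: (cvg_unique _ h1 h2).
have l0 : y <= limn u by have := nondecreasing_cvgn_le nd cu 0%N.
have : limn u * (1 - limn u) * (1 + limn u) = 0.
  move: lim1; rewrite /sgn_step; move: (limn u) => l E.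
  have -> : l * (1 - l) * (1 + l) = l - l ^+ 3 by ring.
  by lra.
move/eqP; rewrite !mulf_eq0 => /orP[/orP[]|].
- by rewrite gt_eqF// (lt_le_trans y0).
- by rewrite subr_eq0 => /eqP E; rewrite [X in _ --> X]E.
- by rewrite gt_eqF// addr_gt0// (lt_le_trans y0).
Qed.

Lemma iter_sgn_step_cvg y : `|y| <= 1 ->
  iter n sgn_step y @[n --> \oo] --> Num.sg y.
Proof.
move=> y1; have [y0|y0|->] := ltgtP y 0.
- rewrite ltr0_sg//.
  rewrite (_ : (fun n => iter n sgn_step y) = (fun n => - iter n sgn_step (- y))).
    apply: cvgN; apply: iter_sgn_step_cvg_pos; first by rewrite oppr_gt0.
    by rewrite -(ltr0_norm y0).
  apply/funext; elim=> [|n IH]; first by rewrite /= opprK.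
  by rewrite !iterS IH /sgn_step; field.
- by rewrite gtr0_sg//; apply: iter_sgn_step_cvg_pos => //; rewrite -(gtr0_norm y0).
- rewrite sgr0 (_ : (fun n => _) = cst 0); first exact: cvg_cst.
  apply/funext; elim=> [//|n IH]; rewrite iterS IH /sgn_step /cst.
  by rewrite mulr0 expr0n subrr mul0r.
Qed.

Lemma sgr_sin2pi y : `|y| < 2^-1 -> Num.sg (sin (2 * pi * y)) = Num.sg y.
Proof.
have pi0 := pi_gt0 R.
have pos (z : R) : 0 < z -> z < 2^-1 -> 0 < sin (2 * pi * z).
  move=> z0 z1; apply: sin_gt0_pi.
  by apply/andP; split; nra.
rewrite ltr_norml => /andP[y1 y2]; have [y0|y0|->] := ltgtP y 0.
- rewrite !ltr0_sg// -oppr_gt0 -sinN -mulrN pos ?oppr_gt0//; lra.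
- by rewrite !gtr0_sg// pos.
- by rewrite mulr0 sin0.
Qed.

End SignIteration.

Section Multipliers.
Variable R : realType.
Local Notation mu := (@lebesgue_measure R).
Local Notation L := (L2R R).
Local Notation hmemL f := (@hmem R L f).
Variable S : set (hcar L).
Hypotheses (Ss : hsubspace S) (Sc : hclosed S).
Hypothesis Smod : forall (a : R) f, S f -> S (fun x => e2pi (a * x) * f x).
Let LP := L2R_prehilbert R.

Let Smem f : S f -> hmemL f.
Proof. by case: Ss => SL _ _; exact: SL. Qed.

Definition multiplier (m : R -> R) : Prop :=
  [/\ measurable_fun setT m, forall x, `|m x| <= 1 &
      forall f, S f -> S (fun x => (m x)%:C * f x)].

(** The functions m_n f are dominated by |f|, so they converge to m' f in L^2, and S is closed. *)
Lemma multiplier_lim (m : nat -> R -> R) (m' : R -> R) :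
  (forall n, multiplier (m n)) -> (forall x, m n x @[n --> \oo] --> m' x) ->
  multiplier m'.
Proof.
move=> hm cm.
have mm' : measurable_fun setT m'.
  by apply: (measurable_realfun.measurable_fun_cvg (h := m)) => // n; case: (hm n).
have m1 x : `|m' x| <= 1.
  apply: (ler_cvg_to (cvg_norm (cm x)) (@cvg_cst _ (1:R) _ \oo _)).
  by apply: nearW => n; case: (hm n).
split=> // f Sf; have [mf fi] := Smem Sf.
apply: (Sc (u := fun n x => (m n x)%:C * f x)).
- by move=> n; case: (hm n) => _ _; exact.
- apply: square_integrable_le fi _ => //.
    by apply: cmeasurableM => //; exact: cmeasurable_real.
  move=> x _; rewrite normc_sqrM normc_real ler_piMl ?sqr_ge0//.
  by rewrite -[leLHS]real_normK ?num_real// expr_le1.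
have bnd (k : R -> R) x : `|k x| <= 1 -> normc ((k x)%:C * f x) ^+ 2 <= normc (f x) ^+ 2.
  move=> k1; rewrite normc_sqrM normc_real ler_piMl ?sqr_ge0//.
  by rewrite -[leLHS]real_normK ?num_real// expr_le1.
have [] := @L2_dominated _ _ _ mu setT measurableT (fun n x => (m n x)%:C * f x)
    (fun x => (m' x)%:C * f x) (fun x => normc (f x) ^+ 2).
- move=> n; apply: cmeasurableM => //; apply: cmeasurable_real; by case: (hm n).
- by apply: cmeasurableM => //; exact: cmeasurable_real.
- exact: fi.
- by move=> n x _; apply: bnd; case: (hm n).
- by move=> x _; exact: bnd.
- apply: aeW => x _; apply: (@ccvg_normc R (fun n => (m n x)%:C * f x)).
  by apply: ccvgM; [exact: ccvg_real|exact: ccvg_cst].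
by [].
Qed.

(** Euler's formula writes the sine as a combination of the modulations of frequency a and -a. *)
Lemma multiplier_sin (a s : R) : multiplier (fun x => sin (2 * pi * (a * x + s))).
Proof.
split.
- have ms : measurable_fun setT (fun x : R => sin (2 * pi * x)).
    by apply: continuous_measurable_fun; exact: continuous_sin2pi.
  exact: (measurableT_comp ms (measurable_affine a s)).
- by move=> x; rewrite ler_norml sin_geN1 sin_le1.
- move=> f Sf.
  rewrite (_ : (fun x => _) =
    (- (2^-1)%:C * 'i%C * e2pi s) *: ((fun x => e2pi (a * x) * f x) : hcar L) +
    ((2^-1)%:C * 'i%C * e2pi (- s)) *: ((fun x => e2pi ((- a) * x) * f x) : hcar L)).
    by apply: (hsubZD Ss); [|apply: (hsubZ Ss)]; exact: Smod.
  apply/funext => x; rewrite [RHS](_ : _ =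
    (- (2^-1)%:C * 'i%C * e2pi s) * (e2pi (a * x) * f x) +
    ((2^-1)%:C * 'i%C * e2pi (- s)) * (e2pi ((- a) * x) * f x))//.
  rewrite -!mulrA !(mulrA (e2pi _) (e2pi _)) -!e2piD.
  have -> : - s + - a * x = - (s + a * x) by ring.
  rewrite [a * x + s]addrC; move: (s + a * x) => y; rewrite -conj_e2pi.
  rewrite !mulrA -mulrDl; congr (_ * _).
  by apply: complex_eq; rewrite ?(ReD, ImD, ReM, ImM, Re_conj, Im_conj, ReN, ImN) /=; field.
Qed.

(** Each iterate of [sgn_step] at m is a combination of odd powers of m, hence a multiplier, and the
    iterates converge pointwise to sgn m. *)
Lemma multiplier_sgn (m : R -> R) : multiplier m ->
  multiplier (fun x => Num.sg (m x)).
Proof.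
move=> hm; apply: (@multiplier_lim (fun n x => iter n (@sgn_step R) (m x))); last first.
  by move=> x; apply: iter_sgn_step_cvg; case: hm.
elim=> [//|n [mm m1 mS]]; set k := fun x => _ in mm m1 mS.
split => /=; rewrite -/k.
- rewrite /sgn_step; apply: measurable_funM; last exact: measurable_cst.
  apply: measurable_funB; last exact: measurable_funX.
  by apply: measurable_funM => //; exact: measurable_cst.
- by move=> x; apply: sgn_step_bound; exact: m1.
- move=> f Sf; have S1 := mS _ Sf; have S3 := mS _ (mS _ S1).
  rewrite (_ : (fun x => _) = (3 / 2)%:C *: ((fun x => (k x)%:C * f x) : hcar L) +
    (- (2^-1))%:C *: ((fun x => (k x)%:C * ((k x)%:C * ((k x)%:C * f x))) : hcar L)).
    by apply: (hsubZD Ss) => //; exact: (hsubZ Ss).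
  apply/funext => x; rewrite [RHS](_ : _ = (3 / 2)%:C * ((k x)%:C * f x) +
    (- (2^-1))%:C * ((k x)%:C * ((k x)%:C * ((k x)%:C * f x))))//.
  rewrite /sgn_step -/(k x); apply: complex_eq; rewrite ?(ReD, ImD, ReM, ImM)/=.
    by field.
  by field.
Qed.

(** sgn(sin(2 pi (x - s) / n)) equals sgn(x - s) as soon as n > 2 |x - s|: the square waves become
    slow enough to look like one jump. *)
Lemma multiplier_sgnB (s : R) : multiplier (fun x => Num.sg (x - s)).
Proof.
apply: (@multiplier_lim (fun n x => Num.sg (sin (2 * pi * (n.+1%:R^-1 * x + - s / n.+1%:R))))).
  by move=> n; apply: multiplier_sgn; exact: multiplier_sin.
move=> x; apply: cvg_near_cst.
exists (Num.trunc (2 * `|x - s|)).+1 => // n /= nx; apply/eqP.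
have n0 : 0 < n.+1%:R :> R by [].
have -> : n.+1%:R^-1 * x + - s / n.+1%:R = (x - s) / n.+1%:R by field; rewrite gt_eqF.
rewrite sgr_sin2pi; first by rewrite sgrM sgrV (gtr0_sg n0) mulr1.
rewrite normrM normfV (gtr0_norm n0) ltr_pdivrMr//.
have : 2 * `|x - s| < n.+1%:R.
  by rewrite (lt_le_trans (truncnS_gt _))// ler_nat; exact: leqW.
lra.
Qed.

(** Away from the endpoints the indicator is (sgn(x - a) - sgn(x - b)) / 2. *)
Lemma S_restr_itv (a b : R) f : S f -> S (restr `]a, b] f).
Proof.
move=> Sf; have hf := Smem Sf.
have [ab|ba] := ltP a b; last first.
  rewrite set_itv_ge ?bnd_simp -?leNgt// (_ : restr _ _ = 0); first exact: (hsub0 Ss).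
  by apply/funext => x; rewrite /restr indic0 mul0r.
have [_ _ ma] := multiplier_sgnB a; have [_ _ mb] := multiplier_sgnB b.
have Sg : S ((2^-1)%:C *: (((fun x => (Num.sg (x - a))%:C * f x) : hcar L) -
    ((fun x => (Num.sg (x - b))%:C * f x) : hcar L))).
  by apply: (hsubZ Ss); apply: (hsubB Ss); [exact: ma|exact: mb].
apply: (hclosed_heq LP Sc Sg).
apply/(L2_heqP measurableT (Smem Sg)); first exact: restr_mem.
have neg : mu.-negligible ([set a] `|` [set b]).
  by apply: negligibleU; apply/negligibleP => //; exact: lebesgue_measure_set1.
apply: negligibleS neg => x nx; apply: contrapT => /not_orP[/= /eqP xa /eqP xb].
apply: nx => _; rewrite [LHS](_ : _ = (2^-1)%:C * ((Num.sg (x - a))%:C * f x -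
  (Num.sg (x - b))%:C * f x))// -mulrBl mulrA; congr (_ * _).
rewrite indicE; case: (boolP (x \in _)) => [/set_mem|/negP xI]; rewrite /=.
  rewrite in_itv/= => /andP[ax xleb]; have xltb : x < b by rewrite lt_neqAle xb.
  rewrite gtr0_sg ?subr_gt0// ltr0_sg ?subr_lt0//.
  by apply: complex_eq => /=; field.
have [xlta|ax|/eqP] := ltgtP x a; last by rewrite (negbTE xa).
  rewrite !ltr0_sg ?subr_lt0//; last exact: lt_trans ab.
  by apply: complex_eq => /=; field.
have bx : b < x.
  rewrite ltNge; apply/negP => xleb; apply: xI; apply/mem_set.
  by rewrite /= in_itv/= ax.
rewrite !gtr0_sg ?subr_gt0//.
by apply: complex_eq => /=; field.
Qed.

Lemma S_restr (D : set R) f : measurable D -> S f -> S (restr D f).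
Proof.
by move=> mD Sf; apply: measurable_mult => // a b; exact: S_restr_itv.
Qed.

End Multipliers.

(** * Zooming in at a Lebesgue point, and irreducibility on L^2(R) *)

Section Dilations.
Variable R : realType.
Local Notation mu := (@lebesgue_measure R).

Lemma cvg_to_right0 (r : nat -> R) : (forall n, 0 < r n) ->
  r n @[n --> \oo] --> (0 : R) -> r n @[n --> \oo] --> 0^'+.
Proof.
move=> r0 cr A At.
have H : \forall n \near \oo, 0 < r n -> A (r n) := cr _ At.
suff : \forall n \near \oo, A (r n) by [].
by apply: filterS H => n; exact.
Qed.

(** The substitution y = x / (n+1) + x0 bounds the integral by 2 (M+1) times the mean of |g - g(x0)|
    over the ball of radius (M+1) / (n+1), which tends to 0 at a Lebesgue point. *)
Lemma lebesgue_pt_dilate (g : R -> R) (x0 : R) (M : nat) :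
  measurable_fun setT g -> lebesgue_pt g x0 ->
  (\int[mu]_(x in `](- M%:R)%R, M%:R]) `|g (n.+1%:R^-1 * x + x0)%R - g x0|%R%:E)%E
    @[n --> \oo] --> 0%E.
Proof.
move=> mg Lg.
(* M+1 rather than M: the ball is open while the interval contains M, and the radius must be
   positive for M = 0. *)
pose r n : R := M.+1%:R / n.+1%:R.
have r0 n : 0 < r n by exact: divr_gt0.
have cr : r n @[n --> \oo] --> (0 : R).
  by rewrite -(mulr0 M.+1%:R); apply: cvgMr; exact: cvg_harmonic.
have Lr : davg g x0 (r n) @[n --> \oo] --> 0%E.
  exact: (cvg_comp _ _ (cvg_to_right0 r0 cr) Lg).
have mgx : measurable_fun setT (fun y => `|g y - g x0|).
  by apply: measurableT_comp => //; exact: measurable_funB.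
have bnd n : (\int[mu]_(x in `](- M%:R)%R, M%:R]) `|g (n.+1%:R^-1 * x + x0)%R - g x0|%R%:E <=
   (2 * M.+1%:R)%:E * davg g x0 (r n))%E.
  have n0 : 0 < n.+1%:R :> R by [].
  pose Phi y := ((\1_`](- M%:R)%R, M%:R] ((y - x0) * n.+1%:R) : R) * `|g y - g x0|)%:E.
  have mPhi : measurable_fun setT Phi.
    apply/measurable_EFinP; apply: measurable_funM => //.
    have m1 : measurable_fun setT (\1_`](- M%:R)%R, M%:R] : R -> R) by exact: measurable_indic.
    have := measurableT_comp m1 (measurable_affine n.+1%:R (- x0 * n.+1%:R)).
    apply: eq_measurable_fun => y _ /=.
    by congr (\1_ _ _); ring.
  have Phi0 y : (0 <= Phi y)%E by rewrite lee_fin mulr_ge0.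
  have E : (\int[mu]_(x in `](- M%:R)%R, M%:R]) `|g (n.+1%:R^-1 * x + x0)%R - g x0|%R%:E =
      n.+1%:R%:E * \int[mu]_y Phi y)%E.
    have t0 : n.+1%:R^-1 != 0 :> R by rewrite invr_eq0.
    rewrite (ge0_integral_affine x0 t0)// muleA -EFinM gtr0_norm ?invr_gt0//.
    rewrite mulfV// mul1e integral_mkcond; apply: eq_integral => x _.
    rewrite /Phi patchE addrK mulrAC mulVf// mul1r indicE.
    by case: (_ \in _); rewrite ?mul1r ?mul0r.
  rewrite E.
  have PhiB : (\int[mu]_y Phi y <= \int[mu]_(y in ball x0 (r n)) `|g y - g x0|%:E)%E.
    rewrite [leRHS]integral_mkcond; apply: ge0_le_integral => //.
      apply/(measurable_restrictT _ (measurable_ball _ _)).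
      exact/measurable_EFinP/measurable_funTS.
    move=> y _; rewrite /Phi patchE indicE.
    case: (boolP (_ \in `](- M%:R)%R, M%:R])%classic) => yM; last first.
      by rewrite mul0r; case: ifP => // _; rewrite lee_fin.
    rewrite mul1r mem_set//.
    move: yM => /set_mem /=; rewrite in_itv/= => /andP[y1 y2].
    rewrite /ball /= /r ltr_pdivlMr// distrC -(gtr0_norm n0) -normrM.
    rewrite ltr_norml; apply/andP; split; rewrite -natr1 ?(gtr0_norm n0); lra.
  have n0' : (0 <= n.+1%:R%:E :> \bar R)%E by rewrite lee_fin.
  rewrite (le_trans (lee_wpmul2l n0' PhiB))//.
  rewrite /davg /iavg lebesgue_measure_ball ?(ltW (r0 n))// muleA.
  rewrite [X in (_ <= _ * X * _)%E](_ : _ = ((r n *+ 2)^-1)%:E); last first.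
    by rewrite inver gt_eqF// mulrn_wgt0.
  rewrite -EFinM /r (_ : 2 * M.+1%:R * (M.+1%:R / n.+1%:R *+ 2)^-1 = n.+1%:R) ?le_refl//.
  rewrite -mulr_natl; field; apply/andP; split; first by rewrite gt_eqF.
  by rewrite nat1r pnatr_eq0.
apply: (@squeeze_cvge _ \oo _ _ (cst 0%E) _ (fun n => ((2 * M.+1%:R)%:E * davg g x0 (r n))%E)).
- apply: nearW => n; rewrite bnd andbT.
  by apply: integral_ge0 => x _; rewrite lee_fin.
- exact: cvg_cst.
- by rewrite -(mule0 (2 * M.+1%:R)%:E); exact: cvgeZl.
Qed.

End Dilations.

Section Irreducibility.
Variable R : realType.
Local Notation mu := (@lebesgue_measure R).
Local Notation L := (L2R R).
Local Notation hmemL f := (@hmem R L f).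
Variable S : set (hcar L).
Hypotheses (Ss : hsubspace S) (Sc : hclosed S).
Hypothesis Smod : forall (a : R) f, S f -> S (fun x => e2pi (a * x) * f x).
Hypothesis Saff : forall (t b : R) f, t != 0 -> S f -> S (fun x => f (t * x + b)).
Let LP := L2R_prehilbert R.

Let Smem f : S f -> hmemL f.
Proof. by case: Ss => SL _ _; exact: SL. Qed.

Lemma restr_cst_mem (z : R[i]) (a b : R) : hmemL (restr `]a, b] (fun _ => z)).
Proof.
have := @integrable_indic_itv R a b false false.
move=> /(integrableZl measurableT (normc z ^+ 2)) ih.
apply: (@square_integrable_le R _ _ mu setT measurableT _
    (fun x => normc z ^+ 2 * \1_`]a, b] x)) => //.
  by apply: cmeasurable_restr => //; exact: cmeasurable_cst.
move=> x _; rewrite normc_sqrM normc_real mulrC ler_wpM2l ?sqr_ge0//.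
by rewrite indicE; case: (_ \in _); rewrite /= ?expr1n ?expr0n.
Qed.

(** F(x / (n+1) + x0), cut to ]-M, M], stays in S and tends to the constant F(x0). A Lebesgue point
    gives L^1 convergence, and the bound B upgrades it: |F - F(x0)|^2 is at most 2 B times the sum
    of the deviations of real and imaginary part. *)
Lemma S_dilate_limit (F : R -> R[i]) (B x0 : R) (M : nat) :
  S F -> (forall x, normc (F x) ^+ 2 <= B ^+ 2) -> 0 <= B ->
  lebesgue_pt (fun x => complex.Re (F x)) x0 ->
  lebesgue_pt (fun x => complex.Im (F x)) x0 ->
  S (restr `](- M%:R), M%:R] (fun _ => F x0)).
Proof.
move=> SF FB B0 LR LI; have hF := Smem SF; have [[mr mi] _] := hF.
pose A : set R := `](- M%:R), M%:R]%classic.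
have mA : measurable A by exact: measurable_itv.
have hv : hmemL (restr A (fun _ => F x0)) := restr_cst_mem (F x0) _ _.
pose u n : hcar L := restr A (fun x => F (n.+1%:R^-1 * x + x0)).
have Su n : S (u n).
  by apply: S_restr => //; apply: Saff => //; rewrite invr_eq0.
apply: (Sc (u := u)) => //.
have H : @hnorm R L (u n - (restr A (fun _ => F x0)) : hcar L) ^+ 2 @[n --> \oo] --> (0 : R).
  have cR := lebesgue_pt_dilate M mr LR; have cI := lebesgue_pt_dilate M mi LI.
  have hB n : square_integrable mu setT (fun x => u n x - restr A (fun _ => F x0) x).
    exact: (hmemB LP (Smem (Su n)) hv).
  pose I1 n := (\int[mu]_(x in A) `|complex.Re (F (n.+1%:R^-1 * x + x0)%R) - complex.Re (F x0)|%R%:E)%E.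
  pose I2 n := (\int[mu]_(x in A) `|complex.Im (F (n.+1%:R^-1 * x + x0)%R) - complex.Im (F x0)|%R%:E)%E.
  suff : (@hnorm R L (u n - (restr A (fun _ => F x0)) : hcar L) ^+ 2)%:E @[n --> \oo] --> (0%:E : \bar R).
    by move/fine_cvg.
  apply: (@squeeze_cvge _ \oo _ _ (cst 0%E) _ (fun n => ((2 * B)%:E * (I1 n + I2 n))%E)); last 2 first.
  - exact: cvg_cst.
  - have -> : 0%:E = ((2 * B)%:E * (0 + 0))%E :> \bar R by rewrite adde0 mule0.
    by apply: cvgeZl => //; apply: cvgeD.
  apply: nearW => n; rewrite lee_fin sqr_ge0/= (L2_hnorm_sqrE measurableT (hB n)).
  have mabs (k : R -> R) c : measurable_fun setT k ->
      measurable_fun A (fun x => `|k (n.+1%:R^-1 * x + x0) - c|%:E).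
    move=> mk; apply/measurable_EFinP/measurable_funTS; apply: measurableT_comp => //.
    apply: measurable_funB => //.
    exact: (measurableT_comp mk (measurable_affine _ _)).
  have m1 := mabs (fun y => complex.Re (F y)) (complex.Re (F x0)) mr.
  have m2 := mabs (fun y => complex.Im (F y)) (complex.Im (F x0)) mi.
  rewrite -ge0_integralD//.
  rewrite -ge0_integralZl_EFin//; last 2 first.
  - exact: emeasurable_funD.
  - by rewrite mulr_ge0.
  rewrite [leRHS]integral_mkcond; apply: ge0_le_integral => //.
  - by move=> x _; rewrite lee_fin sqr_ge0.
  - by apply/measurable_EFinP/measurable_normc_sqr; case: (hB n).
  - apply/(measurable_restrictT _ mA); apply: emeasurable_funM; first exact: measurable_cst.
    exact: emeasurable_funD.
  move=> x _; rewrite patchE /u /restr -mulrBr normc_sqrM normc_real indicE.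
  case: (x \in A); last by rewrite expr0n mul0r.
  rewrite expr1n mul1r -EFinD -EFinM lee_fin normc_sqr ReD ImD ReN ImN.
  have bd y : `|complex.Re (F y)| <= B /\ `|complex.Im (F y)| <= B.
    have := FB y; rewrite normc_sqr => H1.
    split; rewrite -(@ler_pXn2r _ 2) ?nnegrE// real_normK ?num_real//.
      by rewrite (le_trans _ H1)// lerDl sqr_ge0.
    by rewrite (le_trans _ H1)// lerDr sqr_ge0.
  have sq a b : `|a| <= B -> `|b| <= B -> (a - b) ^+ 2 <= 2 * B * `|a - b|.
    move=> aB bB; rewrite -[leLHS]real_normK ?num_real// expr2 ler_wpM2r//.
    by rewrite (le_trans (ler_normB _ _))// mulr_natl mulr2n lerD.
  have [b1 b2] := bd x0; have [b3 b4] := bd (n.+1%:R^-1 * x + x0).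
    by rewrite mulrDr lerD// sq.
  by move=> x _; rewrite adde_ge0// lee_fin.
have := cvg_comp _ _ H (@sqrt_continuous R 0); rewrite sqrtr0.
by apply: cvg_trans; apply: near_eq_cvg; apply: nearW => n /=;
  rewrite sqrtr_sqr ger0_norm// sqrtr_ge0.
Qed.

(** [S_dilate_limit], applied to a bounded truncation of f at a Lebesgue point where f does not
    vanish, puts nonzero constants on all bounded intervals into S; these are total. *)
Lemma S_full f : S f -> @hnorm R L f <> 0 -> S = @hmem R L.
Proof.
move=> Sf fn0; have hf := Smem Sf; have [mf fi] := hf.
have mn := measurable_normc_sqr mf.
pose A (k : nat) : set R := `](- k%:R), k%:R]%classic `&` [set x | normc (f x) ^+ 2 <= k%:R].
have mA k : measurable (A k).
  apply: measurableI; first exact: measurable_itv.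
  have := mn measurableT `]-oo, k%:R]%classic (measurable_itv _).
  by rewrite setTI preimage_itvNyc.
pose F k := restr (A k) f.
have SF k : S (F k) by exact: S_restr.
have FB k x : normc (F k x) ^+ 2 <= k.+1%:R ^+ 2.
  rewrite /F /restr normc_sqrM normc_real indicE.
  case: (boolP (x \in A k)) => [/set_mem [_ /= xk]|_]; last first.
    by rewrite expr0n mul0r sqr_ge0.
  rewrite expr1n mul1r (le_trans xk)// -natrX ler_nat; lia.
have iF k (p : R[i] -> R) : measurable_fun setT (fun x => p (F k x)) ->
    (forall z, p z ^+ 2 <= normc z ^+ 2) -> p 0 = 0 ->
    {ae mu, forall x, lebesgue_pt (fun x => p (F k x)) x}.
  move=> mp pz p0; apply: lebesgue_differentiation.
  apply: open_integrable_locally; first exact: openT.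
  have := @integrable_indic_itv R (- k%:R) k%:R false false.
  move=> /(integrableZl measurableT k.+1%:R); apply: le_integrable => //.
    exact/measurable_EFinP.
  move=> x _ /=; rewrite lee_fin.
  rewrite [leRHS]ger0_norm ?mulr_ge0//.
  have [xA|xA] := pselect (A k x).
    rewrite indicE mem_set ?mulr1; last by case: xA.
    rewrite -(@ler_pXn2r _ 2) ?nnegrE// real_normK ?num_real//.
    exact: le_trans (pz _) (FB k x).
  rewrite (_ : F k x = 0) ?p0 ?normr0 ?mulr_ge0//.
  by rewrite /F /restr indicE memNset// mul0r.
have iR k : {ae mu, forall x, lebesgue_pt (fun x => complex.Re (F k x)) x}.
  apply: (iF k (@complex.Re R)) => //.
    by case: (Smem (SF k)) => -[].
  by move=> z; rewrite normc_sqr lerDl sqr_ge0.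
have iI k : {ae mu, forall x, lebesgue_pt (fun x => complex.Im (F k x)) x}.
  apply: (iF k (@complex.Im R)) => //.
    by case: (Smem (SF k)) => -[].
  by move=> z; rewrite normc_sqr lerDr sqr_ge0.
(* A Lebesgue point of all truncations at once, because the truncation to be used is chosen after
   [x0]. *)
have [x0 [fx0 LR LI]] : exists x0, [/\ f x0 <> 0,
    forall k, lebesgue_pt (fun x => complex.Re (F k x)) x0 &
    forall k, lebesgue_pt (fun x => complex.Im (F k x)) x0].
  apply: contrapT => nex; apply: fn0; apply/(L2_hnorm_ae measurableT hf).
  have := ae_foralln iI; apply: filterS2 (ae_foralln iR) => x hR hI _.
  by apply: contrapT => fx; apply: nex; exists x.
pose k := (Num.trunc (`|x0| + normc (f x0) ^+ 2)).+1.
have kb : `|x0| + normc (f x0) ^+ 2 < k%:R by exact: truncnS_gt.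
have Fx0 : F k x0 = f x0.
  rewrite /F /restr indicE mem_set ?mul1r//; split.
    rewrite /= in_itv/=.
    have : `|x0| < k%:R by rewrite (le_lt_trans _ kb)// lerDl sqr_ge0.
    by rewrite ltr_norml => /andP[-> /ltW].
  by rewrite /= ltW// (le_lt_trans _ kb)// lerDr.
have SM M : S (restr `](- M%:R), M%:R] (fun _ => f x0)).
  by rewrite -Fx0; apply: (S_dilate_limit M (SF k) (FB k)).
apply: L2R_total => // a b.
pose M := (Num.trunc (`|a| + `|b|)).+1.
have Mb : `|a| + `|b| < M%:R by exact: truncnS_gt.
have -> : restr `]a, b] (fun _ => 1) = restr `]a, b]
    ((f x0)^-1 *: (restr `](- M%:R), M%:R] (fun _ => f x0) : hcar L)).
  apply/funext => x; rewrite /restr [X in _ = _ * X](_ : _ =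
     (f x0)^-1 * ((\1_`](- M%:R), M%:R] x)%:C * f x0))//.
  rewrite [X in _ = _ * X]mulrCA mulVf ?mulr1; last exact/eqP.
  rewrite !indicE; case: (boolP (x \in `]a, b]%classic)) => [/set_mem|_]; last by rewrite mul0r.
  rewrite /= in_itv/= => /andP[ax xb]; rewrite mem_set ?mulr1//= in_itv/=.
  have := ler_norm (- a); have := ler_norm b; rewrite normrN.
  have := normr_ge0 a; have := normr_ge0 b => *; apply/andP; split; lra.
by apply: S_restr => //; exact: (hsubZ Ss).
Qed.

End Irreducibility.

(** * Schwartz functions of the form P exp(Q) *)

Section PolyExp.
Variable R : realType.
Implicit Types (P Q : {poly R}).

(** A class closed under differentiation controls all derivatives at once. It is used for the
    functions P exp(Q) with Q fixed and P varying. *)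
Lemma rschwartz_class (A : set (R -> R)) :
  (forall f, A f -> forall x, derivable f x 1) ->
  (forall f, A f -> A (derive1 f)) ->
  (forall f, A f -> forall m, exists B, forall x, `|x| ^+ m * `|f x| <= B) ->
  forall f, A f -> rschwartz f.
Proof.
move=> Ad A1 AB f Af n.
have An : A (derive1n n f) by elim: n => [//|n IH]; rewrite derive1nS; exact: A1.
by split=> [|m]; [exact: Ad|exact: AB].
Qed.

Definition polyexp P Q : R -> R := fun x => P.[x] * expR Q.[x].

Lemma is_derive_polyexp P Q (x : R) :
  is_derive x (1 : R) (polyexp P Q) (polyexp (P^`() + P * Q^`()) Q x).
Proof.
have h : is_derive x (1 : R) (horner P * (expR \o horner Q)) (P.[x] *: (expR Q.[x] * Q^`().[x]) + (expR Q.[x]) *: P^`().[x]).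
  by apply: is_deriveM.
apply: (is_derive_eq h).
rewrite /polyexp hornerD hornerM /GRing.scale /=; ring.
Qed.

Lemma poly_growth P : exists C : R, exists d : nat,
  forall x, `|P.[x]| <= C * (1 + `|x|) ^+ d.
Proof.
elim/poly_ind: P => [|P r [C [d H]]].
  by exists 0, 0%N => x; rewrite horner0 normr0 mul0r.
exists (C + `|r|), d.+1 => x; rewrite hornerMXaddC.
have x1 : 1 <= 1 + `|x| by rewrite lerDl.
rewrite (le_trans (ler_normD _ _))// normrM mulrDl lerD//.
  rewrite exprSr mulrA; apply: ler_pM => //; first by rewrite lerDr.
by rewrite ler_peMr// exprn_ege1.
Qed.

(** For M > 0, raise 1 + u <= exp(u) with u = c s / M to the power M, and compare 1 + s with (1 + M
    / c) (1 + u). *)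
Lemma pow_exp_bounded (c : R) (M : nat) : 0 < c ->
  exists B, forall s, 0 <= s -> (1 + s) ^+ M * expR (- (c * s)) <= B.
Proof.
move=> c0; case: M => [|M].
  exists 1 => s s0; rewrite mul1r -expR0 ler_expR oppr_le0 mulr_ge0// ltW//.
pose k : R := 1 + M.+1%:R / c; exists (k ^+ M.+1) => s s0.
have M0 : 0 < M.+1%:R :> R by [].
have e1 : 1 + c * s / M.+1%:R <= expR (c * s / M.+1%:R) by exact: expR_ge1Dx.
have t0 : 0 <= c * s / M.+1%:R by rewrite divr_ge0// mulr_ge0// ltW.
have e2 : (1 + c * s / M.+1%:R) ^+ M.+1 <= expR (c * s).
  rewrite (_ : expR (c * s) = expR (c * s / M.+1%:R) ^+ M.+1); last first.
    by rewrite -expRM_natl -mulr_natl mulrCA divff ?mulr1// gt_eqF.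
  by rewrite ler_pXn2r ?nnegrE ?expR_ge0 ?addr_ge0.
rewrite expRN ler_pdivrMr ?expR_gt0// (le_trans _ (ler_wpM2l _ e2))//; last first.
  by rewrite exprn_ge0// addr_ge0// divr_ge0// ltW.
rewrite -exprMn ler_pXn2r ?nnegrE ?mulr_ge0 ?addr_ge0 ?divr_ge0 ?(ltW c0)//.
have -> : k * (1 + c * s / M.+1%:R) = 1 + s + (c * s / M.+1%:R + M.+1%:R / c).
  by rewrite /k; field; rewrite nat1r pnatr_eq0 /= gt_eqF.
  by rewrite lerDl addr_ge0// divr_ge0// ltW.
by rewrite mulr_ge0// ltW.
Qed.

Lemma rschwartz_polyexp P Q (c K : R) : 0 < c ->
  (forall x, Q.[x] <= K - c * `|x|) -> rschwartz (polyexp P Q).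
Proof.
move=> c0 QK.
apply: (@rschwartz_class [set f | exists P', f = polyexp P' Q]); last by exists P.
- by move=> _ [P' ->] x; have [] := is_derive_polyexp P' Q x.
- move=> _ [P' ->]; exists (P'^`() + P' * Q^`()); apply/funext => x.
  by rewrite derive1E; have [_ ->] := is_derive_polyexp P' Q x.
- move=> _ [P' ->] m; have [C [d H]] := poly_growth P'.
  have [B HB] := pow_exp_bounded (m + d) c0.
  exists (C * expR K * B) => x; rewrite /polyexp normrM (ger0_norm (expR_ge0 _)).
  have C0 : 0 <= C.
    by have := le_trans (normr_ge0 _) (H 0); rewrite normr0 addr0 expr1n mulr1.
  have x1 : `|x| ^+ m <= (1 + `|x|) ^+ m.
    by rewrite lerXn2r ?nnegrE ?addr_ge0// lerDr.
  have e1 : expR Q.[x] <= expR K * expR (- (c * `|x|)).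
    by rewrite -expRD ler_expR.
  have := ler_pM (exprn_ge0 m (normr_ge0 x)) (mulr_ge0 (normr_ge0 _) (expR_ge0 _))
    x1 (ler_pM (normr_ge0 _) (expR_ge0 _) (H x) e1).
  move/le_trans; apply.
  have := HB `|x| (normr_ge0 x).
  move/(ler_wpM2l (mulr_ge0 C0 (expR_ge0 K))); apply: le_trans.
  rewrite exprD le_eqVlt; apply/orP; left; apply/eqP; ring.
Qed.

Lemma rschwartz0 : rschwartz (cst 0 : R -> R).
Proof.
apply: (@rschwartz_class [set cst 0]) => //.
- by move=> _ -> x; exact: derivable_cst.
- by move=> _ ->; apply/funext => x /=; rewrite derive1_cst.
- by move=> _ -> m; exists 0 => x; rewrite normr0 mulr0.
Qed.

Lemma schwartz_real (f : R -> R) : rschwartz f -> schwartz (fun x => (f x)%:C).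
Proof. by move=> hf; split => //; exact: rschwartz0. Qed.

(* [exp (- (al x + be)^(2n+2))] tends to the indicator of [|al x + be| < 1]. *)
Definition flat_bump (al be : R) (n : nat) : R -> R :=
  polyexp 1 (- (al *: 'X + be%:P) ^+ (2 * n.+1)).

Lemma flat_bumpE (al be : R) n (x : R) :
  flat_bump al be n x = expR (- (al * x + be) ^+ (2 * n.+1)).
Proof. by rewrite /flat_bump /polyexp !hornerE. Qed.

Lemma flat_bump_bound (al be : R) n (x : R) :
  - (al * x + be) ^+ (2 * n.+1) <= (1 + `|be|) - `|al| * `|x|.
Proof.
set y := al * x + be.
have xy : `|al| * `|x| <= `|y| + `|be|.
  by rewrite -normrM (_ : al * x = y - be) ?ler_normB// /y addrK.
have y2 : `|y| - 1 <= y ^+ (2 * n.+1).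
  rewrite exprM -real_normK ?num_real// -exprM.
  have [y1|y1] := lerP 1 `|y|.
    have : `|y| ^+ 1 <= `|y| ^+ (2 * n.+1) by rewrite ler_weXn2l//; lia.
    by rewrite expr1; lra.
  by rewrite (@le_trans _ _ 0) ?exprn_ge0// subr_le0 ltW.
lra.
Qed.

Lemma schwartz_flat_bump (al be : R) n : al != 0 ->
  schwartz (fun x => (flat_bump al be n x)%:C).
Proof.
move=> al0; apply/schwartz_real/(@rschwartz_polyexp _ _ `|al| (1 + `|be|)).
  by rewrite normr_gt0.
by move=> x; rewrite !hornerE; exact: flat_bump_bound.
Qed.

End PolyExp.

(** * Functions decaying like 1/(1 + x^2); density results *)

Section Decaying.
Variable R : realType.
Local Notation mu := (@lebesgue_measure R).
Local Notation L := (L2R R).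
Local Notation hmemL f := (@hmem R L f).
Implicit Types f g : R -> R[i].

(** The domain on which the series of [W_schwartz] is studied. The decay gives absolute convergence,
    the class contains Schwartz functions and bounded truncations, and its stability under
    Heisenberg operators involves no derivatives. *)
Definition decaying f : Prop :=
  cmeasurable f /\ exists B, forall x, normc (f x) ^+ 2 * (1 + x ^+ 2) ^+ 2 <= B ^+ 2.

Lemma oneDsqrV_integrable : mu.-integrable setT (fun x => ((1 + x ^+ 2)^-1)%:E).
Proof.
have mf : measurable_fun setT (fun x : R => (1 + x ^+ 2)^-1).
  by apply: continuous_measurable_fun; exact: continuous_oneDsqrV.
have f0 (x : R) : 0 <= (1 + x ^+ 2)^-1 by rewrite invr_ge0 addr_ge0// sqr_ge0.
apply/integrableP; split; first exact/measurable_EFinP.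
under eq_integral do rewrite gee0_abs ?lee_fin//.
rewrite ge0_symfun_integralT//=.
- rewrite (_ : [set x | _] = `[0, +oo[%classic); last first.
    by apply/seteqP; split => x/=; rewrite in_itv/= andbT.
  by have := integral0y_oneDsqr R; rewrite /oneDsqr => ->; rewrite -EFinM ltry.
- exact: continuous_oneDsqrV.
- by move=> x/=; rewrite sqrrN.
Qed.

Lemma oneDsqr_ge1' (x : R) : 1 <= 1 + x ^+ 2.
Proof. by rewrite lerDl sqr_ge0. Qed.

Lemma decaying_bound f B x : normc (f x) ^+ 2 * (1 + x ^+ 2) ^+ 2 <= B ^+ 2 ->
  normc (f x) ^+ 2 <= B ^+ 2 * (1 + x ^+ 2)^-1.
Proof.
move=> H; have x1 := oneDsqr_ge1' x.
have x0 : 0 < 1 + x ^+ 2 by exact: lt_le_trans x1.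
rewrite ler_pdivlMr// (le_trans _ H)// ler_wpM2l ?sqr_ge0//.
by rewrite ler_eXnr.
Qed.

Lemma decaying_mem f : decaying f -> hmemL f.
Proof.
move=> [mf [B fB]].
apply: (@square_integrable_le R _ _ mu setT measurableT _
    (fun x => B ^+ 2 * (1 + x ^+ 2)^-1)) => //.
  exact: (integrableZl measurableT (B ^+ 2) oneDsqrV_integrable).
by move=> x _; exact: decaying_bound.
Qed.

Lemma decayingZD (a : R[i]) f g : decaying f -> decaying g ->
  decaying (fun x => a * f x + g x).
Proof.
move=> [mf [B fB]] [mg [C gC]]; split.
  by apply: cmeasurableD => //; exact: cmeasurableZ.
exists (Num.sqrt (2 * (normc a ^+ 2 * B ^+ 2) + 2 * C ^+ 2)) => x.
rewrite sqr_sqrtr; last first.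
  by rewrite addr_ge0 ?(mulr_ge0 _ (sqr_ge0 _)) ?(mulr_ge0 _ (mulr_ge0 (sqr_ge0 _) (sqr_ge0 _))).
have -> : a * f x + g x = a * f x - (- g x) by rewrite opprK.
rewrite (le_trans (ler_wpM2r (sqr_ge0 _) (normc_sqrB_le _ _)))//.
rewrite mulrDl normc_sqrM (_ : normc (- g x) ^+ 2 = normc (g x) ^+ 2); last first.
  by rewrite !normc_sqr ReN ImN !sqrrN.
have := ler_wpM2l (sqr_ge0 (normc a)) (fB x); have := gC x.
move: (normc a ^+ 2) (normc (f x) ^+ 2) (normc (g x) ^+ 2) ((1 + x ^+ 2) ^+ 2) => p q r s.
lra.
Qed.

Lemma rschwartz_decay (f : R -> R) : rschwartz f ->
  measurable_fun setT f /\ exists B, forall x, f x ^+ 2 * (1 + x ^+ 2) ^+ 2 <= B ^+ 2.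
Proof.
move=> /(_ 0%N)[df bf]; rewrite /= in df bf; split.
  apply: continuous_measurable_fun => x.
  exact/differentiable_continuous/derivable1_diffP/df.
have [B0 H0] := bf 0%N; have [B2 H2] := bf 2.
exists (B0 + B2) => x; rewrite -exprMn -[leLHS]real_normK ?num_real//.
rewrite ler_pXn2r ?nnegrE//; last first.
  by apply: addr_ge0; [apply: le_trans (H0 x)|apply: le_trans (H2 x)]; apply: mulr_ge0 => //; exact: exprn_ge0.
rewrite normrM [X in _ * X]ger0_norm; last by rewrite addr_ge0// sqr_ge0.
rewrite mulrDr mulr1 lerD//; first by have := H0 x; rewrite mul1r.
by have := H2 x; rewrite mulrC real_normK ?num_real.
Qed.

Lemma schwartz_decaying f : schwartz f -> decaying f.
Proof.
move=> [/rschwartz_decay[m1 [B1 H1]] /rschwartz_decay[m2 [B2 H2]]].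
split; first by split.
exists (Num.sqrt (B1 ^+ 2 + B2 ^+ 2)) => x.
by rewrite sqr_sqrtr ?addr_ge0 ?sqr_ge0// normc_sqr mulrDl lerD.
Qed.

Lemma expR_Nle_inv (z : R) : 0 < z -> expR (- z) <= z^-1.
Proof.
move=> z0; rewrite expRN lef_pV2 ?posrE ?expR_gt0//.
by rewrite (le_trans _ (expR_ge1Dx _))// lerDr.
Qed.

Lemma flat_bump_cvg (al be x : R) : (`|al * x + be| != 1 :> R) ->
  flat_bump al be n x @[n --> \oo] --> ((`|al * x + be| < 1)%R%:R : R).
Proof.
under eq_fun do rewrite flat_bumpE exprM -real_normK ?num_real//.
move: `|al * x + be| (normr_ge0 (al * x + be)) => y y0 y1.
have q0 : 0 <= y ^+ 2 by rewrite exprn_ge0.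
have [ylt|ygt] := ltP y 1.
  have c0 : - (y ^+ 2) ^+ n.+1 @[n --> \oo] --> (0 : R).
    rewrite -[0]oppr0; apply: cvgN.
    have : (y ^+ 2) ^+ n @[n --> \oo] --> (0 : R).
      by apply: cvg_expr; rewrite ger0_norm// expr_lt1.
    by rewrite -(@cvg_shiftS R).
  by have := cvg_comp _ _ c0 (@continuous_expR R 0); rewrite expR0.
have {ygt}ygt : 1 < y by rewrite lt_neqAle eq_sym y1.
have yp : 0 < y ^+ 2 by rewrite exprn_gt0// (lt_trans _ ygt).
apply: (@squeeze_cvgr _ _ _ _ (cst 0) (fun n => (y ^- 2) ^+ n.+1)).
- apply: nearW => n; rewrite expR_ge0/= exprVn expR_Nle_inv//.
  exact: exprn_gt0.
- exact: cvg_cst.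
- have : (y ^- 2) ^+ n @[n --> \oo] --> (0 : R).
    apply: cvg_expr; rewrite ger0_norm ?invr_ge0//.
    by rewrite invf_lt1// exprn_egt1.
  by rewrite -(@cvg_shiftS R).
Qed.

(** With y = al x + be mapping ]a, b[ onto ]-1, 1[, the functions exp(- y^(2n+2)) tend to the
    indicator of ]a, b] except at a and b, and their squares are dominated by 2 / (1 + y^2). *)
Lemma schwartz_total (S : set (hcar L)) : hsubspace S -> hclosed S ->
  (forall f, schwartz f -> S f) -> S = @hmem R L.
Proof.
move=> Ss Sc Sch; apply: L2R_total => // a b.
have [ab|ba] := ltP a b; last first.
  rewrite set_itv_ge ?bnd_simp -?leNgt// (_ : restr _ _ = 0); first exact: (hsub0 Ss).
  by apply/funext => x; rewrite /restr indic0 mul0r.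
have d0 : 0 < b - a by rewrite subr_gt0.
pose al := 2 / (b - a); pose be := - (a + b) / (b - a).
have al0 : al != 0 by rewrite mulf_neq0// invr_eq0 gt_eqF.
have yE x : al * x + be = (2 * x - a - b) / (b - a).
  by rewrite /al /be; field; rewrite gt_eqF.
pose u n : hcar L := fun x => (flat_bump al be n x)%:C.
have Su n : S (u n) by apply/Sch/schwartz_flat_bump.
have hv : hmemL (restr `]a, b] (fun _ => 1)) := restr_cst_mem 1 _ _.
apply: (Sc u) => //.
have ih0 : mu.-integrable setT (EFin \o (fun x : R => 2 * (1 + x ^+ 2)^-1)).
  exact: (integrableZl measurableT 2 oneDsqrV_integrable).
have mh : measurable_fun setT (fun x : R => 2 * (1 + x ^+ 2)^-1).
  by have /integrableP[/measurable_EFinP] := ih0.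
have [ih _] := Rintegral_affine be al0 mh ih0.
have inv1 (y : R) : 0 <= (1 + y ^+ 2)^-1 by rewrite invr_ge0 addr_ge0// sqr_ge0.
have inv2 (y : R) : `|y| <= 1 -> 1 <= 2 * (1 + y ^+ 2)^-1.
  move=> y1; rewrite ler_pdivlMr ?(lt_le_trans _ (oneDsqr_ge1' _))// mul1r.
  by rewrite -[X in _ + X]real_normK ?num_real// (natrD _ 1 1) lerD// expr_le1.
have xab x : (`|al * x + be| < 1) = (a < x < b).
  rewrite yE normrM normfV (gtr0_norm d0) ltr_pdivrMr// mul1r ltr_norml.
  by apply/idP/idP => /andP[? ?]; apply/andP; split; lra.
have [] := @L2_dominated _ _ _ mu setT measurableT u (restr `]a, b] (fun _ => 1)) _ _ _ ih; last by [].
- by move=> n; case: (decaying_mem (schwartz_decaying (schwartz_flat_bump be n al0))).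
- by case: hv.
- move=> n x _; rewrite normc_real flat_bumpE -expRM_natl; set y := al * x + be.
  have [y1|y1] := lerP `|y| 1.
    rewrite (le_trans _ (inv2 _ y1))// -expR0 ler_expR mulr_ge0_le0// oppr_le0.
    by rewrite exprM exprn_ge0// sqr_ge0.
  rewrite (@le_trans _ _ (expR (- y ^+ 2)))//; last first.
    rewrite expRN (@le_trans _ _ (1 + y ^+ 2)^-1)//; last by have := inv1 y; lra.
    rewrite lef_pV2 ?posrE ?expR_gt0 ?(lt_le_trans _ (oneDsqr_ge1' _))//.
    exact: expR_ge1Dx.
  rewrite ler_expR mulrN lerN2 exprM -real_normK ?num_real//.
  have q1 : 1 <= `|y| ^+ 2 by rewrite exprn_ege1// ltW.
  have : (`|y| ^+ 2) ^+ 1 <= (`|y| ^+ 2) ^+ n.+1 by rewrite ler_weXn2l.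
  by rewrite expr1; lra.
- move=> x _; rewrite /restr mulr1 normc_real indicE.
  case: (boolP (x \in _)) => [/set_mem|_]; last by rewrite expr0n mulr_ge0.
  rewrite /= in_itv/= expr1n => /andP[ax xb]; apply: inv2.
  rewrite yE normrM normfV (gtr0_norm d0) ler_pdivrMr// mul1r ler_norml.
  by apply/andP; split; lra.
- have neg : mu.-negligible ([set a] `|` [set b]).
    by apply: negligibleU; apply/negligibleP => //; exact: lebesgue_measure_set1.
  apply: negligibleS neg => x nx; apply: contrapT => /not_orP[/= /eqP xa /eqP xb].
  apply: nx => _; apply: (@ccvg_normc R (fun n => u n x)).
  rewrite /restr mulr1; apply: ccvg_real.
  have -> : \1_`]a, b] x = (`|al * x + be| < 1)%R%:R :> R.
    rewrite xab indicE; congr (_%:R); congr nat_of_bool.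
    apply/idP/idP => [/set_mem|/andP[ax xltb]].
      by rewrite /= in_itv/= => /andP[-> xleb]; rewrite lt_neqAle xb.
    by apply/mem_set; rewrite /= in_itv/= ax ltW.
  apply: flat_bump_cvg; rewrite yE normrM normfV (gtr0_norm d0).
  apply/eqP => /(congr1 ( *%R^~ (b - a))); rewrite mulfVK ?gt_eqF// mul1r => H.
  have : (2 * x - a - b) ^+ 2 = (b - a) ^+ 2 by rewrite -[LHS]real_normK ?num_real// H.
  move=> /eqP; rewrite -subr_eq0 (_ : _ - _ = 4 * (x - a) * (x - b)); last by ring.
  by rewrite !mulf_eq0 pnatr_eq0 !subr_eq0 (negbTE xa) (negbTE xb).
Qed.

(** Cutting f to |x| <= k and |f|^2 <= k gives decaying functions. *)
Lemma decaying_dense f : hmemL f -> exists2 u : nat -> R -> R[i],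
  (forall n, decaying (u n)) & @hnorm R L (u n - f : hcar L) @[n --> \oo] --> (0 : R).
Proof.
move=> hf; have [mf fi] := hf.
pose A (k : nat) : set R := `](- k%:R), k%:R]%classic `&` [set x | normc (f x) ^+ 2 <= k%:R].
have mA k : measurable (A k).
  apply: measurableI; first exact: measurable_itv.
  have mn := measurable_normc_sqr mf.
  have := mn measurableT `]-oo, k%:R]%classic (measurable_itv _).
  by rewrite setTI preimage_itvNyc.
have mr k : cmeasurable (restr (A k) f) by exact: cmeasurable_restr.
exists (fun k => restr (A k) f).
  move=> k; split => //; exists ((1 + k%:R ^+ 2) * (1 + k%:R)) => x.
  rewrite /restr normc_sqrM normc_real indicE.
  case: (boolP (x \in A k)) => [/set_mem [xk /= fk]|_]; last first.
    by rewrite expr0n !mul0r sqr_ge0.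
  rewrite expr1n mul1r exprMn mulrC.
  have xk2 : x ^+ 2 <= k%:R ^+ 2.
    rewrite -[leLHS]real_normK ?num_real// ler_pXn2r ?nnegrE// ler_norml.
    by move: xk; rewrite /= in_itv/= => /andP[/ltW -> ->].
  apply: ler_pM; rewrite ?sqr_ge0//.
    by rewrite ler_pXn2r ?nnegrE ?addr_ge0 ?sqr_ge0// lerD.
  rewrite (le_trans fk)//.
  have k0 : 0 <= k%:R :> R by []; nra.
have [] := @L2_dominated _ _ _ mu setT measurableT (fun k => restr (A k) f) f
  (fun x => normc (f x) ^+ 2) mr mf fi; last by [].
- by move=> n x _; exact: restr_le.
- by [].
- apply: aeW => x _; apply: cvg_near_cst.
  exists (Num.trunc (`|x| + normc (f x) ^+ 2)).+1 => // m /= nm; apply/eqP.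
  have kb : `|x| + normc (f x) ^+ 2 < m%:R.
    by rewrite (lt_le_trans (truncnS_gt _))// ler_nat.
  rewrite /restr indicE mem_set ?mul1r ?subrr ?normc_sqr /= ?expr0n ?addr0//.
  split; last by rewrite /= ltW// (le_lt_trans _ kb)// lerDr.
  rewrite /= in_itv/=.
  have : `|x| < m%:R by rewrite (le_lt_trans _ kb)// lerDl sqr_ge0.
  by rewrite ltr_norml => /andP[-> /ltW].
Qed.

End Decaying.

(** * The coefficients chi(n d / N) *)

Section CharacterSums.
Variables (R : realType) (N : int) (d : nat) (chi : int -> R[i]).
Hypotheses (N0 : N != 0) (d0 : (0 < d)%N) (dN : (d%:Z %| N)%Z).
Hypothesis hchi : dirichlet_character d chi.
Local Notation w := (chi_frac N d chi).

Lemma dirichlet_periodicM (n m : int) : chi (n + m * d%:Z) = chi n.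
Proof.
have nat_case (k : nat) p : chi (p + k%:Z * d%:Z) = chi p.
  elim: k p => [|k IH] p; first by rewrite mul0r addr0.
  by rewrite intS mulrDl mul1r addrA IH (dirichlet_periodic hchi).
case: m => k; first exact: nat_case.
rewrite NegzE -[RHS](nat_case k.+1).
by rewrite -[in RHS](subrK (k.+1%:Z * d%:Z) n) ?mulNr ?addrK ?nat_case ?subrK.
Qed.

Lemma dirichlet_modz (n : int) : chi (n %% d%:Z)%Z = chi n.
Proof. by rewrite [in RHS](divz_eq n d%:Z) addrC dirichlet_periodicM. Qed.

Lemma normc_exp (z : R[i]) k : normc (z ^+ k) = normc z ^+ k.
Proof.
elim: k => [|k IH]; first by rewrite !expr0 ComplexField.Normc.normc1.
by rewrite !exprS ComplexField.Normc.normcM IH.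
Qed.

(** By Euler's theorem chi(n)^phi(d) = 1 when n is coprime to d, so chi(n) has modulus 1. *)
Lemma dirichlet_normc (n : int) : normc (chi n) ^+ 2 = (coprimez n d%:Z)%:R.
Proof.
have := dirichlet_neq0 hchi n; case: (boolP (coprimez n d%:Z)) => [cp _|_ /negbFE/eqP ->];
  last by rewrite normc_sqr /= expr0n addr0.
pose a := `|(n %% d%:Z)%Z|%N.
have aE : a%:Z = (n %% d%:Z)%Z by rewrite gez0_abs// modz_ge0// eqz_nat -lt0n.
have cpa : coprime a d.
  have : coprimez a%:Z d%:Z by rewrite aE /coprimez gcdz_modl.
  by rewrite coprimezE !absz_nat.
have chiX k : chi ((a ^ k)%N%:Z) = chi a%:Z ^+ k.
  elim: k => [|k IH]; first by rewrite expn0 expr0 (dirichlet1 hchi).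
  by rewrite expnS PoszM (dirichletM hchi) IH exprS.
have : chi a%:Z ^+ totient d = 1.
  rewrite -chiX -(dirichlet1 hchi) -dirichlet_modz -[RHS]dirichlet_modz.
  by rewrite !modz_nat (cyclic.Euler_exp_totient cpa).
move=> /(congr1 (@ComplexField.Normc.normc R)).
rewrite normc_exp ComplexField.Normc.normc1 => /eqP.
rewrite pexprn_eq1 ?normc_ge0// eqn0Ngt totient_gt0 d0 /= => /eqP.
by rewrite -(dirichlet_modz n) -aE => ->; rewrite expr1n.
Qed.

Lemma chi_frac_periodic (n m : int) : w (n + N * m) = w n.
Proof.
rewrite /chi_frac mulrDl -mulrA.
rewrite rpredDr; last exact: (dvdz_mulr _ (dvdzz N)).
case: ifP => // NnD.
by rewrite [in LHS]addrC [N * _]mulrC divzMDl// addrC mulrC dirichlet_periodicM.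
Qed.

(** With q = |N| / d: N divides i d exactly when q divides i, and then i d / N is i / q up to the
    sign of N. *)
Lemma chi_frac_nat (i : nat) : normc (w i%:Z) ^+ 2 =
  ((`|N| %/ d %| i)%N && coprime (i %/ (`|N| %/ d)) d)%:R.
Proof.
have dN' : (d %| `|N|)%N by [].
set q := (`|N| %/ d)%N; have nq : `|N|%N = (q * d)%N by rewrite divnK.
have q0 : (0 < q)%N by rewrite divn_gt0// dvdn_leq// absz_gt0.
rewrite /chi_frac.
have -> : (N %| i%:Z * d%:Z)%Z = (q %| i)%N.
  by rewrite dvdzE abszM !absz_nat nq dvdn_pmul2r.
case: (boolP (q %| i)%N) => [/dvdnP[r ->]|_]; last by rewrite normc_sqr /= expr0n addr0.
rewrite mulnK// dirichlet_normc.
have -> : ((r * q)%N%:Z * d%:Z %/ N)%Z = sgz N * r%:Z.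
  have NE : N = sgz N * (q * d)%N%:Z by rewrite -nq -intEsg.
  have s2 : sgz N * sgz N = 1 by rewrite -expr2 sqr_sg N0.
  have -> : (r * q)%N%:Z * d%:Z = sgz N * r%:Z * N.
    rewrite [X in _ = _ * X]NE; move: (sgz N) s2 => s s2.
    rewrite -[LHS]mul1r -s2 !PoszM; ring.
  by rewrite mulzK.
have s1 : `|sgz N|%N = 1%N by move: N0; case: sgzP.
by rewrite /= coprimezE abszM !absz_nat s1 mul1n.
Qed.

(** By periodicity the window may start at 0; there only the multiples r q with r < d coprime to d
    contribute, each 1. This count is the phi(d) in the normalising constant. *)
Lemma chi_frac_window (k : int) :
  \sum_(0 <= i < `|N|) normc (w (k + i%:Z)) ^+ 2 = (totient d)%:R :> R.
Proof.
have dN' : (d %| `|N|)%N by [].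
set g := fun n => normc (w n) ^+ 2.
have gper n : g (n + `|N|%N%:Z) = g n.
  have -> : `|N|%N%:Z = N * sgz N.
    by rewrite {2}[N]intEsg mulrAC -expr2 sqr_sg N0 mul1r.
  by rewrite /g chi_frac_periodic.
have shift1 n : \sum_(0 <= i < `|N|) g (n + 1 + i%:Z) = \sum_(0 <= i < `|N|) g (n + i%:Z).
  have := gper n; have : (0 < `|N|)%N by rewrite absz_gt0.
  case: `|N|%N => // m _ gm.
  rewrite big_nat_recr//= [RHS]big_nat_recl//= addr0 addrC; congr (_ + _).
    by rewrite -[RHS]gm; congr g; lia.
  by apply: eq_big_nat => i _; congr g; lia.
have -> : \sum_(0 <= i < `|N|) g (k + i%:Z) = \sum_(0 <= i < `|N|) g i%:Z.
  have base n : \sum_(0 <= i < `|N|) g (n%:Z + i%:Z) = \sum_(0 <= i < `|N|) g i%:Z.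
    elim: n => [|n IH]; first by apply: eq_bigr => i _; rewrite add0r.
    by rewrite -IH -[RHS]shift1; apply: eq_bigr => i _; congr (g (_ + _)); lia.
  case: k => n; first exact: base.
  elim: n => [|n IH].
    by rewrite -(shift1 (Negz 0)); apply: eq_bigr => i _; rewrite NegzE addNr add0r.
  rewrite -IH -(shift1 (Negz n.+1)); apply: eq_bigr => i _; congr (g (_ + _)).
  by rewrite !NegzE; lia.
rewrite totient_count_coprime natr_sum.
set q := (`|N| %/ d)%N; have nq : `|N|%N = (d * q)%N by rewrite mulnC divnK.
have q0 : (0 < q)%N by rewrite divn_gt0// dvdn_leq// absz_gt0.
rewrite nq big_nat_mul; apply: eq_big_nat => r _.
rewrite big_ltn; last by rewrite mulSn; lia.
rewrite big_nat_cond big1.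
  by rewrite /g chi_frac_nat -/q dvdn_mull// mulnK// coprime_sym; exact: addr0.
move=> i; rewrite andbT => /andP[ri ir]; rewrite /g chi_frac_nat -/q.
case: (boolP (q %| i)%N) => // /dvdnP[m im]; exfalso.
by move: ri ir; rewrite im ltn_pmul2r// ltn_pmul2r// ltnS; lia.
Qed.

Lemma chi_frac_le1 n : normc (w n) ^+ 2 <= 1.
Proof.
rewrite /chi_frac; case: ifP => _; last by rewrite normc_sqr /= expr0n addr0.
by rewrite dirichlet_normc lern1 leq_b1.
Qed.

End CharacterSums.

(** * Absolutely convergent sums over the integers *)

Section SumZ.
Variable R : realType.
Implicit Types u v : int -> R[i].

(** The integers of absolute value at most n without repetition, so that the symmetric partial sums
    of [sumZ] become sums over a list. *)
Fixpoint zlist (n : nat) : seq int :=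
  if n is m.+1 then [:: m.+1%:Z, - m.+1%:Z & zlist m] else [:: 0].

Lemma mem_zlist n j : (j \in zlist n) = (`|j| <= n)%N.
Proof.
elim: n => [|n IH]; first by rewrite inE leqn0 absz_eq0.
rewrite !inE IH; lia.
Qed.

Lemma uniq_zlist n : uniq (zlist n).
Proof.
elim: n => [//|n IH] /=; rewrite IH inE !mem_zlist; lia.
Qed.

Definition psum u n : R[i] := \sum_(j <- zlist n) u j.

Lemma psumE u n :
  psum u n = u 0 + \sum_(0 <= k < n) (u k.+1%:Z + u (- k.+1%:Z)).
Proof.
elim: n => [|n IH]; first by rewrite /psum big_seq1 big_nil addr0.
rewrite big_nat_recr//= addrA -IH /psum /= !big_cons; ring.
Qed.

Lemma sumZ_unique u l : ccvg (psum u) l -> sumZ u = l.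
Proof.
move=> [h1 h2]; rewrite /sumZ.
rewrite (_ : (fun n => complex.Re _) = (fun n => complex.Re (psum u n))); last first.
  by apply/funext => n; rewrite psumE.
rewrite (_ : (fun n => complex.Im _) = (fun n => complex.Im (psum u n))); last first.
  by apply/funext => n; rewrite psumE.
by rewrite (cvg_lim _ h1)// (cvg_lim _ h2)//; case: (l).
Qed.

(** The bound |u_n| <= B / (1 + n^2) for B >= 0, in squared form. *)
Definition sq_decay u (B : R) : Prop :=
  forall n, normc (u n) ^+ 2 * (1 + n%:~R ^+ 2) ^+ 2 <= B ^+ 2.

Lemma sq_decay_abs u B n : 0 <= B -> sq_decay u B ->
  `|complex.Re (u n)| <= B / (1 + n%:~R ^+ 2) /\
  `|complex.Im (u n)| <= B / (1 + n%:~R ^+ 2).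
Proof.
move=> B0 /(_ n); have x0 : 0 < 1 + n%:~R ^+ 2 :> R.
  exact: (lt_le_trans ltr01 (oneDsqr_ge1' _)).
rewrite normc_sqr mulrDl => H.
rewrite !ler_pdivlMr//.
have E (y : R) : `|y| * (1 + n%:~R ^+ 2) = `|y * (1 + n%:~R ^+ 2)|.
  by rewrite normrM [X in _ = _ * X]gtr0_norm.
rewrite !E; split; rewrite -(@ler_pXn2r _ 2) ?nnegrE// real_normK ?num_real//;
  rewrite exprMn (le_trans _ H)//.
  by rewrite lerDl mulr_ge0// sqr_ge0.
by rewrite lerDr mulr_ge0// sqr_ge0.
Qed.

(** Telescoping: 1 / (1 + m^2) <= 2 / (m (m + 1)). *)
Lemma sum_oneDsqr_le (n : nat) :
  \sum_(0 <= k < n) (1 + (k.+1%:R) ^+ 2)^-1 <= 2 - 2 / n.+1%:R :> R.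
Proof.
elim: n => [|n IH]; first by rewrite big_nil divr1 subrr.
rewrite big_nat_recr//= (le_trans (lerD IH (lexx _)))//.
have n0 : 0 <= n%:R :> R by [].
have x0 : 0 < 1 + n.+1%:R ^+ 2 :> R by exact: (lt_le_trans ltr01 (oneDsqr_ge1' _)).
have -> : 2 - 2 / n.+2%:R = 2 - 2 / n.+1%:R + 2 / (n.+1%:R * n.+2%:R) :> R.
  by field; rewrite !gt_eqF//= ?addr_gt0.
rewrite lerD2l -[leLHS]mul1r ler_pdivrMr// mulrAC ler_pdivlMr ?mulr_gt0//.
rewrite mul1r -!natr1; nra.
Qed.

(** 5 B is B for the term 0 plus 4 B for the remaining pairs. The bound is uniform in the length of
    the partial sum and later serves for domination. *)
Lemma psum_cvg u B : 0 <= B -> sq_decay u B ->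
  ccvg (psum u) (sumZ u) /\
  forall n, `|complex.Re (psum u n)| <= 5 * B /\ `|complex.Im (psum u n)| <= 5 * B.
Proof.
move=> B0 uB.
have main (p : R[i] -> R) : (forall z w, p (z + w) = p z + p w) -> p 0 = 0 ->
   (forall n, `|p (u n)| <= B / (1 + n%:~R ^+ 2)) ->
   cvgn (fun n => p (psum u n)) /\ forall n, `|p (psum u n)| <= 5 * B.
  move=> pD p0 pB.
  pose v k := p (u k.+1%:Z) + p (u (- k.+1%:Z)).
  have vB k : `|v k| <= 2 * B * (1 + (k.+1%:R) ^+ 2)^-1.
    have h1 := pB k.+1%:Z; have h2 := pB (- k.+1%:Z).
    rewrite mulrNz sqrrN in h2.
    rewrite (le_trans (ler_normD _ _))// (le_trans (lerD h1 h2))//.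
    by rewrite -pmulrn; move: (_^-1) => x; lra.
  have pE n : p (psum u n) = p (u 0) + series v n.
    rewrite psumE pD /series /=; congr (_ + _).
    elim: n => [|n IH]; first by rewrite !big_nil.
    by rewrite !big_nat_recr//= pD IH pD.
  have sB n : \sum_(0 <= k < n) `|v k| <= 4 * B.
    apply: (@le_trans _ _ (\sum_(0 <= k < n) 2 * B * (1 + (k.+1%:R) ^+ 2)^-1)).
      exact: ler_sum.
    rewrite -mulr_sumr (le_trans (ler_wpM2l _ (sum_oneDsqr_le n)))//.
      by rewrite mulr_ge0.
    have : 0 <= 2 / n.+1%:R :> R by rewrite divr_ge0.
    by move: (2 / n.+1%:R) => h h0; have := mulr_ge0 B0 h0; nra.
  have cv : cvgn (series v).
    apply: normed_cvg; apply: nondecreasing_is_cvgn.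
      apply/nondecreasing_seqP => n; rewrite /series /=. by rewrite [leRHS]big_nat_recr//= lerDl.
    by exists (4 * B) => _ [n _ <-]; exact: sB.
  split.
    rewrite (_ : (fun n => _) = (fun n => p (u 0) + series v n)); last by apply/funext.
    by apply: is_cvgD => //; exact: is_cvg_cst.
  move=> n; rewrite pE (le_trans (ler_normD _ _))//.
  have := pB 0; rewrite expr0n addr0 divr1 => u0.
  have : `|series v n| <= 4 * B by rewrite (le_trans (ler_norm_sum _ _ _)).
  by lra.
have [r1 r2] := main (@complex.Re R) (@ReD R) erefl (fun n => (sq_decay_abs n B0 uB).1).
have [i1 i2] := main (@complex.Im R) (@ImD R) erefl (fun n => (sq_decay_abs n B0 uB).2).
split; last by [].
have h : ccvg (psum u) (limn (fun n => complex.Re (psum u n)) +i* limn (fun n => complex.Im (psum u n))).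
  by split.
by rewrite (sumZ_unique h).
Qed.

Lemma ccvgZ (a : R[i]) (u : nat -> R[i]) l : ccvg u l -> ccvg (fun n => a * u n) (a * l).
Proof. by apply: ccvgM; exact: ccvg_cst. Qed.

Lemma sumZ_ZD (a : R[i]) u v Bu Bv : 0 <= Bu -> 0 <= Bv ->
  sq_decay u Bu -> sq_decay v Bv ->
  sumZ (fun n => a * u n + v n) = a * sumZ u + sumZ v.
Proof.
move=> u0 v0 hu hv; apply: sumZ_unique.
rewrite (_ : psum _ = fun n => a * psum u n + psum v n); last first.
  by apply/funext => n; rewrite /psum big_split/= mulr_sumr.
by apply: ccvgD; [apply: ccvgZ|]; [exact: (psum_cvg u0 hu).1|exact: (psum_cvg v0 hv).1].
Qed.

Lemma sumZ_Z (a : R[i]) u B : 0 <= B -> sq_decay u B ->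
  sumZ (fun n => a * u n) = a * sumZ u.
Proof.
move=> B0 hu; apply: sumZ_unique.
rewrite (_ : psum _ = fun n => a * psum u n); last first.
  by apply/funext => n; rewrite /psum mulr_sumr.
by apply: ccvgZ; exact: (psum_cvg B0 hu).1.
Qed.

Let tends0 u := ccvg (fun n : nat => u n%:Z) 0 /\ ccvg (fun n : nat => u (- n%:Z)) 0.

Let sq_decay_tends0 u B : 0 <= B -> sq_decay u B -> tends0 u.
Proof.
move=> B0 hu.
have gen (x : nat -> R) (m : nat -> int) : (forall n, `|m n|%N = n) ->
    (forall n, `|x n| <= B / (1 + (m n)%:~R ^+ 2)) -> x n @[n --> \oo] --> (0 : R).
  move=> mn xB; apply/cvgr0Pnorm_le => e e0.
  exists (Num.trunc (B / e)).+1 => // n /= nB; rewrite (le_trans (xB n))//.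
  have x1 := oneDsqr_ge1' ((m n)%:~R : R).
  rewrite ler_pdivrMr ?(lt_le_trans _ x1)// mulrC -ler_pdivrMr//.
  have E : (m n)%:~R ^+ 2 = n%:R ^+ 2 :> R.
    by rewrite -[in RHS](mn n) -[LHS]real_normK ?num_real// -intr_norm natr_absz.
  rewrite E (le_trans (ltW (truncnS_gt _)))// (@le_trans _ _ n%:R) ?ler_nat//.
  by have : 0 <= n%:R :> R by []; nra.
have pos n : `|n%:Z|%N = n by rewrite absz_nat.
have neg n : `|- n%:Z|%N = n by rewrite abszN absz_nat.
split; split.
- by apply: (gen _ _ pos) => n; case: (sq_decay_abs n%:Z B0 hu).
- by apply: (gen _ _ pos) => n; case: (sq_decay_abs n%:Z B0 hu).
- by apply: (gen _ _ neg) => n; case: (sq_decay_abs (- n%:Z) B0 hu).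
- by apply: (gen _ _ neg) => n; case: (sq_decay_abs (- n%:Z) B0 hu).
Qed.

Let tends0_shift u : tends0 u -> tends0 (fun n => u (n + 1)).
Proof.
move=> [[u1 u2] [v1 v2]]; split; split.
- rewrite (_ : (fun n => _) = (fun n => complex.Re (u n.+1%:Z))).
    by rewrite (@cvg_shiftS R (fun n => complex.Re (u n%:Z))).
  by apply/funext => n; rewrite -addn1 PoszD.
- rewrite (_ : (fun n => _) = (fun n => complex.Im (u n.+1%:Z))).
    by rewrite (@cvg_shiftS R (fun n => complex.Im (u n%:Z))).
  by apply/funext => n; rewrite -addn1 PoszD.
- rewrite -(@cvg_shiftS R) (_ : (fun n => _) = (fun n => complex.Re (u (- n%:Z))))//.
  by apply/funext => n; congr (complex.Re (u _)); lia.
- rewrite -(@cvg_shiftS R) (_ : (fun n => _) = (fun n => complex.Im (u (- n%:Z))))//.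
  by apply/funext => n; congr (complex.Im (u _)); lia.
Qed.

(** The shifted symmetric partial sum differs from the original by the boundary terms u(n+1) -
    u(-n), which tend to 0. *)
Let psum_shift1 u l : tends0 u -> ccvg (psum u) l ->
  ccvg (psum (fun n => u (n + 1))) l.
Proof.
move=> [up un] ul.
have E n : psum (fun n => u (n + 1)) n = psum u n + (u n.+1%:Z + (- 1) * u (- n%:Z)).
  elim: n => [|n IH]; first by rewrite /psum /= !big_seq1 oppr0 add0r mulN1r addrCA subrr addr0.
  rewrite /psum /= !big_cons in IH *; rewrite IH.
  have -> : n.+1%:Z + 1 = n.+2%:Z by lia.
  have -> : - n.+1%:Z + 1 = - n%:Z by lia.
  ring.
rewrite (_ : psum _ = fun n => psum u n + (u n.+1%:Z + (- 1) * u (- n%:Z))); last exact/funext.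
rewrite -[l]addr0; apply: ccvgD => //.
rewrite -[0](_ : 0 + (- 1) * 0 = _); last by rewrite mulr0 addr0.
apply: ccvgD; last exact: ccvgZ.
case: up => u1 u2; split.
  by rewrite (@cvg_shiftS R (fun n => complex.Re (u n%:Z))).
by rewrite (@cvg_shiftS R (fun n => complex.Im (u n%:Z))).
Qed.

Let psum_opp u : psum (fun n => u (- n)) = psum u.
Proof.
apply/funext => n; rewrite /psum; elim: n => [|n IH]; first by rewrite !big_seq1 oppr0.
by rewrite /= !big_cons IH opprK addrCA.
Qed.

Let psum_shift_nat u l (m : nat) : tends0 u -> ccvg (psum u) l ->
  ccvg (psum (fun n => u (n + m%:Z))) l.
Proof.
move=> u0 ul; suff : ccvg (psum (fun n => u (n + m%:Z))) l /\ tends0 (fun n => u (n + m%:Z)) by case.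
elim: m => [|m [IH1 IH2]].
  by rewrite (_ : (fun n => u _) = u)//; apply/funext => n; rewrite addr0.
rewrite (_ : (fun n => u (n + m.+1%:Z)) = (fun n => u ((n + 1) + m%:Z))).
  by split; [exact: (psum_shift1 IH2)|exact: (tends0_shift IH2)].
by apply/funext => n; congr u; lia.
Qed.

(** Nonnegative shifts iterate [psum_shift1]; a negative one becomes positive under n |-> -n, which
    preserves symmetric partial sums. *)
Lemma sumZ_shift u B (m : int) : 0 <= B -> sq_decay u B ->
  sumZ (fun n => u (n + m)) = sumZ u.
Proof.
move=> B0 hu; apply: sumZ_unique.
have ul := (psum_cvg B0 hu).1; have u0 := sq_decay_tends0 B0 hu.
case: m => m; first exact: psum_shift_nat.
have := @psum_shift_nat (fun n => u (- n)) (sumZ u) m.+1.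
rewrite psum_opp => /(_ _ ul) H.
rewrite -psum_opp (_ : (fun n => u (- n + Negz m)) = (fun n => u (- (n + m.+1%:Z)))).
  apply: H; case: u0 => h1 h2; split => //.
  by rewrite (_ : (fun n : nat => _) = (fun n : nat => u n%:Z))//; apply/funext => n; rewrite opprK.
by apply/funext => n; congr u; rewrite NegzE; lia.
Qed.

End SumZ.

(** * Parseval's identity for trigonometric polynomials *)

Section Parseval.
Variable R : realType.
Local Notation mu := (@lebesgue_measure R).
Local Notation I01 := (`[0, 1]%classic : set R).

Let mI : measurable (I01 : set (measurableTypeR R)).
Proof. exact: measurable_itv. Qed.

Definition trig (z : R[i]) (k : int) (a : R) : R :=
  complex.Re (z * e2pi (k%:~R * a)).

Lemma continuous_trig z k : continuous (trig z k).
Proof.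
have cl : continuous (fun a : R => k%:~R * a) by move=> a; apply: cvgMr; exact: cvg_id.
have -> : trig z k = (fun a => complex.Re z * cos (2 * pi * (k%:~R * a)) -
    complex.Im z * sin (2 * pi * (k%:~R * a))).
  by apply/funext => a; rewrite /trig ReM.
move=> a; apply: cvgB; apply: cvgMr.
  exact: (cvg_comp _ _ (cl a) (@continuous_cos2pi R _)).
exact: (cvg_comp _ _ (cl a) (@continuous_sin2pi R _)).
Qed.

Lemma trig_integrable z k : mu.-integrable I01 (EFin \o trig z k).
Proof.
apply: continuous_compact_integrable; first exact: segment_compact.
by apply: continuous_subspaceT; exact: continuous_trig.
Qed.

Lemma trig_integral z k : k != 0 -> \int[mu]_(a in I01) trig z k a = 0.
Proof.
move=> k0; have kR : (k%:~R : R) != 0 by rewrite intr_eq0.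
pose c : R := 2 * pi * k%:~R.
have c0 : c != 0 by rewrite !mulf_neq0// gt_eqF// pi_gt0.
pose G (a : R) := c^-1 * (complex.Re z * sin (c * a) + complex.Im z * cos (c * a)).
have dG (a : R) : is_derive a (1 : R) G (trig z k a).
  have h1 : is_derive a (1 : R) (fun x : R => c * x) c.
    by apply: is_derive_eq; rewrite /GRing.scale /= mulr1.
  have h2 : is_derive a (1 : R) (sin \o (fun x : R => c * x)) (c * cos (c * a)).
    by apply: is_derive_eq; rewrite mulrC.
  have h3 : is_derive a (1 : R) (cos \o (fun x : R => c * x)) (c * - sin (c * a)).
    by apply: is_derive_eq; rewrite mulrC.
  have h4 := is_deriveZ c^-1 (is_deriveD (is_deriveZ (complex.Re z) h2)
    (is_deriveZ (complex.Im z) h3)).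
  apply: (is_derive_eq h4); rewrite /GRing.scale /= /trig ReM /=.
  have -> : 2 * pi * (k%:~R * a) = c * a by rewrite /c; ring.
  by field.
have cG : continuous G.
  by move=> a; apply/differentiable_continuous/derivable1_diffP; case: (dG a).
have := @continuous_FTC2 R (trig z k) G 0 1 ltr01.
rewrite /Rintegral => ->.
- rewrite /G mulr0 sin0 cos0 mulr1.
  have := e2pi_int R k; rewrite /e2pi -/c => -[-> ->].
  by rewrite -EFinB /= subrr.
- by apply: continuous_subspaceT; exact: continuous_trig.
- split.
  + by move=> x _; case: (dG x).
  + by apply: cvg_at_right_filter; exact: cG.
  + by apply: cvg_at_left_filter; exact: cG.
- by move=> x _; rewrite derive1E; case: (dG x).
Qed.

Definition trig_poly (s : seq int) (c : int -> R[i]) (a : R) : R[i] :=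
  \sum_(n <- s) c n * e2pi (n%:~R * a).

(** Adding one frequency n creates cross terms of frequency m - n <> 0, which integrate to 0 over
    [0, 1]. *)
Lemma trig_poly_parseval (s : seq int) (c : int -> R[i]) : uniq s ->
  mu.-integrable I01 (EFin \o (fun a => normc (trig_poly s c a) ^+ 2)) /\
  \int[mu]_(a in I01) (normc (trig_poly s c a) ^+ 2) = \sum_(n <- s) normc (c n) ^+ 2.
Proof.
elim: s => [|n s IH] /=.
  move=> _; rewrite big_nil.
  rewrite (_ : (fun a => _) = cst 0); last first.
    by apply/funext => a; rewrite /trig_poly big_nil normc_sqr /= expr0n addr0.
  split; first exact: integrable0.
  by rewrite Rintegral_cst// mul0r.
move=> /andP[ns us]; have [IHi IHv] := IH us.
pose X a := \sum_(m <- s) 2 * trig (c m * (c n)^*) (m - n) a.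
have E a : normc (trig_poly (n :: s) c a) ^+ 2 =
    normc (trig_poly s c a) ^+ 2 + (normc (c n) ^+ 2 + X a).
  rewrite /trig_poly big_cons -/(trig_poly s c a).
  have sq (x y : R[i]) : normc (x + y) ^+ 2 =
     normc y ^+ 2 + (normc x ^+ 2 + 2 * complex.Re (y * x^*)).
    by rewrite !normc_sqr ReD ImD ReM Re_conj Im_conj; ring.
  rewrite sq normc_sqrM normc_e2pi mulr1; congr (_ + (_ + _)).
  rewrite /X /trig_poly -mulr_sumr; congr (2 * _).
  rewrite mulr_suml (big_morph (@complex.Re R) (@ReD R) (erefl : complex.Re 0 = 0)).
  apply: eq_bigr => m _; rewrite /trig; congr complex.Re.
  rewrite rmorphM /= conj_e2pi intrB mulrBl e2piD; ring.
have XI : mu.-integrable I01 (EFin \o X) /\ \int[mu]_(a in I01) X a = 0.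
  rewrite /X; elim: (s) ns => [_|m t IHt].
    rewrite (_ : (fun a => _) = cst 0); last by apply/funext => a; rewrite big_nil.
    by split; [exact: integrable0|rewrite Rintegral_cst// mul0r].
  rewrite inE negb_or => /andP[nm nt]; have [i1 v1] := IHt nt.
  have i2 : mu.-integrable I01 (EFin \o (fun a => 2 * trig (c m * (c n)^*) (m - n) a)).
    exact: (integrableZl mI 2 (trig_integrable (c m * (c n)^*) (m - n))).
  rewrite (_ : (fun a => \sum_(m0 <- m :: t) _) = (fun a =>
     2 * trig (c m * (c n)^*) (m - n) a + \sum_(m <- t) 2 * trig (c m * (c n)^*) (m - n) a)).
    split; first exact: (integrableD mI i2 i1).
    rewrite RintegralD// v1 addr0 RintegralZl//; last exact: trig_integrable.
    by rewrite trig_integral ?mulr0// subr_eq0 eq_sym.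
  by apply/funext => a; rewrite big_cons.
have ic : mu.-integrable I01 (EFin \o (fun _ : R => normc (c n) ^+ 2)).
  apply: continuous_compact_integrable; first exact: segment_compact.
  by apply: continuous_subspaceT => x; exact: cvg_cst.
have [Xi Xv] := XI.
have i3 := integrableD mI ic Xi.
rewrite (_ : (fun a => _) = (fun a => normc (trig_poly s c a) ^+ 2 + (normc (c n) ^+ 2 + X a))).
  split; first exact: (integrableD mI IHi i3).
  rewrite RintegralD// IHv RintegralD// Xv addr0 Rintegral_cst//.
  have -> : fine (mu I01) = 1 by rewrite lebesgue_measure_itv/= lte_fin ltr01 -EFinB subr0.
  by rewrite mulr1 big_cons addrC.
by apply/funext.
Qed.

End Parseval.

(** * Integration over the unit cube *)

Section CubeIntegral.
Variable R : realType.
Local Notation mu := (@lebesgue_measure R).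
Local Notation I01 := (`[0, 1]%classic : set R).
Local Notation R2 := (measurableTypeR R * measurableTypeR R)%type.
Local Notation R3 := (R2 * measurableTypeR R)%type.

Lemma measurable_cube : measurable (@cube R : set R3).
Proof. by apply: measurableX; [apply: measurableX|]; exact: measurable_itv. Qed.

Let mu1 : mu I01 = 1%E.
Proof. by rewrite lebesgue_measure_itv/= lte_fin ltr01 -EFinB subr0. Qed.

Lemma leb3_cube : leb3 (@cube R) = 1%E.
Proof.
rewrite /leb3 /cube product_measure1E//=; last by apply: measurableX; exact: measurable_itv.
rewrite product_measure1E//=.
by rewrite mu1 !mule1.
Qed.

Lemma integral_prod_fst d (T : measurableType d)
    (m1 : {sigma_finite_measure set T -> \bar R}) (A : set T) (H : T -> \bar R) :
  measurable A -> measurable_fun setT H -> (forall p, 0 <= H p)%E ->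
  (\int[(m1 \x mu)%E]_(g in A `*` I01) H g.1 = \int[m1]_(p in A) H p)%E.
Proof.
move=> mA mH H0.
have mI : measurable (I01 : set (measurableTypeR R)) by exact: measurable_itv.
have mAI : measurable (A `*` I01 : set (T * measurableTypeR R)) by exact: measurableX.
rewrite integral_mkcond [RHS]integral_mkcond.
set h : T * measurableTypeR R -> \bar R := _ \_ _.
have h0 g : (0 <= h g)%E by apply: erestrict_ge0 => p _; exact: H0.
have mh : measurable_fun setT h.
  apply/(measurable_restrictT _ mAI)/measurable_funTS.
  exact: (measurableT_comp mH measurable_fst).
apply: (etrans (@fubini_tonelli1 _ _ _ _ R m1 mu h mh h0)).
apply: eq_integral => p _; rewrite /fubini_F.
transitivity (\int[mu]_(z in I01) (H \_ A) p)%E.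
  rewrite [RHS]integral_mkcond; apply: eq_integral => z _.
  rewrite /h !patchE in_setX /=.
  by case: (p \in _) => /=; case: (z \in _).
apply: (etrans (integral_cst mu mI _)).
apply: (etrans (congr1 (fun x => (H \_ A) p * x)%E mu1)); exact: mule1.
Qed.

Section ProductSigmaFinite.
Context d1 d2 (T1 : measurableType d1) (T2 : measurableType d2).
Variable m1 : {sigma_finite_measure set T1 -> \bar R}.
Variable m2 : {sigma_finite_measure set T2 -> \bar R}.

Lemma product_sigma_finite : sigma_finite setT (product_measure1 m1 m2).
Proof.
have /sigma_finiteP[F [TF ndF Foo]] := sigma_finiteT m1.
have /sigma_finiteP[G [TG ndG Goo]] := sigma_finiteT m2.
exists (fun n => F n `*` G n).
  apply/seteqP; split=> [[x y] _|//].
  have : (\bigcup_n F n) x by rewrite -TF.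
  have : (\bigcup_n G n) y by rewrite -TG.
  move=> [k _ Gky] [n _ Fnx]; exists (maxn n k) => //; split.
    by move: x Fnx; exact/subsetPset/ndF/leq_maxl.
  by move: y Gky; exact/subsetPset/ndG/leq_maxr.
move=> k; have [? ?] := Foo k; have [? ?] := Goo k.
split; first exact: measurableX.
by rewrite product_measure1E// lte_mul_pinfty// ge0_fin_numE.
Qed.

(* The instance declared in the library for [product_measure1] is found only
   for subprobabilities. *)
Definition product_sf : {sigma_finite_measure set (T1 * T2)%type -> \bar R} :=
  HB.pack (product_measure1 m1 m2) (Measure_isSigmaFinite.Build _ _ _ _ product_sigma_finite).

End ProductSigmaFinite.

Lemma integral_prod_fst2 d1 d2 (T1 : measurableType d1) (T2 : measurableType d2)
    (m1 : {sigma_finite_measure set T1 -> \bar R})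
    (m2 : {sigma_finite_measure set T2 -> \bar R}) (A : set (T1 * T2)%type)
    (H : T1 * T2 -> \bar R) :
  measurable A -> measurable_fun setT H -> (forall p, 0 <= H p)%E ->
  (\int[((m1 \x m2) \x mu)%E]_(g in A `*` I01) H g.1 = \int[(m1 \x m2)%E]_(p in A) H p)%E.
Proof.
exact: (@integral_prod_fst _ _ (product_sf m1 m2)).
Qed.

(** Meant for the squared modulus of the series, which does not depend on z. The integral in a is
    innermost because Parseval evaluates it for fixed c. *)
Lemma cube_integral (H : R2 -> \bar R) : measurable_fun setT H ->
  (forall p, 0 <= H p)%E ->
  (\int[@leb3 R]_(g in @cube R) H g.1 = \int[mu]_(c in I01) \int[mu]_(a in I01) H (a, c))%E.
Proof.
move=> mH H0.
have mI : measurable (I01 : set (measurableTypeR R)) by exact: measurable_itv.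
have mI2 : measurable (I01 `*` I01 : set R2) by exact: measurableX.
have E0 := @integral_prod_fst2 _ _ _ _ mu mu _ H mI2 mH H0.
apply: (etrans E0).

rewrite integral_mkcond.
pose k : R2 -> \bar R := H \_ (I01 `*` I01).
have k0 g : (0 <= k g)%E by apply: erestrict_ge0 => p _; exact: H0.
have mk : measurable_fun setT k.
  by apply/(measurable_restrictT _ mI2)/measurable_funTS.
rewrite -/k.
have E2 := @fubini_tonelli1 _ _ _ _ R mu mu k mk k0.
apply: (etrans E2); clear E2.
have E3 := @fubini_tonelli _ _ _ _ R mu mu k mk k0.
apply: (etrans E3); clear E3; rewrite [RHS]integral_mkcond.
apply: eq_integral => c _; rewrite /fubini_G patchE.
transitivity (\int[mu]_(a in I01) (if c \in I01 then H (a, c) else 0%E))%E.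
  rewrite [RHS]integral_mkcond; apply: eq_integral => a _.
  rewrite /k !patchE in_setX /=.
  by case: (a \in _) => //=; case: (c \in _).
by case: ifP => // _; rewrite integral0.
Qed.

End CubeIntegral.

Lemma clim_ccvg (R : realType) (s : nat -> R[i]) l : ccvg s l -> clim s = l.
Proof.
move=> [h1 h2]; rewrite /clim; case: asboolP => [_|[]]; last first.
  by split; [apply/cvg_ex; exists (complex.Re l)|apply/cvg_ex; exists (complex.Im l)].
by rewrite (cvg_lim _ h1)// (cvg_lim _ h2)//; case: (l).
Qed.

(** Polarisation: a = 1 recovers the real part of the inner product and a = i the imaginary part. *)
Lemma hinner_polar (R : realType) (E F : hspace R) (u v : hcar E) (u' v' : hcar F) :
  prehilbert E -> prehilbert F -> hmem u -> hmem v -> hmem u' -> hmem v' ->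
  (forall a : R[i], hnorm (a *: u + v) = hnorm (a *: u' + v')) ->
  hnorm u = hnorm u' -> hnorm v = hnorm v' ->
  hinner u v = hinner u' v'.
Proof.
move=> EP FP hu hv hu' hv' H uu vv.
have P (a : R[i]) : normc a = 1 ->
    complex.Re (a * hinner u v) = complex.Re (a * hinner u' v').
  move=> a1.
  have := hnorm_addZ_sqr EP 1 (hmemZ EP a hu) hv.
  have := hnorm_addZ_sqr FP 1 (hmemZ FP a hu') hv'.
  rewrite !scale1r H !hnormZ// a1 (hinnerZl EP)// (hinnerZl FP)// uu vv; lra.
apply: complex_eq.
  by have := P 1 (ComplexField.Normc.normc1 R); rewrite !mul1r.
have := P (0 +i* 1); rewrite !ReM /= expr0n expr1n add0r sqrtr1 => /(_ erefl).
by rewrite !mul0r !mul1r !sub0r => /oppr_inj.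
Qed.

(** * The series of [W_schwartz] on decaying functions *)

Section WDecaying.
Variables (R : realType) (N : int) (d : nat) (chi : int -> R[i]).
Hypotheses (N0 : N != 0) (d0 : (0 < d)%N) (dN : (d%:Z %| N)%Z).
Hypothesis hchi : dirichlet_character d chi.
Local Notation mu := (@lebesgue_measure R).
Local Notation w := (chi_frac N d chi).
Local Notation NR := (N%:~R : R).
Local Notation L := (L2R R).
Local Notation I01 := (`[0, 1]%classic : set R).
Local Notation R2 := (measurableTypeR R * measurableTypeR R)%type.
Local Notation R3 := (R2 * measurableTypeR R)%type.
Local Notation LC := (L2space (@leb3 R) (@cube R)).
Local Notation W0 := (W_schwartz N d chi).
Local Notation phi := ((totient d)%:R : R).
Let LP := L2R_prehilbert R.
Let CP : prehilbert LC := L2_prehilbert (@leb3 R) (@measurable_cube R).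

Definition Wconst : R[i] := sqrtC (N%:~R / (totient d)%:R).

Let phi0 : 0 < phi. Proof. by rewrite ltr0n totient_gt0. Qed.
Let NR0 : NR != 0. Proof. by rewrite intr_eq0. Qed.

Lemma normc_Wconst : normc Wconst ^+ 2 = `|NR| / phi.
Proof.
rewrite -normc_exp sqrtCK.
have -> : N%:~R / (totient d)%:R = (NR / phi)%:C :> R[i].
  by rewrite rmorphM fmorphV/= rmorph_int rmorph_nat.
rewrite /= expr0n addr0 sqrtr_sqr normrM; congr (_ * _).
by rewrite gtr0_norm// invr_gt0.
Qed.

Definition Wterm (f : R -> R[i]) (g : R3) (n : int) : R[i] :=
  w n * f (n%:~R + NR * g.1.2) * e2pi (n%:~R * g.1.1).

Definition Wpart (f : R -> R[i]) (k : nat) (g : R3) : R[i] :=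
  Wconst * e2pi (NR * g.2) * psum (Wterm f g) k.

Lemma W_schwartzE f (g : R3) :
  W0 f g = Wconst * e2pi (NR * g.2) * sumZ (Wterm f g).
Proof. by case: g => [[a c] z]. Qed.

Definition fbound (f : R -> R[i]) (B : R) :=
  0 <= B /\ forall x, normc (f x) ^+ 2 * (1 + x ^+ 2) ^+ 2 <= B ^+ 2.

Lemma decaying_fbound f : decaying f -> exists B, fbound f B.
Proof.
case=> _ [B fB]; exists `|B|; split=> // x; rewrite (le_trans (fB x))//.
by rewrite real_normK ?num_real.
Qed.

(** A Peetre-type inequality: 1 + m^2 <= (2 + 2 y^2) (1 + (m + y)^2), so a translation by y = N c
    costs the factor 2 + 2 y^2. *)
Lemma Wterm_decay f B (g : R3) : fbound f B ->
  sq_decay (Wterm f g) (B * (2 + 2 * (NR * g.1.2) ^+ 2)).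
Proof.
move=> [B0 fB] n; rewrite /Wterm !normc_sqrM normc_e2pi mulr1.
set y := NR * _; set m := n%:~R : R.
have wle := chi_frac_le1 N d0 hchi n.
have := fB (m + y); set F := normc (f _) ^+ 2; set G := normc _ ^+ 2.
have F0 : 0 <= F by exact: sqr_ge0.
have G0 : 0 <= G by exact: sqr_ge0.
rewrite exprMn => H.
set p := 1 + m ^+ 2; set q := 2 + 2 * y ^+ 2; set r := 1 + (m + y) ^+ 2.
have pq : p ^+ 2 <= (q * r) ^+ 2.
  have p0 : 0 <= p by rewrite addr_ge0// sqr_ge0.
  suff pqr : p <= q * r by rewrite !expr2; apply: ler_pM.
  have := sqr_ge0 (m + y + y); have := mulr_ge0 (sqr_ge0 y) (sqr_ge0 (m + y)).
  rewrite /p /q /r; set a := y ^+ 2 * _.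
  have -> : (2 + 2 * y ^+ 2) * (1 + (m + y) ^+ 2) =
    2 + 2 * y ^+ 2 + 2 * (m + y) ^+ 2 + 2 * a by rewrite /a; ring.
  move=> a0; have := sqr_ge0 (m + 2 * y); nra.
apply: (@le_trans _ _ (F * (q * r) ^+ 2)).
  apply: ler_pM => //; [exact: mulr_ge0|exact: sqr_ge0|].
  by rewrite ler_piMl.
by rewrite exprMn mulrCA mulrC ler_wpM2r// sqr_ge0.
Qed.

Let decB0 (B : R) (g : R3) : 0 <= B -> 0 <= B * (2 + 2 * (NR * g.1.2) ^+ 2).
Proof. by move=> ?; rewrite mulr_ge0// addr_ge0// mulr_ge0// sqr_ge0. Qed.

Lemma Wpart_cvg f g : decaying f -> ccvg (Wpart f ^~ g) (W0 f g).
Proof.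
move=> /decaying_fbound[B fB]; rewrite W_schwartzE; apply: ccvgZ.
have [B0 _] := fB.
exact: (psum_cvg (decB0 g B0) (Wterm_decay g fB)).1.
Qed.

Lemma W_schwartz_linear (a : R[i]) f h : decaying f -> decaying h ->
  W0 (fun x => a * f x + h x) = (fun g => a * W0 f g + W0 h g).
Proof.
move=> /decaying_fbound[B fB] /decaying_fbound[B' hB].
apply/funext => g; rewrite !W_schwartzE.
rewrite (_ : Wterm _ _ = fun n => a * Wterm f g n + Wterm h g n); last first.
  by apply/funext => n; rewrite /Wterm; ring.
rewrite (sumZ_ZD a (decB0 g fB.1) (decB0 g hB.1) (Wterm_decay g fB) (Wterm_decay g hB)).
ring.
Qed.

Lemma cmeasurable_Wpart f k : cmeasurable f -> cmeasurable (Wpart f k).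
Proof.
move=> mf.
have m1 : measurable_fun setT (fun g : R3 => g.1.1).
  exact: (measurableT_comp measurable_fst measurable_fst).
have m2 : measurable_fun setT (fun g : R3 => g.1.2).
  exact: (measurableT_comp measurable_snd measurable_fst).
apply: cmeasurableM.
  apply: cmeasurableZ; apply: cmeasurable_e2pi_comp.
  by apply: measurable_funM => //; exact: measurable_snd.
apply: cmeasurable_sum => n; apply: cmeasurableM.
  apply: cmeasurableZ.
  have mh : measurable_fun setT (fun g : R3 => n%:~R + NR * g.1.2 : measurableTypeR R).
    by apply: measurable_funD => //; apply: measurable_funM.
  exact: (cmeasurable_comp mh mf).
by apply: cmeasurable_e2pi_comp; exact: measurable_funM.
Qed.

Lemma cmeasurable_W_schwartz f : decaying f -> cmeasurable (W0 f : R3 -> R[i]).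
Proof.
move=> hf; rewrite (_ : W0 f = fun g => clim (Wpart f ^~ g)).
  by apply: cmeasurable_clim => k; apply: cmeasurable_Wpart; case: hf.
by apply/funext => g; rewrite (clim_ccvg (Wpart_cvg _ hf)).
Qed.

End WDecaying.

Lemma sqr_bound (R : realType) (b p q b' : R) : p <= 5 * b -> q <= 5 * b ->
  b <= b' -> 0 <= b -> 0 <= p -> 0 <= q -> p ^+ 2 + q ^+ 2 <= 50 * b' ^+ 2.
Proof.
move=> h1 h2 h3 h4 p0 q0.
have p2 : p ^+ 2 <= (5 * b') ^+ 2 by rewrite ler_pXn2r ?nnegrE//; lra.
have q2 : q ^+ 2 <= (5 * b') ^+ 2 by rewrite ler_pXn2r ?nnegrE//; lra.
by move: p2 q2; rewrite exprMn; lra.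
Qed.

(** * Unfolding c in [0, 1] to the line: the isometry property *)

Section WindowSums.
Variables (R : realType) (N : int) (d : nat) (chi : int -> R[i]).
Hypotheses (N0 : N != 0) (d0 : (0 < d)%N) (dN : (d%:Z %| N)%Z).
Hypothesis hchi : dirichlet_character d chi.
Local Notation w := (chi_frac N d chi).
Local Notation NR := (N%:~R : R).
Local Notation phi := ((totient d)%:R : R).
Local Notation J := (`[0, 1[%classic : set R).

(** For N > 0 the integers n are those in ]x - N, x], for N < 0 those in [x, x - N[. The interval
    [0, 1[ is half-open so that there are exactly |N| of them for every x. *)
Lemma window_itv (x : R) : exists m : int, forall n : int,
  (NR^-1 * (x - n%:~R) \in J) = ((m <= n) && (n < m + `|N|%N%:Z)).
Proof.
have memJ (y : R) : (y \in J) = (0 <= y < 1) by rewrite mem_setE in_itv.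
have [Np|Nn] := ltrP 0 N.
  have NE : `|N|%N%:Z = N by rewrite gez0_abs// ltW.
  have NRp : 0 < NR by rewrite ltr0z.
  exists (Num.floor x - N + 1) => n; rewrite memJ NE mulrC.
  rewrite pmulr_lge0 ?invr_gt0// subr_ge0 ltr_pdivrMr// mul1r ltrBlDr -intrD.
  rewrite -floor_ge_int -floor_lt_int; move: (Num.floor x) => F.
  have -> : (F - N + 1 <= n) = (F < N + n) by apply/idP/idP; lia.
  have -> : (n < F - N + 1 + N) = (n <= F) by apply/idP/idP; lia.
  by rewrite andbC.
have {}Nn : N < 0 by rewrite lt_neqAle N0.
have NE : `|N|%N%:Z = - N by rewrite ltz0_abs.
have NRn : NR < 0 by rewrite ltrz0.
exists (Num.ceil x) => n; rewrite memJ NE mulrC.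
rewrite nmulr_lge0 ?invr_lt0// subr_le0 ltr_ndivrMr// mul1r ltrBrDr -intrD.
rewrite -ceil_le_int -ceil_gt_int; move: (Num.ceil x) => F.
by have -> : (n < F - N) = (N + n < F) by apply/idP/idP; lia.
Qed.

(** Divided by phi(d), the weight that the k-th partial sum of the series puts on |f(x)|^2 after the
    substitution x = n + N c. *)
Definition Wsum (k : nat) (x : R) : R :=
  \sum_(n <- zlist k) normc (w n) ^+ 2 * \1_J (NR^-1 * (x - n%:~R)).

Lemma Wsum_le k x : 0 <= Wsum k x <= phi /\
  exists k0, forall k', (k0 <= k')%N -> Wsum k' x = phi.
Proof.
have [m Jm] := window_itv x.
pose win := [seq m + i%:Z | i <- iota 0 `|N|].
have uwin : uniq win by rewrite map_inj_uniq ?iota_uniq// => i j; lia.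
have memwin n : (n \in win) = ((m <= n) && (n < m + `|N|%N%:Z)).
  apply/mapP/idP => [[j]|].
    by rewrite mem_iota => ? ->; lia.
  move=> /andP[h1 h2]; exists `|n - m|%N; rewrite ?mem_iota; lia.
have E k' : Wsum k' x = \sum_(n <- win | n \in zlist k') normc (w n) ^+ 2.
  rewrite /Wsum.
  transitivity (\sum_(n <- zlist k' | n \in win) normc (w n) ^+ 2).
    rewrite [RHS]big_mkcond; apply: eq_bigr => n _; rewrite memwin -Jm indicE.
    by case: (_ \in J); rewrite ?mulr1 ?mulr0.
  rewrite -big_filter -[RHS]big_filter; apply: perm_big; apply: uniq_perm.
  - by rewrite filter_uniq// uniq_zlist.
  - by rewrite filter_uniq.
  - by move=> n; rewrite !mem_filter andbC.
have phiE : \sum_(n <- win) normc (w n) ^+ 2 = phi.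
  by rewrite -(chi_frac_window N0 d0 dN hchi m) big_map /index_iota subn0.
split.
  rewrite E sumr_ge0/=; last by move=> *; exact: sqr_ge0.
  rewrite -phiE big_mkcond; apply: ler_sum => n _; case: ifP => // _; exact: sqr_ge0.
exists (`|m| + `|N|)%N => k' hk; rewrite E -phiE -[LHS]big_filter.
congr (\sum_(n <- _) _); apply/all_filterP/allP => n; rewrite memwin mem_zlist; lia.
Qed.

End WindowSums.

Section WNorm.
Variables (R : realType) (N : int) (d : nat) (chi : int -> R[i]).
Hypotheses (N0 : N != 0) (d0 : (0 < d)%N) (dN : (d%:Z %| N)%Z).
Hypothesis hchi : dirichlet_character d chi.
Local Notation mu := (@lebesgue_measure R).
Local Notation w := (chi_frac N d chi).
Local Notation NR := (N%:~R : R).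
Local Notation L := (L2R R).
Local Notation I01 := (`[0, 1]%classic : set R).
Local Notation J := (`[0, 1[%classic : set R).
Local Notation R2 := (measurableTypeR R * measurableTypeR R)%type.
Local Notation R3 := (R2 * measurableTypeR R)%type.
Local Notation LC := (L2space (@leb3 R) (@cube R)).
Local Notation W0 := (W_schwartz N d chi).
Local Notation Wpart := (@Wpart R N d chi).
Local Notation Wsum := (@Wsum R N d chi).
Local Notation phi := ((totient d)%:R : R).
Let LP := L2R_prehilbert R.
Let mC := @measurable_cube R.
Let CP : prehilbert LC := L2_prehilbert (@leb3 R) mC.
Let phi0 : 0 < phi. Proof. by rewrite ltr0n totient_gt0. Qed.
Let NR0 : NR != 0. Proof. by rewrite intr_eq0. Qed.

(** For c in [0, 1] the bounds of [Wterm_decay] and [psum_cvg] are uniform, so all partial sums lie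
    below one constant on the cube, which has measure 1. *)
Lemma Wpart_L2_cvg f : decaying f ->
  [/\ forall k, square_integrable (@leb3 R) (@cube R) (Wpart f k),
      square_integrable (@leb3 R) (@cube R) (W0 f) &
      @hnorm R LC (Wpart f k - W0 f : hcar LC) @[k --> \oo] --> (0 : R)].
Proof.
move=> hf; have [B fB] := decaying_fbound hf; have [B0 _] := fB.
pose B' := B * (2 + 2 * NR ^+ 2); pose M := `|NR| / phi * (50 * B' ^+ 2).
have B'0 : 0 <= B' by rewrite mulr_ge0// addr_ge0// mulr_ge0// sqr_ge0.
have bnd (g : R3) k : cube g -> normc (Wpart f k g) ^+ 2 <= M.
  move=> [[_ /= gc] _].
  rewrite /Wpart !normc_sqrM normc_Wconst// normc_e2pi mulr1.
  rewrite ler_wpM2l ?divr_ge0//.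
  have c2 : (NR * g.1.2) ^+ 2 <= NR ^+ 2.
    rewrite exprMn ler_piMr ?sqr_ge0//.
    by move: gc; rewrite in_itv/= => /andP[c0 c1]; rewrite expr_le1.
  have B1 : B * (2 + 2 * (NR * g.1.2) ^+ 2) <= B'.
    by rewrite ler_wpM2l// lerD2l ler_wpM2l.
  have B10 : 0 <= B * (2 + 2 * (NR * g.1.2) ^+ 2).
    by rewrite mulr_ge0// addr_ge0// mulr_ge0// sqr_ge0.
  have [h1 h2] := (psum_cvg B10 (Wterm_decay N d0 hchi g fB)).2 k.
  rewrite normc_sqr -(real_normK (num_real (complex.Re _))) -(real_normK (num_real (complex.Im _))).
  exact: (sqr_bound h1 h2 B1 B10 (normr_ge0 _) (normr_ge0 _)).
have cv g : ccvg (Wpart f ^~ g) (W0 f g) by exact: Wpart_cvg.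
have cvn g := ccvg_normc (cv g).
apply: (@L2_dominated _ _ _ (@leb3 R) _ mC _ _ (fun _ => M)).
- by move=> n; apply: cmeasurable_Wpart; case: hf.
- exact: (cmeasurable_W_schwartz N d0 hchi hf).
- apply: measurable_bounded_integrable => //.
    by apply: (@eq_ind_r _ 1%E (fun x => (x < +oo)%E) (ltry 1) _ (leb3_cube R)).
  by exists `|M|; split; [exact: num_real|move=> y My g _; exact: ltW].
- by move=> n g; exact: bnd.
- move=> g Cg.
  have [h1 h2] := cv g.
  have : normc (Wpart f n g) ^+ 2 @[n --> \oo] --> normc (W0 f g) ^+ 2.
    rewrite normc_sqr; under eq_fun do rewrite normc_sqr.
    by apply: cvgD; rewrite !expr2; apply: cvgM.
  move=> h; apply: (ler_cvg_to h (cvg_cst M)).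
  by apply: nearW => n; exact: bnd.
- by apply: aeW => g _; exact: cvn.
Qed.

End WNorm.

Section WIsometry.
Variables (R : realType) (N : int) (d : nat) (chi : int -> R[i]).
Hypotheses (N0 : N != 0) (d0 : (0 < d)%N) (dN : (d%:Z %| N)%Z).
Hypothesis hchi : dirichlet_character d chi.
Local Notation mu := (@lebesgue_measure R).
Local Notation w := (chi_frac N d chi).
Local Notation NR := (N%:~R : R).
Local Notation L := (L2R R).
Local Notation I01 := (`[0, 1]%classic : set R).
Local Notation J := (`[0, 1[%classic : set R).
Local Notation R2 := (measurableTypeR R * measurableTypeR R)%type.
Local Notation R3 := (R2 * measurableTypeR R)%type.
Local Notation LC := (L2space (@leb3 R) (@cube R)).
Local Notation W0 := (W_schwartz N d chi).
Local Notation Wpart := (@Wpart R N d chi).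
Local Notation Wsum := (@Wsum R N d chi).
Local Notation phi := ((totient d)%:R : R).
Let LP := L2R_prehilbert R.
Let mC := @measurable_cube R.
Let CP : prehilbert LC := L2_prehilbert (@leb3 R) mC.
Let phi0 : 0 < phi. Proof. by rewrite ltr0n totient_gt0. Qed.
Let NR0 : NR != 0. Proof. by rewrite intr_eq0. Qed.

Let S_ge0 k x : 0 <= Wsum k x / phi.
Proof. by have [/andP[h _] _] := Wsum_le N0 d0 dN hchi k x; rewrite divr_ge0// ltW. Qed.

(** The counterpart of [Wpart f k] on the line, with the same norm: truncating the series becomes a
    weight between 0 and 1 that equals 1 at each x for large k. *)
Let v (f : R -> R[i]) (k : nat) (x : R) : R[i] := (Num.sqrt (Wsum k x / phi))%:C * f x.

Let measurable_shift_indic (n : int) :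
  measurable_fun setT (fun x : R => \1_J (NR^-1 * (x - n%:~R)) : R).
Proof.
have h : measurable_fun setT (fun x : R => NR^-1 * x + (- NR^-1 * n%:~R) : measurableTypeR R).
  exact: measurable_affine.
have mJ : measurable (J : set (measurableTypeR R)) by exact: measurable_itv.
have := measurableT_comp (@measurable_indic _ _ R setT _ mJ) h.
rewrite (_ : _ \o _ = (fun x : R => \1_J (NR^-1 * (x - n%:~R)) : R))//.
by apply/funext => x /=; congr (\1_J _); ring.
Qed.

Let measurable_Wsum k : measurable_fun setT (Wsum k).
Proof.
by apply: measurable_sum => n; exact: measurable_funM.
Qed.

Let v_cvg f : decaying f ->
  (forall k, @hmem R L (v f k)) /\ @hnorm R L (v f k - f : hcar L) @[k --> \oo] --> (0 : R).
Proof.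
move=> hf; have [mf _] := hf; have hm := decaying_mem hf.
have [] := @L2_dominated _ _ _ mu setT measurableT (v f) f (fun x => normc (f x) ^+ 2).
- move=> k; apply: cmeasurableM => //; apply: cmeasurable_real.
  apply: (measurableT_comp (continuous_measurable_fun (@sqrt_continuous R))) => //.
  exact: (measurable_funM (measurable_Wsum k) (@measurable_cst _ _ _ _ setT _)).
- exact: mf.
- by case: hm.
- move=> k x _; rewrite /v normc_sqrM normc_real sqr_sqrtr ?S_ge0//.
  have [/andP[_ h] _] := Wsum_le N0 d0 dN hchi k x.
  by rewrite ler_piMl ?sqr_ge0// ler_pdivrMr// mul1r.
- by [].
- apply: aeW => x _; have [_ [k0 hk0]] := Wsum_le N0 d0 dN hchi 0 x.
  apply: (cvg_near_cst); exists k0 => // k /= /hk0 E.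
  by rewrite /v E divff ?gt_eqF// sqrtr1 mul1r subrr normc_sqr /= expr0n addr0.
- by [].
Qed.

(** Parseval in a for fixed c, then x = n + N c in each term of the finite sum; the Jacobian |N| is
    absorbed by |C| = |N| / phi(d). *)
Let Wpart_norm f k : decaying f -> @hnorm R LC (Wpart f k) = @hnorm R L (v f k).
Proof.
move=> hf; have [mf _] := hf.
have [hW _ _] := Wpart_L2_cvg N d0 hchi hf.
have [hv _] := v_cvg hf.
apply/eqP; rewrite -(@eqrXn2 _ 2) ?hnorm_ge0//; apply/eqP/EFin_inj.
rewrite (L2_hnorm_sqrE mC (hW k)) (L2_hnorm_sqrE measurableT (hv k)).
pose ka := `|NR| / phi.
have ka0 : 0 <= ka by rewrite divr_ge0// ltW.
pose G n (c : R) : R := normc (w n * f (n%:~R + NR * c)) ^+ 2.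
have mG n : measurable_fun setT (G n).
  apply: measurable_normc_sqr; apply: cmeasurableZ.
  have mh : measurable_fun setT (fun c : R => n%:~R + NR * c : measurableTypeR R).
    have := measurable_affine NR n%:~R.
    by rewrite (_ : (fun x => _) = (fun c : R => n%:~R + NR * c))//; apply/funext => x; rewrite addrC.
  exact: (cmeasurable_comp mh mf).
have mkG n : measurable_fun setT (fun c => (ka * G n c)%:E).
  by apply/measurable_EFinP; exact: (measurable_funM (@measurable_cst _ _ _ _ setT _) (mG n)).
pose H (p : R2) : \bar R := (ka * normc (trig_poly (zlist k) (fun n => w n * f (n%:~R + NR * p.2)) p.1) ^+ 2)%:E.
have mH : measurable_fun setT H.
  apply/measurable_EFinP/measurable_funM => //; apply: measurable_normc_sqr.
  apply: cmeasurable_sum => n; apply: cmeasurableM.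
    apply: cmeasurableZ.
    have mh : measurable_fun setT (fun g : R2 => n%:~R + NR * g.2 : measurableTypeR R).
      by apply: measurable_funD => //; apply: measurable_funM.
    exact: (cmeasurable_comp mh mf).
  by apply: cmeasurable_e2pi_comp; exact: measurable_funM.
have H0 p : (0 <= H p)%E by rewrite lee_fin mulr_ge0// sqr_ge0.
transitivity (\int[@leb3 R]_(g in @cube R) H g.1)%E.
  apply: eq_integral => g _; rewrite /H /Wpart !normc_sqrM normc_Wconst// normc_e2pi mulr1.
  by [].
apply: (etrans (cube_integral mH H0)).
have mI : measurable (I01 : set (measurableTypeR R)) by exact: measurable_itv.
have mJ : measurable (J : set (measurableTypeR R)) by exact: measurable_itv.
transitivity (\int[mu]_(c in I01) \sum_(n <- zlist k) (ka * G n c)%:E)%E.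
  apply: eq_integral => c _; rewrite /H /=.
  have [iP EP] := trig_poly_parseval (fun n => w n * f (n%:~R + NR * c)) (uniq_zlist k).
  under eq_integral do rewrite EFinM.
  rewrite ge0_integralZl//=; last first.
  - by move=> a _; rewrite lee_fin sqr_ge0.
  - by case/integrableP: iP.
  rewrite sumEFin -mulr_sumr [RHS]EFinM; congr (_ * _)%E.
  have := integrable_fin_num mI iP => /fineK E.
  apply: (etrans (esym E)); congr (_%:E); exact: EP.
rewrite ge0_integral_sum//; last 2 first.
- by move=> n; apply/measurable_funTS; exact: mkG.
- by move=> n c _; rewrite lee_fin mulr_ge0// sqr_ge0.
transitivity (\int[mu]_x \sum_(n <- zlist k) (phi^-1 * normc (w n) ^+ 2 * \1_J (NR^-1 * (x - n%:~R)) * normc (f x) ^+ 2)%:E)%E; last first.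
  apply: eq_integral => x _; rewrite sumEFin; congr (_%:E).
  rewrite /v normc_sqrM normc_real sqr_sqrtr// /Wsum mulr_suml mulr_suml.
  by apply: eq_bigr => n _; ring.
have pos n x : 0 <= phi^-1 * normc (w n) ^+ 2 * \1_J (NR^-1 * (x - n%:~R)) * normc (f x) ^+ 2 :> R.
  apply: mulr_ge0; last exact: sqr_ge0.
  apply: mulr_ge0; last by rewrite indicE ler0n.
  by apply: mulr_ge0; [rewrite invr_ge0 ltW|exact: sqr_ge0].
have ms n : measurable_fun setT (fun x : R => phi^-1 * normc (w n) ^+ 2 * \1_J (NR^-1 * (x - n%:~R)) * normc (f x) ^+ 2 : R).
  exact: (measurable_funM (measurable_funM (@measurable_cst _ _ _ _ setT _) (measurable_shift_indic n)) (measurable_normc_sqr mf)).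
have msE n : measurable_fun setT (fun x : R => (phi^-1 * normc (w n) ^+ 2 * \1_J (NR^-1 * (x - n%:~R)) * normc (f x) ^+ 2)%:E).
  by apply/measurable_EFinP; exact: ms.
rewrite ge0_integral_sum//; last first.
- by move=> n x _; rewrite lee_fin; exact: pos.
apply: eq_bigr => n _.
rewrite (@ge0_integral_affine _ NR n%:~R)//; last first.
- by move=> x; rewrite lee_fin; exact: pos.
(* The endpoint c = 1 is a null set; dropping it makes the windows exact. *)
transitivity (\int[mu]_(x in J) (ka * G n x)%:E)%E.
  by apply: esym; apply: integral_itv_bndo_bndc; apply/measurable_funTS; exact: mkG.
rewrite -ge0_integralZl//; last 2 first.
- have h : measurable_fun setT (fun x : R => NR * x + n%:~R : measurableTypeR R).
    exact: measurable_affine.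
  exact: (measurableT_comp (msE n) h).
- by move=> x _; rewrite lee_fin; exact: pos.
rewrite [LHS]integral_mkcond; apply: eq_integral => x _.
rewrite patchE -EFinM indicE.
have -> : NR^-1 * (NR * x + n%:~R - n%:~R) = x by rewrite addrK mulKf.
case: (x \in J); last by rewrite mulr0 mul0r mulr0.
congr (_%:E); rewrite /G normc_sqrM /ka [n%:~R + _]addrC.
by rewrite [true%:R]mulr1n; ring.
Qed.

Lemma W_schwartz_norm f : decaying f -> @hnorm R LC (W0 f) = @hnorm R L f.
Proof.
move=> hf; have [hW hW0 Wc] := Wpart_L2_cvg N d0 hchi hf; have [hv vc] := v_cvg hf.
have hm := decaying_mem hf.
have [h1 _] := cvg_hinner CP hW hW hW0 hW0 Wc Wc.
have [h2 _] := cvg_hinner LP hv hv hm hm vc vc.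
apply/eqP; rewrite -(@eqrXn2 _ 2) ?hnorm_ge0//; apply/eqP.
rewrite (hnorm_sqr CP)// (hnorm_sqr LP)//.
have E k : complex.Re (@hinner R LC (Wpart f k) (Wpart f k)) =
    complex.Re (@hinner R L (v f k) (v f k)).
  have := hnorm_sqr CP (hW k); have := hnorm_sqr LP (hv k).
  by rewrite Wpart_norm// => -> ->.
move: h1; rewrite (funext E) => h1.
exact: (cvg_unique _ h1 h2).
Qed.

Lemma W_schwartz_inner f h : decaying f -> decaying h ->
  @hinner R LC (W0 f) (W0 h) = @hinner R L f h.
Proof.
move=> hf hh.
have [_ f1 _] := Wpart_L2_cvg N d0 hchi hf; have [_ h1 _] := Wpart_L2_cvg N d0 hchi hh.
apply: (hinner_polar CP LP) => //; try exact: decaying_mem; try exact: W_schwartz_norm.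
move=> a; rewrite -W_schwartz_norm; last exact: decayingZD.
by rewrite (W_schwartz_linear N d0 hchi).
Qed.

End WIsometry.

(** * Heisenberg translations, null sets and the fundamental cube *)

Section HeisenbergNullSets.
Variable R : realType.
Local Notation mu := (@lebesgue_measure R).
Local Notation R2 := (measurableTypeR R * measurableTypeR R)%type.
Local Notation R3 := (R2 * measurableTypeR R)%type.

Lemma integral_translate2 (a c : R) (h : R2 -> \bar R) : measurable_fun setT h ->
  (forall p, 0 <= h p)%E ->
  (\int[(mu \x mu)%E]_p h (p.1 + a, p.2 + c)%R = \int[(mu \x mu)%E]_p h p)%E.
Proof.
move=> mh h0.
have mt : measurable_fun setT (fun p : R2 => (p.1 + a, p.2 + c) : R2).
  by apply/measurable_fun_pairP; split; apply: measurable_funD.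
have mht := measurableT_comp mh mt.
have ht0 (p : R2) : (0 <= h (p.1 + a, p.2 + c)%R)%E by exact: h0.
apply: (etrans (@fubini_tonelli1 _ _ _ _ R mu mu _ mht ht0)).
apply: (etrans _ (esym (@fubini_tonelli1 _ _ _ _ R mu mu h mh h0))).
have mF := @measurable_fun_fubini_tonelli_F _ _ _ _ R mu h mh h0.
have F0 x : (0 <= fubini_F mu h x)%E by apply: integral_ge0 => y _; exact: h0.
apply: (etrans _ (esym (@ge0_integral_affine _ 1 a _ (oner_neq0 R) mF F0))).
rewrite normr1 mul1e; apply: eq_integral => x _; rewrite /fubini_F mul1r.
have mx : measurable_fun setT (fun y : R => h (x + a, y)).
  exact: (measurableT_comp mh (@measurable_pair1 _ _ _ _ (x + a))).
rewrite [RHS](@ge0_integral_affine _ 1 c _ (oner_neq0 R) mx)// normr1 mul1e.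
by apply: eq_integral => y _; rewrite mul1r.
Qed.

(** The common form of left and right translations in the Heisenberg group: a translation of (a, c)
    and a shift of z depending on (a, c). *)
Definition shear (a c : R) (s : R2 -> R) (g : R3) : R3 :=
  (g.1.1 + a, g.1.2 + c, g.2 + s g.1).

Lemma measurable_shear a c s : measurable_fun setT s ->
  measurable_fun setT (shear a c s).
Proof.
move=> ms.
have m1 : measurable_fun setT (fun g : R3 => g.1.1).
  exact: (measurableT_comp measurable_fst measurable_fst).
have m2 : measurable_fun setT (fun g : R3 => g.1.2).
  exact: (measurableT_comp measurable_snd measurable_fst).
apply/measurable_fun_pairP; split.
  by apply/measurable_fun_pairP; split; apply: measurable_funD.
apply: measurable_funD; first exact: measurable_snd.
exact: (measurableT_comp ms measurable_fst).
Qed.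

(** Each z-section of the preimage is a translate of a section of B, and the base is translated
    too. *)
Lemma leb3_shear a c s (B : set R3) : measurable_fun setT s -> measurable B ->
  leb3 (shear a c s @^-1` B) = leb3 B.
Proof.
move=> ms mB.
have mS : measurable (shear a c s @^-1` B).
  by rewrite -[X in measurable X]setTI; exact: measurable_shear.
have E (A : set R3) : leb3 A = (\int[(mu \x mu)%E]_p mu (xsection A p))%E by [].
pose h (p : R2) : \bar R := mu (xsection B p).
have mh : measurable_fun setT h by exact: (measurable_fun_xsection mu mB).
have h0 p : (0 <= h p)%E by exact: measure_ge0.
rewrite !E; apply: etrans (integral_translate2 a c mh h0).
apply: eq_integral => p _; rewrite /h.
have mX := measurable_xsection (p.1 + a, p.2 + c) mB.
have := @lebesgue_measure_affine R 1 (s p) _ (oner_neq0 R) mX.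
rewrite normr1 mul1e => <-; congr (mu _); apply/seteqP; split => z.
  by rewrite /xsection /shear /= !inE mul1r.
by rewrite /xsection /shear /= !inE mul1r.
Qed.

Lemma negligible_shear a c s (A : set R3) : measurable_fun setT s ->
  (@leb3 R).-negligible A -> (@leb3 R).-negligible (shear a c s @^-1` A).
Proof.
move=> ms [B [mB B0 AB]]; exists (shear a c s @^-1` B); split.
- by rewrite -[X in measurable X]setTI; exact: measurable_shear.
- exact: (etrans (leb3_shear a c ms mB)).
- by move=> g /AB.
Qed.

Lemma heis_mulrE (h g : R3) :
  heis_mul g h = shear h.1.1 h.1.2 (fun p => h.2 + p.2 * h.1.1) g.
Proof. by case: h g => [[a' c'] z'] [[a c] z]; rewrite /shear /= addrA. Qed.

Lemma heis_mullE (h g : R3) :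
  heis_mul h g = shear h.1.1 h.1.2 (fun p => h.2 + h.1.2 * p.1) g.
Proof.
case: h g => [[a' c'] z'] [[a c] z]; rewrite /shear /= [a' + a]addrC [c' + c]addrC.
by congr (_, _); ring.
Qed.

Let mr (x y : R) : measurable_fun setT (fun p : R2 => x + p.2 * y).
Proof. by apply: measurable_funD => //; apply: measurable_funM. Qed.

Let ml (x y : R) : measurable_fun setT (fun p : R2 => x + y * p.1).
Proof. by apply: measurable_funD => //; apply: measurable_funM. Qed.

Lemma measurable_heis_mulr (h : R3) : measurable_fun setT (fun g : R3 => heis_mul g h : R3).
Proof. by rewrite (funext (heis_mulrE h)); exact: measurable_shear. Qed.

Lemma negligible_heis_mulr (h : R3) (A : set R3) : (@leb3 R).-negligible A ->
  (@leb3 R).-negligible [set g | A (heis_mul g h)].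
Proof.
move=> nA; rewrite (_ : mkset _ = shear h.1.1 h.1.2 (fun p => h.2 + p.2 * h.1.1) @^-1` A).
  exact: negligible_shear.
by apply/seteqP; split => g /=; rewrite heis_mulrE.
Qed.

Lemma negligible_heis_mull (h : R3) (A : set R3) : (@leb3 R).-negligible A ->
  (@leb3 R).-negligible [set g | A (heis_mul h g)].
Proof.
move=> nA; rewrite (_ : mkset _ = shear h.1.1 h.1.2 (fun p => h.2 + h.1.2 * p.1) @^-1` A).
  exact: negligible_shear.
by apply/seteqP; split => g /=; rewrite heis_mullE.
Qed.

Lemma heis_fundamental (g : R3) :
  exists m n k : int, cube (heis_mul (heisZ R m n k) g).
Proof.
case: g => [[a c] z].
have fl (x : R) : 0 <= (- Num.floor x)%:~R + x <= 1.
  have := floor_itv x; rewrite intrD mulrNz => /andP[h1 h2].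
  by rewrite addrC subr_ge0 h1 /= lerBlDl ltW// addrC.
pose n := - Num.floor c.
(* Left multiplication by (m, n, k) adds n a to z, so k depends on n. *)
exists (- Num.floor a), n, (- Num.floor (z + n%:~R * a)).
split; first split; rewrite /= in_itv/=.
- exact: fl.
- exact: fl.
- by rewrite -addrA; exact: fl.
Qed.

(** Every point has an integer translate in the cube, so the exceptional set lies in countably many
    translates of a null set. *)
Lemma invariant_ae (F G : R3 -> R[i]) :
  (forall m n k g, F (heis_mul (heisZ R m n k) g) = F g) ->
  (forall m n k g, G (heis_mul (heisZ R m n k) g) = G g) ->
  {ae (@leb3 R), forall g, cube g -> F g = G g} ->
  {ae (@leb3 R), forall g, F g = G g}.
Proof.
move=> Fi Gi FG; pose B := ~` [set g : R3 | cube g -> F g = G g].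
have nB : (@leb3 R).-negligible B by exact: FG.
pose f (j : nat) : set R3 :=
    if (choice.unpickle j : option (int * int * int)) is Some m
  then [set g | B (heis_mul (heisZ R m.1.1 m.1.2 m.2) g)] else set0.
have nf : (@leb3 R).-negligible (\bigcup_j f j).
  apply: negligible_bigcup => j; rewrite /f; case: (choice.unpickle _) => [m|].
    exact: negligible_heis_mull.
  exact: negligible_set0.
apply: negligibleS nf => g /= gFG.
have [m [n [k gC]]] := heis_fundamental g.
have [j fj] : exists j, f j = [set g | B (heis_mul (heisZ R m n k) g)].
  by exists (choice.pickle (m, n, k)); rewrite /f choice.pickleK.
exists j; first exact: I.
by rewrite fj /B /= => H; apply: gFG; rewrite -(Fi m n k) -(Gi m n k); exact: H.
Qed.

End HeisenbergNullSets.

Section SquareIntegrableAe.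
Variables (R : realType) (d : measure_display) (X : measurableType d).
Variables (mu : {measure set X -> \bar R}) (D : set X).
Hypothesis mD : measurable D.

Lemma square_integrable_ae (f g : X -> R[i]) : cmeasurable f ->
  {ae mu, forall x, f x = g x} ->
  square_integrable mu D g -> square_integrable mu D f.
Proof.
move=> mf fg [mg ig]; split=> //.
have mF (h : X -> R[i]) : cmeasurable h -> measurable_fun D (fun x => (normc (h x) ^+ 2)%:E).
  by move=> mh; apply/measurable_EFinP/measurable_funTS; exact: measurable_normc_sqr.
apply/integrableP; split; first exact: mF.
case/integrableP: ig => _; congr (_ < _)%E.
apply: ae_eq_integral => //.
- exact/measurableT_comp/mF.
- exact/measurableT_comp/mF.
- by apply: filterS fg => x -> _.
Qed.

End SquareIntegrableAe.

#[local] Instance leb3_ae_filter (R : realType) :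
  Filter (nbhs (almost_everywhere (@leb3 R))).
Proof. exact: ae_filter_ringOfSetsType. Qed.

(** * The space H_N *)

Section HeisenbergForms.
Variables (R : realType) (N : int).
Local Notation NR := (N%:~R : R).
Local Notation mu := (@lebesgue_measure R).
Local Notation R2 := (measurableTypeR R * measurableTypeR R)%type.
Local Notation R3 := (R2 * measurableTypeR R)%type.
Local Notation LC := (L2space (@leb3 R) (@cube R)).
Local Notation HN := (HN R N).
Let mC := @measurable_cube R.
Let CP : prehilbert LC := L2_prehilbert (@leb3 R) mC.

(** Equivariance at every point. The almost-everywhere version refers to the null set z = 0, which
    right translations move; the series and its pointwise limits satisfy this stronger form. *)
Definition strict_form (F : R3 -> R[i]) : Prop :=
  [/\ forall m n k g, F (heis_mul (heisZ R m n k) g) = F g,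
      square_integrable (@leb3 R) (@cube R) F &
      forall g, F g = e2pi (NR * g.2) * F (g.1, 0)].

Lemma strict_invariant_form F : strict_form F -> invariant_form N F.
Proof. by case=> Fi Fs Fe; split=> //; exact: aeW. Qed.

Lemma invariant_form_linear (a : R[i]) (F G : R3 -> R[i]) :
  invariant_form N F -> invariant_form N G ->
  invariant_form N (fun g => a * F g + G g).
Proof.
case=> Fi Fs Fe [Gi Gs Ge]; split.
- by move=> m n k g; rewrite Fi Gi.
- exact: square_integrableZD.
- by apply: filterS2 Fe Ge => g /= -> ->; ring.
Qed.

Lemma HN_sub (F : R3 -> R[i]) : @hmem R HN F -> square_integrable (@leb3 R) (@cube R) F.
Proof. by move=> [mF [F' [_ Fs _] FF']]; exact: square_integrable_ae FF' Fs. Qed.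

Lemma HN_subspace : @hsubspace R LC (@hmem R HN).
Proof.
split; first by move=> F /HN_sub.
  split; first exact: (@cmeasurable_cst _ _ _ 0).
  exists (fun _ => 0); last exact: aeW.
  split=> //; first exact: square_integrable0.
  by apply: aeW => g; rewrite mulr0.
move=> a F G [mF [F' iF FF']] [mG [G' iG GG']]; split.
  exact: (cmeasurableD (cmeasurableZ a mF) mG).
exists (fun g => a * F' g + G' g); first exact: invariant_form_linear.
by apply: filterS2 FF' GG' => g /= <- <-.
Qed.

Lemma HN_prehilbert : prehilbert HN.
Proof. exact: prehilbert_hsub CP HN_subspace. Qed.

(** The norm sees only the cube; invariance of the chosen representatives spreads the equality to
    the whole group. *)
Lemma HN_heqP (F G : R3 -> R[i]) : @hmem R HN F -> @hmem R HN G ->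
  @heq R HN F G <-> {ae (@leb3 R), forall g, F g = G g}.
Proof.
move=> hF hG; have [mF [F' iF FF']] := hF; have [mG [G' iG GG']] := hG.
have [LE1 LE2] := L2_heqP mC (HN_sub hF) (HN_sub hG).
split=> [[_ _ FG]|FG]; last first.
  have [_ _ E] : @heq R LC F G by apply: LE2; apply: filterS FG => g + _.
  by split.
have FGc : {ae (@leb3 R), forall g, cube g -> F g = G g}.
  by apply: LE1; split=> //; exact: HN_sub.
have F'G' : {ae (@leb3 R), forall g, F' g = G' g}.
  case: iF iG => Fi _ _ [Gi _ _]; apply: invariant_ae Fi Gi _.
  by apply: filterS3 FF' GG' FGc => g <- <-.
by apply: filterS3 FF' GG' F'G' => g -> ->.
Qed.

Lemma HN_mem_ae (F G : R3 -> R[i]) : cmeasurable G -> invariant_form N F ->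
  {ae (@leb3 R), forall g, F g = G g} -> @hmem R HN G.
Proof.
move=> mG iF FG; split=> //; exists F => //.
by apply: filterS FG => g ->.
Qed.

Lemma ae_rho (h : R3) (F G : R3 -> R[i]) :
  {ae (@leb3 R), forall g, F g = G g} ->
  {ae (@leb3 R), forall g, rho h F g = rho h G g}.
Proof. by move=> FG; exact: (negligible_heis_mulr h FG). Qed.

Lemma heis_mulA (g h k : R3) : heis_mul g (heis_mul h k) = heis_mul (heis_mul g h) k.
Proof.
by case: g h k => [[a c] z] [[a' c'] z'] [[a2 c2] z2] /=; congr (_, _, _); ring.
Qed.

End HeisenbergForms.

(** * Invariance and intertwining property of the series *)

Section SchwartzForms.
Variables (R : realType) (N : int) (d : nat) (chi : int -> R[i]).
Hypotheses (N0 : N != 0) (d0 : (0 < d)%N) (dN : (d%:Z %| N)%Z).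
Hypothesis hchi : dirichlet_character d chi.
Local Notation NR := (N%:~R : R).
Local Notation w := (chi_frac N d chi).
Local Notation R2 := (measurableTypeR R * measurableTypeR R)%type.
Local Notation R3 := (R2 * measurableTypeR R)%type.
Local Notation W0 := (W_schwartz N d chi).

Definition heis_schr (h : R3) (f : R -> R[i]) (x : R) : R[i] :=
  e2pi (NR * h.2 + h.1.1 * x) * f (x + NR * h.1.2).

Lemma decaying_heis_schr h f : decaying f -> decaying (heis_schr h f).
Proof.
move=> [mf [B fB]]; split.
  apply: cmeasurableM.
    have -> : (fun x : R => e2pi (NR * h.2 + h.1.1 * x)) = (fun x : R => e2pi (h.1.1 * x + NR * h.2)).
      by apply/funext => x; rewrite addrC.
    exact: (cmeasurable_e2pi_comp (measurable_affine _ _)).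
  have := cmeasurable_comp (measurable_affine 1 (NR * h.1.2)) mf.
  by rewrite (_ : _ \o _ = fun x => f (x + NR * h.1.2))//; apply/funext => x /=; rewrite mul1r.
set y := NR * h.1.2.
exists (B * (2 + 2 * y ^+ 2)) => x; rewrite normc_sqrM normc_e2pi mul1r -/y.
have := fB (x + y); set F := normc _ ^+ 2.
have F0 : 0 <= F by exact: sqr_ge0.
rewrite exprMn => H.
have pq : (1 + x ^+ 2) ^+ 2 <= ((2 + 2 * y ^+ 2) * (1 + (x + y) ^+ 2)) ^+ 2.
  have p0 : 0 <= 1 + x ^+ 2 by rewrite addr_ge0// sqr_ge0.
  suff pqr : 1 + x ^+ 2 <= (2 + 2 * y ^+ 2) * (1 + (x + y) ^+ 2) by rewrite !expr2; apply: ler_pM.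
  have := mulr_ge0 (sqr_ge0 y) (sqr_ge0 (x + y)); have := sqr_ge0 (x + 2 * y).
  set a := y ^+ 2 * _.
  have -> : (2 + 2 * y ^+ 2) * (1 + (x + y) ^+ 2) =
    2 + 2 * y ^+ 2 + 2 * (x + y) ^+ 2 + 2 * a by rewrite /a; ring.
  move=> h1 h2; nra.
apply: (le_trans (ler_wpM2l F0 pq)).
by rewrite exprMn mulrCA mulrC ler_wpM2r// sqr_ge0.
Qed.

(** Moving c by n is undone by the re-indexing j |-> j + N n, allowed since the coefficients have
    period N; the resulting phase e(- N n a) cancels against the term n a added to z. *)
Lemma W_schwartz_invariant f m n k (g : R3) : decaying f ->
  W0 f (heis_mul (heisZ R m n k) g) = W0 f g.
Proof.
move=> /decaying_fbound[B fB]; rewrite !W_schwartzE.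
have gB := Wterm_decay N d0 hchi g fB.
have B0 : 0 <= B * (2 + 2 * (NR * g.1.2) ^+ 2).
  by case: fB => ? _; rewrite mulr_ge0// addr_ge0// mulr_ge0// sqr_ge0.
have E j : Wterm N d chi f (heis_mul (heisZ R m n k) g) j =
    e2pi (- ((N * n)%:~R * g.1.1)) * Wterm N d chi f g (j + N * n).
  case: g {gB B0} => [[a c] z]; rewrite /Wterm /heisZ /= chi_frac_periodic//.
  have -> : e2pi (j%:~R * (m%:~R + a)) = e2pi (- ((N * n)%:~R * a)) * e2pi ((j + N * n)%:~R * a).
    rewrite mulrDr -intrM e2piD e2pi_int mul1r -e2piD; congr e2pi.
    by rewrite intrD mulrDl addrCA addNr addr0.
  have -> : j%:~R + NR * (n%:~R + c) = (j + N * n)%:~R + NR * c.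
    by rewrite intrD intrM; ring.
  ring.
rewrite (funext E).
set p := e2pi (- _); set u := Wterm N d chi f g.
have vB : sq_decay (fun j => p * u j) (B * (2 + 2 * (NR * g.1.2) ^+ 2)).
  by move=> j; rewrite normc_sqrM normc_e2pi mul1r; exact: gB.
have -> : sumZ (fun j => p * u (j + N * n)) = p * sumZ u.
  by rewrite -(sumZ_Z p B0 gB); exact: (sumZ_shift (N * n) B0 vB).
have -> : e2pi (NR * (heis_mul (heisZ R m n k) g).2) = e2pi (NR * g.2) * e2pi ((N * n)%:~R * g.1.1).
  case: (g) => [[a c] z] /=.
  rewrite !mulrDr mulrA -!intrM !e2piD e2pi_int; ring.
have := e2piN ((N * n)%:~R * g.1.1); rewrite -/p => pE.
by rewrite -mulrA -mulrA (mulrA _ p) pE mul1r mulrA.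
Qed.

Lemma W_schwartz_equivariant f (g : R3) :
  W0 f g = e2pi (NR * g.2) * W0 f (g.1, 0).
Proof.
case: g => [[a c] z] /=; rewrite mulr0 e2pi0; ring.
Qed.

(** True term by term up to the factor [p] = e(N (z' + c a')), which is what right multiplication by
    h = [a', c', z'] does to the z-coordinate. *)
Lemma W_schwartz_intertwine h f (g : R3) : decaying f ->
  W0 (heis_schr h f) g = rho h (W0 f) g.
Proof.
move=> /decaying_fbound[B fB]; rewrite /rho !W_schwartzE.
set gh := heis_mul g h.
have gB := Wterm_decay N d0 hchi gh fB.
have B0 : 0 <= B * (2 + 2 * (NR * gh.1.2) ^+ 2).
  by case: fB => ? _; rewrite mulr_ge0// addr_ge0// mulr_ge0// sqr_ge0.
pose p := e2pi (NR * (h.2 + g.1.2 * h.1.1)).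
have E n : Wterm N d chi (heis_schr h f) g n = p * Wterm N d chi f gh n.
  rewrite /gh /p; clear B0 gB p gh; case: g h => [[a c] z] [[a' c'] z'] /=; rewrite /Wterm /heis_schr /=.
  have -> : n%:~R + NR * c + NR * c' = n%:~R + NR * (c + c') by ring.
  have -> : e2pi (n%:~R * (a + a')) = e2pi (n%:~R * a) * e2pi (n%:~R * a').
    by rewrite mulrDr e2piD.
  have -> : e2pi (NR * z' + a' * (n%:~R + NR * c)) = e2pi (NR * (z' + c * a')) * e2pi (n%:~R * a').
    by rewrite -e2piD; congr e2pi; ring.
  ring.
rewrite (funext E) (sumZ_Z p B0 gB).
have -> : e2pi (NR * gh.2) = e2pi (NR * g.2) * p.
  rewrite /gh /p; clear E B0 gB p gh; case: g h => [[a c] z] [[a' c'] z'] /=.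
  by rewrite -e2piD; congr e2pi; ring.
ring.
Qed.

Lemma W_schwartz_strict f : decaying f -> strict_form N (W0 f).
Proof.
move=> hf; split.
- by move=> m n k g; exact: W_schwartz_invariant.
- by have [] := Wpart_L2_cvg N d0 hchi hf.
- exact: W_schwartz_equivariant.
Qed.

End SchwartzForms.

(** An invertible factor preserves divergence as well, so the identity also holds for the default
    value 0. *)
Lemma climZ (R : realType) (a b : R[i]) (s : nat -> R[i]) : a * b = 1 ->
  clim (fun k => a * s k) = a * clim s.
Proof.
move=> ab.
have P (u : nat -> R[i]) : cvgn (fun n => complex.Re (u n)) /\ cvgn (fun n => complex.Im (u n)) ->
    exists l, ccvg u l.
  by move=> [h1 h2]; exists (limn (fun n => complex.Re (u n)) +i* limn (fun n => complex.Im (u n))).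
have Q (u : nat -> R[i]) l : ccvg u l ->
    cvgn (fun n => complex.Re (u n)) /\ cvgn (fun n => complex.Im (u n)).
  by move=> [h1 h2]; split; apply/cvg_ex; [exists (complex.Re l)|exists (complex.Im l)].
have [[l sl]|ns] := pselect (exists l, ccvg s l).
  by rewrite (clim_ccvg sl); apply: clim_ccvg; exact: ccvgZ.
rewrite /clim; case: asboolP => [/P[l sl]|_].
  exfalso; apply: ns; exists (b * l); have := ccvgZ b sl.
  rewrite (_ : (fun n => b * _) = s)//.
  by apply/funext => k; rewrite mulrA [b * a]mulrC ab mul1r.
by case: asboolP => [/P//|_]; rewrite mulr0.
Qed.

Lemma hcvgZD (R : realType) (E : hspace R) (a : R[i]) (u v : nat -> hcar E) f g :
  prehilbert E -> (forall k, hmem (u k)) -> (forall k, hmem (v k)) ->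
  hmem f -> hmem g ->
  hnorm (u k - f) @[k --> \oo] --> (0 : R) ->
  hnorm (v k - g) @[k --> \oo] --> (0 : R) ->
  hnorm ((a *: u k + v k) - (a *: f + g)) @[k --> \oo] --> (0 : R).
Proof.
move=> EP hu hv hf hg uf vg.
apply: (@squeeze_cvgr _ _ _ _ (cst 0) (fun k =>
  normc a * hnorm (u k - f) + hnorm (v k - g))).
- apply: nearW => k; rewrite hnorm_ge0/= opprD addrACA -scalerBr.
  have h1 := hmemB EP (hu k) hf.
  by rewrite -(hnormZ EP)// hnormD//; [exact: hmemZ|exact: hmemB].
- exact: cvg_cst.
- rewrite -[0](_ : normc a * 0 + 0 = _); last by rewrite mulr0 addr0.
  by apply: cvgD => //; exact: cvgMr.
Qed.

(** * The isometric extension to L^2(R) *)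

Section Extension.
Variables (R : realType) (N : int) (d : nat) (chi : int -> R[i]).
Hypotheses (N0 : N != 0) (d0 : (0 < d)%N) (dN : (d%:Z %| N)%Z).
Hypothesis hchi : dirichlet_character d chi.
Local Notation NR := (N%:~R : R).
Local Notation L := (L2R R).
Local Notation R2 := (measurableTypeR R * measurableTypeR R)%type.
Local Notation R3 := (R2 * measurableTypeR R)%type.
Local Notation W0 := (W_schwartz N d chi).
Local Notation LC := (L2space (@leb3 R) (@cube R)).
Local Notation HN := (HN R N).
Let LP := L2R_prehilbert R.
Let mC := @measurable_cube R.
Let CP : prehilbert LC := L2_prehilbert (@leb3 R) mC.
Let HP := HN_prehilbert R N.

(** Convergence fast enough for [L2_rapid], so that the images of u_k converge to their pointwise
    [clim] in norm. *)
Definition rapid_seq (f : R -> R[i]) (u : nat -> R -> R[i]) : Prop :=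
  [/\ forall k, decaying (u k),
      forall k, @hnorm R L (u k.+1 - u k : hcar L) ^+ 2 <= 8^-1 ^+ k &
      @hnorm R L (u k - f : hcar L) @[k --> \oo] --> (0 : R)].

Lemma rapid_seq_ex f : @hmem R L f -> exists u, rapid_seq f u.
Proof.
move=> hf; have [v hv vf] := decaying_dense hf.
pose e (k : nat) : R := 8^-1 ^+ k / 2.
have e0 k : 0 < e k by rewrite divr_gt0// exprn_gt0.
have H k : exists n, @hnorm R L (v n - f : hcar L) <= e k.
  have [n0 _ /(_ n0 (leqnn _))/= hn] := (cvgr0Pnorm_le _).1 vf _ (e0 k).
  by exists n0; rewrite (le_trans (ler_norm _)).
have [n nP] := choice H.
have hm k := decaying_mem (hv k).
exists (v \o n); split => /=.
- by move=> k; exact: hv.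
- move=> k.
  have le : @hnorm R L (v (n k.+1) - v (n k) : hcar L) <= 8^-1 ^+ k.
    rewrite (le_trans (hnormB_le LP (hm _) hf (hm _)))//.
    rewrite (hnormB_sym LP hf (hm _)) (le_trans (lerD (nP _) (nP _)))// /e exprS.
    have : 0 <= 8^-1 ^+ k :> R by rewrite exprn_ge0.
    lra.
  apply: (@le_trans _ _ ((8^-1 ^+ k) ^+ 2)).
    by rewrite ler_pXn2r ?nnegrE ?hnorm_ge0// exprn_ge0.
  rewrite expr2 ler_piMl ?exprn_ge0// exprn_ile1// invf_le1//. by rewrite ler1n.
- apply: (@squeeze_cvgr _ _ _ _ (cst 0) (fun k => 8^-1 ^+ k)).
  + apply: nearW => k; rewrite hnorm_ge0/= (le_trans (nP k))// /e.
    have : 0 <= 8^-1 ^+ k :> R by rewrite exprn_ge0.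
    lra.
  + exact: cvg_cst.
  + apply: cvg_expr; rewrite ger0_norm// invf_lt1//. by rewrite ltr1n.
Qed.

Lemma W_schwartz_normB u v : decaying u -> decaying v ->
  @hnorm R LC (W0 u - W0 v : hcar LC) = @hnorm R L (u - v : hcar L).
Proof.
move=> hu hv.
have -> : (u - v : hcar L) = (fun x => -1 * v x + u x).
  by apply/funext => x; rewrite mulN1r addrC.
rewrite -(W_schwartz_norm N0 d0 dN hchi); last exact: decayingZD.
rewrite (W_schwartz_linear N d0 hchi)//; congr (@hnorm R LC _).
by apply/funext => g; rewrite mulN1r addrC.
Qed.

Definition Wlim (u : nat -> R -> R[i]) (g : R3) : R[i] := clim (fun k => W0 (u k) g).

Let W0_mem u : decaying u -> square_integrable (@leb3 R) (@cube R) (W0 u).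
Proof. by move=> hu; have [] := W_schwartz_strict N0 d0 hchi hu. Qed.

(** The limit is pointwise, so invariance and equivariance of the W0 (u_k) pass to it at every
    point, including points of divergence. *)
Lemma Wlim_rapid f u : rapid_seq f u ->
  strict_form N (Wlim u) /\
  @hnorm R LC (W0 (u k) - Wlim u : hcar LC) @[k --> \oo] --> (0 : R).
Proof.
move=> [hu ur uf].
have [] := @L2_rapid _ _ _ (@leb3 R) _ mC (fun k => W0 (u k)).
- by move=> k; exact: W0_mem.
- by move=> k; rewrite W_schwartz_normB.
move=> h1 h2; split => //; split => //.
- move=> m n k g; rewrite /Wlim; congr clim; apply/funext => j.
  exact: W_schwartz_invariant.
- move=> g; rewrite /Wlim -(climZ _ (e2piN _)); congr clim; apply/funext => j.
  exact: W_schwartz_equivariant.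
Qed.

Lemma strict_mem F : strict_form N F -> @hmem R HN F.
Proof.
move=> sF; have [_ [mF _] _] := sF.
by split => //; exists F; [exact: strict_invariant_form|exact: aeW].
Qed.

Lemma Wlim_cvg f u (x : nat -> R -> R[i]) : @hmem R L f -> rapid_seq f u ->
  (forall k, decaying (x k)) ->
  @hnorm R L (x k - f : hcar L) @[k --> \oo] --> (0 : R) ->
  @hnorm R LC (W0 (x k) - Wlim u : hcar LC) @[k --> \oo] --> (0 : R).
Proof.
move=> hf ru hx xf; have [[_ sW _] uW] := Wlim_rapid ru; have [hu _ uf] := ru.
apply: (@squeeze_cvgr _ _ _ _ (cst 0) (fun k =>
  (@hnorm R L (x k - f : hcar L) + @hnorm R L (u k - f : hcar L)) +
  @hnorm R LC (W0 (u k) - Wlim u : hcar LC))).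
- apply: nearW => k; rewrite hnorm_ge0/=.
  rewrite (le_trans (hnormB_le CP (W0_mem (hx k)) (W0_mem (hu k)) sW))// lerD2r.
  rewrite W_schwartz_normB//.
  have hxk := decaying_mem (hx k); have huk := decaying_mem (hu k).
  by rewrite (le_trans (hnormB_le LP hxk hf huk))// (hnormB_sym LP hf huk).
- exact: cvg_cst.
- rewrite -[0](_ : 0 + 0 + 0 = _); last by rewrite !addr0.
  by apply: cvgD; [exact: cvgD|].
Qed.

(** An explicit isometric extension. It shows that the choice defining [W] is not vacuous and
    supplies a strictly equivariant representative of each [W] f. *)
Definition Wext (f : R -> R[i]) : R3 -> R[i] :=
  Wlim (xget (fun _ _ => 0) (rapid_seq f)).

Let WextP f : @hmem R L f -> exists2 u, rapid_seq f u & Wext f = Wlim u.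
Proof.
by move=> /rapid_seq_ex hu; exists (xget (fun _ _ => 0) (rapid_seq f)) => //; exact: xgetPex hu.
Qed.

Lemma Wext_strict f : @hmem R L f -> strict_form N (Wext f).
Proof. by move=> /WextP[u ru ->]; have [] := Wlim_rapid ru. Qed.

Lemma Wext_cvg f (x : nat -> R -> R[i]) : @hmem R L f ->
  (forall k, decaying (x k)) ->
  @hnorm R L (x k - f : hcar L) @[k --> \oo] --> (0 : R) ->
  @hnorm R LC (W0 (x k) - Wext f : hcar LC) @[k --> \oo] --> (0 : R).
Proof. by move=> hf hx xf; have [u ru ->] := WextP hf; exact: (Wlim_cvg hf ru). Qed.

Let heqHN F G : @hmem R HN F -> @hmem R HN G -> @heq R LC F G -> @heq R HN F G.
Proof. by move=> hF hG [_ _ E]; split. Qed.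

Lemma Wext_decaying f : decaying f -> @heq R HN (Wext f) (W0 f).
Proof.
move=> hf; have hm := decaying_mem hf.
have sW := Wext_strict hm; have [_ s1 _] := sW.
have sW0 := W_schwartz_strict N0 d0 hchi hf.
apply: heqHN; try exact: strict_mem.
apply: (hlim_unique CP (u := fun _ => W0 f)) => //.
- by move=> _; exact: W0_mem.
- exact: W0_mem.
- apply: (Wext_cvg hm) => //.
  by rewrite subrr (hnorm0 LP); exact: cvg_cst.
- by rewrite subrr (hnorm0 CP); exact: cvg_cst.
Qed.

Lemma Wext_isometry : @hisometry R L HN Wext.
Proof.
split.
- by move=> f hf; exact/strict_mem/Wext_strict.
- move=> a f g hf hg.
  have hfg := hmemZD LP a hf hg.
  have [u [hu _ uf]] := rapid_seq_ex hf; have [v [hv _ vg]] := rapid_seq_ex hg.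
  have mf := Wext_strict hf; have mg := Wext_strict hg; have mfg := Wext_strict hfg.
  apply: heqHN; [exact: strict_mem|apply: (hmemZD HP); exact: strict_mem|].
  apply: (hlim_unique CP (u := fun k => a *: (W0 (u k) : hcar LC) + W0 (v k))).
  + by move=> k; apply: (hmemZD CP); exact: W0_mem.
  + by case: mfg.
  + by apply: (hmemZD CP); [case: mf|case: mg].
  + rewrite (_ : (fun k => _) = (fun k => @hnorm R LC (W0 (fun x => a * u k x + v k x) - Wext (a *: (f : hcar L) + g) : hcar LC))).
      apply: (Wext_cvg hfg).
        by move=> k; exact: decayingZD.
      apply: (hcvgZD a LP) => // k; exact: decaying_mem.
    apply/funext => k; rewrite (W_schwartz_linear N d0 hchi)//.
  + apply: (hcvgZD a CP); [by move=> k; exact: W0_mem|by move=> k; exact: W0_mem|by case: mf|by case: mg| |].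
      exact: Wext_cvg.
    exact: Wext_cvg.
- move=> f g hf hg.
  have [u [hu _ uf]] := rapid_seq_ex hf; have [v [hv _ vg]] := rapid_seq_ex hg.
  have [_ mf _] := Wext_strict hf; have [_ mg _] := Wext_strict hg.
  have hmu k := decaying_mem (hu k); have hmv k := decaying_mem (hv k).
  have [h1 h2] := cvg_hinner LP hmu hmv hf hg uf vg.
  have [h3 h4] := cvg_hinner CP (fun k => W0_mem (hu k)) (fun k => W0_mem (hv k)) mf mg (Wext_cvg hf hu uf) (Wext_cvg hg hv vg).
  have E k := W_schwartz_inner N0 d0 dN hchi (hu k) (hv k).
  move: h3 h4.
  rewrite (_ : (fun n => complex.Re (@hinner R LC _ _)) = (fun n => complex.Re (@hinner R L (u n) (v n)))); last first.
    by apply/funext => n; rewrite E.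
  rewrite (_ : (fun n => complex.Im (@hinner R LC _ _)) = (fun n => complex.Im (@hinner R L (u n) (v n)))); last first.
    by apply/funext => n; rewrite E.
  move=> h3 h4; apply: complex_eq; [exact: (cvg_unique _ h3 h1)|exact: (cvg_unique _ h4 h2)].
Qed.

Lemma heis_schrE (h : R3) f :
  heis_schr N h f = schr N (mkHJ (oner_neq0 R) h.1.1 h.1.2 h.2) f.
Proof.
apply/funext => x; rewrite /heis_schr /schr /wop /schr_phase /= normr1 powR1.
by rewrite !mul1r.
Qed.

(** A translate of the limit along u is, at every point, the limit along the transformed sequence,
    which is again rapid because [heis_schr] is isometric. Hence the translate is a strict form
    too. *)
Lemma Wext_rho (h : R3) f : @hmem R L f ->
  strict_form N (rho h (Wext f)) /\ @heq R HN (Wext (heis_schr N h f)) (rho h (Wext f)).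
Proof.
move=> hf; have [u ru WE] := WextP hf; have [hu ur uf] := ru.
have SI := schr_isometry N (mkHJ (oner_neq0 R) h.1.1 h.1.2 h.2).
have hm k := decaying_mem (hu k).
have hhf : @hmem R L (heis_schr N h f) by rewrite heis_schrE; exact: (hisometry_mem SI).
have rh : rapid_seq (heis_schr N h f) (fun k => heis_schr N h (u k)).
  split.
  - by move=> k; exact: decaying_heis_schr.
  - by move=> k; rewrite !heis_schrE (iso_hnormB LP LP SI).
  - rewrite (_ : (fun k => _) = (fun k => @hnorm R L (u k - f : hcar L)))//.
    by apply/funext => k; rewrite !heis_schrE (iso_hnormB LP LP SI).
have E : rho h (Wext f) = Wlim (fun k => heis_schr N h (u k)).
  rewrite WE; apply/funext => g; rewrite /rho /Wlim; congr clim; apply/funext => k.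
  by rewrite (W_schwartz_intertwine N d0 hchi).
have [sW cW] := Wlim_rapid rh; rewrite E; split; first exact: sW.
have sW' := Wext_strict hhf.
apply: heqHN; try exact: strict_mem.
have [rh1 _ rh3] := rh.
apply: (hlim_unique CP (u := fun k => W0 (heis_schr N h (u k)))).
- by move=> k; apply: W0_mem; exact: rh1.
- by case: sW'.
- by case: sW.
- exact: (Wext_cvg hhf rh1 rh3).
- exact: cW.
Qed.

Lemma W_extension : isometric_extension N d chi (W N d chi).
Proof.
apply: (@xgetPex _ (fun _ _ => 0) (isometric_extension N d chi)).
exists Wext; split; first exact: Wext_isometry.
by move=> f /schwartz_decaying; exact: Wext_decaying.
Qed.

Lemma W_isometry : @hisometry R L HN (W N d chi).
Proof. by case: W_extension. Qed.

(** Two isometries that agree on Schwartz functions agree on a closed subspace, hence everywhere by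
    [schwartz_total]. *)
Lemma W_Wext f : @hmem R L f -> @heq R HN (W N d chi f) (Wext f).
Proof.
have WI := W_isometry; have WE := Wext_isometry.
pose S : set (hcar L) := [set f | @hmem R L f /\ @heq R HN (W N d chi f) (Wext f)].
suff SE : S = @hmem R L by move=> hf; have [_ ] : S f by rewrite SE.
apply: schwartz_total.
- split=> [g []//| |a g1 g2 [h1 e1] [h2 e2]].
    split; first exact: (hmem0 LP).
    have h0 := hmem0 LP.
    have := iso_heqZ LP HP WI 0 h0; have := iso_heqZ LP HP WE 0 h0.
    rewrite !scale0r => e1 e2; apply: (heq_trans HP e2); exact: (heq_sym HP).
  split; first exact: (hmemZD LP).
  apply: (heq_trans HP (hisometry_linear WI a h1 h2)).
  apply: (heq_trans HP (heqZD HP a e1 e2)).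
  exact: (heq_sym HP (hisometry_linear WE a h1 h2)).
- move=> u g hu hg ug; split=> //.
  have hm k : @hmem R L (u k) by case: (hu k).
  apply: (hlim_unique HP (u := fun k => W N d chi (u k))).
  + by move=> k; exact: (hisometry_mem WI).
  + exact: (hisometry_mem WI).
  + exact: (hisometry_mem WE).
  + rewrite (_ : (fun k => _) = (fun k => @hnorm R L (u k - g : hcar L)))//.
    by apply/funext => k; exact: (iso_hnormB LP HP WI).
  + rewrite (_ : (fun k => _) = (fun k => @hnorm R L (u k - g : hcar L)))//.
    apply/funext => k; rewrite -(iso_hnormB LP HP WE)//.
    have [_ e] := hu k.
    apply: (heq_hnorm HP); apply: (heqB HP e).
    exact/(heq_refl HP)/(hisometry_mem WE).
- move=> f0 sf; have df := schwartz_decaying sf; split; first exact: decaying_mem.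
  have [_ /(_ _ sf) e] := W_extension.
  by apply: (heq_trans HP e); apply: (heq_sym HP); exact: Wext_decaying.
Qed.

(** For an arbitrary representative F: it agrees almost everywhere with the strict form [Wext f],
    and right translations preserve null sets. *)
Lemma W_rho (h : R3) (f : R -> R[i]) (F : R3 -> R[i]) : @hmem R L f ->
  @heq R HN (W N d chi f) F ->
  @heq R HN (W N d chi (heis_schr N h f)) (rho h F).
Proof.
move=> hf WF; have [sr er] := Wext_rho h hf.
have hhf : @hmem R L (heis_schr N h f).
  by rewrite heis_schrE; exact: (hisometry_mem (schr_isometry N _)).
have eF : @heq R HN (Wext f) F := heq_trans HP (heq_sym HP (W_Wext hf)) WF.
have [hW hF _] := eF.
have ae := (HN_heqP hW hF).1 eF.
have aer := ae_rho h ae.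
have mrF : cmeasurable (rho h F : R3 -> R[i]).
  by case: hF => mF _; exact: (cmeasurable_comp (measurable_heis_mulr h) mF).
have hr := HN_mem_ae mrF (strict_invariant_form sr) aer.
apply: (heq_trans HP (W_Wext hhf)); apply: (heq_trans HP er).
by apply: (HN_heqP (strict_mem sr) hr).2.
Qed.

End Extension.

(** * Transport of representations along a unitary map *)

Section Transport.
Variables (R : realType) (G : topologicalGroupType) (E F : hspace R).
Variables (pi : G -> hcar E -> hcar E) (tau : G -> hcar F -> hcar F).
Variable T : hcar E -> hcar F.
Hypotheses (EP : prehilbert E) (FP : prehilbert F) (TU : hunitary T).
Hypothesis tauT : forall g f u, hmem f -> heq (T f) u -> heq (tau g u) (T (pi g f)).

Let TI : hisometry T. Proof. by case: TU. Qed.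

Let Tsurj u : hmem u -> exists2 f, hmem f & heq (T f) u.
Proof. by case: TU => _; exact. Qed.

Lemma heq_hinner (H : hspace R) (u u' v v' : hcar H) : prehilbert H ->
  heq u u' -> heq v v' -> hinner u v = hinner u' v'.
Proof.
move=> HP uu' vv'; have [hu hu' _] := uu'; have [hv hv' _] := vv'.
have Q (x y : hcar H) : hmem x -> hmem y -> hnorm x = 0 -> hinner x y = 0.
  move=> hx hy x0; apply: complex_eq; apply/eqP; rewrite -normr_le0.
    by rewrite (le_trans (abs_Re_hinner HP hx hy))// x0 mul0r.
  by rewrite (le_trans (abs_Im_hinner HP hx hy))// x0 mul0r.
have [_ _ nu] := uu'; have [_ _ nv] := heq_sym HP vv'.
have := Q _ _ (hmemB HP hu hu') hv nu; rewrite (hinnerBl HP)// => /subr0_eq ->.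
have := Q _ _ (hmemB HP hv' hv) hu' nv; rewrite (hinnerBl HP)// => /subr0_eq.
by move=> e; rewrite (ph_hermitian HP hv hu') -e -(ph_hermitian HP hv' hu').
Qed.

Lemma transport_hilbert : is_hilbert E -> is_hilbert F.
Proof.
move=> EH; case: (FP) => Fs Fl Fh Fg; split=> // u hu cu.
have H n : exists f, hmem f /\ heq (T f) (u n).
  by have [f hf e] := Tsurj (hu n); exists f.
have [f fP] := choice H.
have fh n := (fP n).1; have fe n := (fP n).2.
have nE m n : hnorm (f m - f n) = hnorm (u m - u n).
  rewrite -(iso_hnormB EP FP TI)//; apply: (heq_hnorm FP).
  exact: (heqB FP).
have [e e0|g hg fg] := hilbert_complete EH fh.
  have [n0 cn] := cu e e0; exists n0 => m n hm hn; rewrite nE; exact: cn.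
exists (T g); first exact: (hisometry_mem TI).
rewrite (_ : (fun n => _) = (fun n => hnorm (f n - g)))//.
apply/funext => n; rewrite -(iso_hnormB EP FP TI)//; apply: (heq_hnorm FP).
apply: (heqB FP); first exact: (heq_sym FP).
exact/(heq_refl FP)/(hisometry_mem TI).
Qed.

(** [tauT] covers every representative u of T f, and every member of F represents some T f; so each
    property of tau at u is read off from pi at f. *)
Lemma transport_rep : unitary_rep pi -> unitary_rep tau.
Proof.
case=> EH pU p1 pM pC.
have pI g : hisometry (pi g) by case: (pU g).
have pmem g f : hmem f -> hmem (pi g f) by exact: (hisometry_mem (pI g)).
have Tmem f : hmem f -> hmem (T f) by exact: (hisometry_mem TI).
have refl f : hmem f -> heq (T f) (T f) by move=> hf; exact/(heq_refl FP)/Tmem.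
split; first exact: transport_hilbert.
- move=> g; split; first split.
  + by move=> u /Tsurj[f hf /(tauT g hf)[]].
  + move=> a u v /Tsurj[f hf fu] /Tsurj[h hh hv].
    have hfh := hmemZD EP a hf hh.
    have e1 : heq (T (a *: f + h)) (a *: u + v).
      apply: (heq_trans FP (hisometry_linear TI a hf hh)).
      exact: (heqZD FP).
    apply: (heq_trans FP (tauT g hfh e1)).
    apply: (heq_trans FP (iso_heq EP FP TI (hisometry_linear (pI g) a hf hh))).
    apply: (heq_trans FP (hisometry_linear TI a (pmem g f hf) (pmem g h hh))).
    apply: (heqZD FP); apply: (heq_sym FP); exact: tauT.
  + move=> u v /Tsurj[f hf fu] /Tsurj[h hh hv].
    rewrite (heq_hinner FP (tauT g hf fu) (tauT g hh hv)).
    rewrite -(heq_hinner FP fu hv).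
    rewrite (hisometry_inner TI (pmem g f hf) (pmem g h hh)).
    by rewrite (hisometry_inner (pI g) hf hh) -(hisometry_inner TI hf hh).
  + move=> w /Tsurj[f hf fw]; have [_ /(_ f hf)[h hh hf']] := pU g.
    exists (T h); first exact: Tmem.
    apply: (heq_trans FP (tauT g hh (refl _ hh))).
    exact: (heq_trans FP (iso_heq EP FP TI hf')).
- move=> u /Tsurj[f hf fu].
  apply: (heq_trans FP (tauT _ hf fu)).
  exact: (heq_trans FP (iso_heq EP FP TI (p1 f hf))).
- move=> g h u /Tsurj[f hf fu].
  apply: (heq_trans FP (tauT _ hf fu)).
  apply: (heq_trans FP (iso_heq EP FP TI (pM g h f hf))).
  apply: (heq_sym FP); apply: tauT; first exact: pmem.
  by apply: (heq_sym FP); exact: tauT.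
- move=> u g0 /Tsurj[f hf fu].
  rewrite (_ : (fun g => _) = (fun g => hnorm (pi g f - pi g0 f))); first exact: pC.
  apply/funext => g; rewrite -(iso_hnormB EP FP TI (pmem g f hf) (pmem g0 f hf)).
  by apply: (heq_hnorm FP); apply: (heqB FP); exact: tauT.
Qed.

(** The preimage of a closed invariant subspace under T is closed and invariant. The way back uses
    surjectivity of T and the fact that closed subspaces are unions of classes. *)
Lemma transport_irreducible : unitary_rep pi ->
  irreducible_rep pi -> irreducible_rep tau.
Proof.
move=> pU; case=> [[f0 hf0 nf0] irr].
have Tmem f : hmem f -> hmem (T f) by exact: (hisometry_mem TI).
have refl f : hmem f -> heq (T f) (T f) by move=> hf; exact/(heq_refl FP)/Tmem.
split; first by exists (T f0); [exact: Tmem|rewrite (iso_hnorm TI)].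
move=> S Ss Sc Stau.
have [SF S0 SZD] := Ss.
have Sheq u v : S u -> heq u v -> S v by exact: (hclosed_heq FP Sc).
pose S' : set (hcar E) := [set f | hmem f /\ S (T f)].
have S's : hsubspace S'.
  split=> [f []//| |a f h [hf Sf] [hh Sh]].
    split; first exact: (hmem0 EP).
    have h0 := hmem0 EP.
    apply: (Sheq 0 _ S0); apply: (heq_sym FP).
    by have := iso_heqZ EP FP TI 0 h0; rewrite !scale0r.
  split; first exact: (hmemZD EP).
  apply: (Sheq _ _ (SZD a _ _ Sf Sh)); apply: (heq_sym FP).
  exact: (hisometry_linear TI).
have S'c : hclosed S'.
  move=> u v hu hv uv; split=> //.
  apply: (Sc (fun n => T (u n))); [by move=> n; case: (hu n)|exact: Tmem|].
  rewrite (_ : (fun n => _) = (fun n => hnorm (u n - v)))//.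
  by apply/funext => n; apply: (iso_hnormB EP FP TI) => //; case: (hu n).
have S'pi g f : S' f -> S' (pi g f).
  move=> [hf Sf]; have e := tauT g hf (refl _ hf).
  split; last exact: (Sheq _ _ (Stau g _ Sf)).
  by have [pI _] := unitary_rep_unitary pU g; exact: (hisometry_mem pI).
have [S'0|S'E] := irr S' S's S'c S'pi; [left|right].
  move=> u Su; have [f hf fu] := Tsurj (SF u Su).
  rewrite -(heq_hnorm FP fu) (iso_hnorm TI)// S'0//; split=> //.
  by apply: (Sheq u) => //; exact: (heq_sym FP).
apply/seteqP; split=> // u /Tsurj[f hf fu].
have [_ Sf] : S' f by rewrite S'E.
exact: Sheq Sf fu.
Qed.

End Transport.

(** The intertwiner is T2 after an inverse of T1; the inverse chooses a preimage, unique up to [heq]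
    because T1 is isometric. *)
Lemma transport_equivalent (R : realType) (G : topologicalGroupType)
    (E F1 F2 : hspace R) (pi : G -> hcar E -> hcar E)
    (tau1 : G -> hcar F1 -> hcar F1) (tau2 : G -> hcar F2 -> hcar F2)
    (T1 : hcar E -> hcar F1) (T2 : hcar E -> hcar F2) :
  prehilbert E -> prehilbert F1 -> prehilbert F2 ->
  hunitary T1 -> hunitary T2 -> unitary_rep pi ->
  (forall g f u, hmem f -> heq (T1 f) u -> heq (tau1 g u) (T1 (pi g f))) ->
  (forall g f u, hmem f -> heq (T2 f) u -> heq (tau2 g u) (T2 (pi g f))) ->
  unitarily_equivalent tau1 tau2.
Proof.
move=> EP P1 P2 [I1 S1] [I2 S2] pU H1 H2.
pose inv u := xget 0 [set f | hmem f /\ heq (T1 f) u].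
have invP u : hmem u -> hmem (inv u) /\ heq (T1 (inv u)) u.
  by move=> /S1[f hf fu]; apply: (@xgetPex _ 0 [set f | hmem f /\ heq (T1 f) u]); exists f.
have invE f u : hmem f -> heq (T1 f) u -> heq (T2 (inv u)) (T2 f).
  move=> hf fu; have [_ hu _] := fu; have [hi ei] := invP u hu.
  apply: (iso_heq EP P2 I2); apply: (iso_heq_inj EP P1 I1) => //.
  by apply: (heq_trans P1 ei); exact: (heq_sym P1).
have refl1 f : hmem f -> heq (T1 f) (T1 f).
  by move=> hf; exact/(heq_refl P1)/(hisometry_mem I1).
have refl2 f : hmem f -> heq (T2 f) (T2 f).
  by move=> hf; exact/(heq_refl P2)/(hisometry_mem I2).
have pmem g f : hmem f -> hmem (pi g f).
  by move=> hf; have [pI _] := unitary_rep_unitary pU g; exact: (hisometry_mem pI).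
exists (fun u => T2 (inv u)).
  split; first split.
  - by move=> u /invP[hi _]; exact: (hisometry_mem I2).
  - move=> a u v hu hv; have [hi ei] := invP u hu; have [hj ej] := invP v hv.
    have hij := hmemZD EP a hi hj.
    have e : heq (T1 (a *: inv u + inv v)) (a *: u + v).
      by apply: (heq_trans P1 (hisometry_linear I1 a hi hj)); exact: (heqZD P1).
    apply: (heq_trans P2 (invE _ _ hij e)).
    exact: (hisometry_linear I2).
  - move=> u v hu hv; have [hi ei] := invP u hu; have [hj ej] := invP v hv.
    by rewrite (hisometry_inner I2)// -(heq_hinner P1 ei ej) (hisometry_inner I1).
  - move=> w /S2[f hf fw]; exists (T1 f); first exact: (hisometry_mem I1).
    by apply: (heq_trans P2 (invE _ _ hf (refl1 _ hf))).
move=> g u hu; have [hi ei] := invP u hu.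
have e := H1 g _ _ hi ei.
apply: (heq_trans P2 (invE _ _ (pmem g _ hi) (heq_sym P1 e))).
by apply: (heq_sym P2); apply: H2 => //; exact: refl2.
Qed.

(** * The model representation of the sub-Jacobi group *)

Section SchroedingerRepresentation.
Variables (R : realType) (N : int).
Hypothesis N0 : N != 0.
Local Notation L := (L2R R).
Local Notation mu := (@lebesgue_measure R).
Local Notation NR := (N%:~R : R).
Let LP := L2R_prehilbert R.
Let NR0 : NR != 0. Proof. by rewrite intr_eq0. Qed.

Lemma L2R_hilbert : is_hilbert L.
Proof.
case: LP => Ls Ll Lh Lg; split=> // u hu cu.
exact: (@L2_complete _ _ _ mu setT measurableT u hu cu).
Qed.

Lemma schr_unitary_rep : @unitary_rep R (HJ R) L (schr N).
Proof.
have SI (g : HJ R) := schr_isometry N g; have Smem g := hisometry_mem (SI g).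
split; first exact: L2R_hilbert.
- move=> g; split; first exact: SI.
  move=> w hw; exists (schr N (g^-1)%g w); first exact: Smem.
  by rewrite -schrM mulgV schr1; exact: (heq_refl LP).
- by move=> u hu; rewrite schr1; exact: (heq_refl LP).
- by move=> g h u hu; rewrite schrM; apply: (heq_refl LP); apply/Smem/Smem.
- by move=> u g0 hu; exact: schr_continuous.
Qed.

Lemma L2R_nonzero : hnonzero L.
Proof.
pose f := restr `]0, 1] (fun _ => 1 : R[i]).
have hf : @hmem R L f by exact: restr_cst_mem.
exists f => //; have := @L2_hnorm_sqrE R _ _ mu setT measurableT f hf.
rewrite (_ : (fun x => _) = (fun x => (\1_`]0%R, 1%R] x)%:E)); last first.
  apply/funext => x; rewrite /f /restr mulr1 normc_real indicE.
  by case: (_ \in _); rewrite /= ?expr1n ?expr0n.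
have m1 : mu (`]0, 1]%classic : set R) = 1%E.
  by rewrite lebesgue_measure_itv/= lte_fin ltr01 -EFinB subr0.
rewrite integral_indic ?setIT; last 2 first.
- exact: measurableT.
- exact: measurable_itv.
move=> E h0; have := etrans E m1; rewrite h0 expr0n.
by case=> /esym/eqP; rewrite oner_eq0.
Qed.

(** The elements [1, a, 0, 0] act by modulations and, since N <> 0, the elements [t, 0, b/N, 0] act
    by f |-> |t|^(1/2) f(t x + b); these are the two stabilities required by [S_full]. *)
Lemma schr_irreducible : @irreducible_rep R (HJ R) L (schr N).
Proof.
split; first exact: L2R_nonzero.
move=> S Ss Sc Sp; have [H|] := pselect (forall u, S u -> @hnorm R L u = 0); first by left.
move=> /existsNP[f /not_implyP[Sf nf]]; right.
apply: (S_full Ss Sc _ _ Sf nf) => [a h Sh|t b h t0 Sh].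
  have := Sp (mkHJ (oner_neq0 R) a 0 0) _ Sh; congr S.
  apply/funext => x; rewrite /schr /wop /schr_phase /= normr1 powR1.
  by rewrite !(mulr0, add0r, addr0, mul1r).
have := hsubZ Ss ((`|t| `^ 2^-1)^-1%:C) (Sp (mkHJ t0 0 (b / NR) 0) _ Sh); congr S.
have E x : schr N (mkHJ t0 0 (b / NR) 0) h x = (`|t| `^ 2^-1)%:C * h (t * x + b).
  rewrite /schr /wop /schr_phase /= !(mulr0, mul0r) addr0 e2pi0 mul1r.
  by rewrite [NR * (b / NR)]mulrC divfK.
apply/funext => x; transitivity ((`|t| `^ 2^-1)^-1%:C * schr N (mkHJ t0 0 (b / NR) 0) h x) => //.
rewrite E mulrA -rmorphM mulVf ?mul1r//.
by rewrite gt_eqF// powR_gt0// normr_gt0.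
Qed.

End SchroedingerRepresentation.

(** * The representations [rhoJ] and their classification *)

Section RhoJ.
Variables (R : realType) (N : int) (d : nat) (chi : int -> R[i]).
Hypotheses (N0 : N != 0) (d0 : (0 < d)%N) (dN : (d%:Z %| N)%Z).
Hypothesis hchi : dirichlet_character d chi.
Local Notation NR := (N%:~R : R).
Local Notation L := (L2R R).
Local Notation HN := (HN R N).
Local Notation HNd := (HNd N d chi).
Local Notation W := (W N d chi).
Let LP := L2R_prehilbert R.
Let HP := HN_prehilbert R N.
Let WI : @hisometry R L HN W := W_isometry N0 d0 dN hchi.

Lemma heq_W_refl f : @hmem R L f -> @heq R HN (W f) (W f).
Proof. by move=> hf; exact/(heq_refl HP)/(hisometry_mem WI). Qed.

Lemma HNd_subspace : @hsubspace R HN (@hmem R HNd).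
Proof.
split; first by move=> F [f hf []].
  exists 0; first exact: (hmem0 LP).
  by have := iso_heqZ LP HP WI 0 (hmem0 LP); rewrite !scale0r.
move=> a F G [f hf e] [g hg e']; exists (a *: (f : hcar L) + g); first exact: (hmemZD LP).
by apply: (heq_trans HP (hisometry_linear WI a hf hg)); exact: (heqZD HP).
Qed.

Lemma HNd_prehilbert : prehilbert HNd.
Proof. exact: prehilbert_hsub HP HNd_subspace. Qed.

Lemma heq_HNd f F : @hmem R L f -> @heq R HN (W f) F -> @heq R HNd (W f) F.
Proof.
move=> hf e; have [_ _ E] := e; split=> //; last by exists f.
by exists f => //; exact: heq_W_refl.
Qed.

Lemma W_unitary : @hunitary R L HNd W.
Proof.
split; last by move=> F [f hf e]; exists f => //; exact: heq_HNd.
split.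
- by move=> f hf; exists f => //; exact: heq_W_refl.
- move=> a f g hf hg; apply: heq_HNd; first exact: (hmemZD LP).
  exact: (hisometry_linear WI).
- exact: (hisometry_inner WI).
Qed.

(** The preimage chosen by [Winv] is equivalent to [heis_schr N h f] since W is isometric; applying
    U(t) to the latter gives exactly [schr N g f]. *)
Lemma rhoJ_W (g : HJ R) (f : hcar L) (F : hcar HNd) : @hmem R L f ->
  @heq R HNd (W f) F -> @heq R HNd (rhoJ g F) (W (schr N g f)).
Proof.
move=> hf [_ [f1 hf1 e1] E].
have e : @heq R HN (W f) F by split=> //; [exact: (hisometry_mem WI)|case: e1].
pose h := (HJa g, HJc g, HJz g).
have hh : @hmem R L (heis_schr N h f).
  by rewrite heis_schrE; exact: (hisometry_mem (schr_isometry N _)).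
have er := W_rho N0 d0 dN hchi h hf e.
have [hi ei] : @hmem R L (Winv N d chi (rho h F)) /\ @heq R HN (W (Winv N d chi (rho h F))) (rho h F).
  apply: (@xgetPex _ _ [set f | @hmem R L f /\ @heq R HN (W f) (rho h F)]).
  by exists (heis_schr N h f).
have eL : @heq R L (Winv N d chi (rho h F)) (heis_schr N h f).
  apply: (iso_heq_inj LP HP WI) => //; apply: (heq_trans HP ei).
  exact: (heq_sym HP).
have UE k : U (HJt g) k = wop (HJt g) 0 (fun _ => 1) k.
  by apply/funext => x; rewrite /U /wop mul1r addr0.
have UI : @hisometry R L L (U (HJt g)).
  rewrite (funext UE); apply: wop_isometry.
  - exact: HJt_neq0.
  - exact: cmeasurable_cst.
  - by move=> x; rewrite normc_sqr /= expr1n expr0n addr0.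
have US : U (HJt g) (heis_schr N h f) = schr N g f.
  by apply/funext => x; rewrite /U /schr /wop /schr_phase /heis_schr /=.
have eU := iso_heq LP LP UI eL; rewrite US in eU.
have [_ hs _] := eU; have [hu _ _] := eU.
apply: (heq_sym HNd_prehilbert); apply: heq_HNd => //.
by apply: (heq_sym HP); exact: (iso_heq LP HP WI eU).
Qed.

Lemma rhoJ_unitary_rep : unitary_rep (@rhoJ R N d chi).
Proof.
exact: (@transport_rep R (HJ R) L HNd (schr N) (@rhoJ R N d chi) W
  LP HNd_prehilbert W_unitary rhoJ_W (schr_unitary_rep R N)).
Qed.

Lemma rhoJ_irreducible : irreducible_rep (@rhoJ R N d chi).
Proof.
exact: (@transport_irreducible R (HJ R) L HNd (schr N) (@rhoJ R N d chi) W
  LP HNd_prehilbert W_unitary rhoJ_W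
  (schr_unitary_rep R N) (schr_irreducible R N0)).
Qed.

Lemma rhoJ_central : has_central_character N d chi.
Proof.
move=> z F [f hf e]; have eH := heq_HNd hf e.
apply: (heq_trans HNd_prehilbert (rhoJ_W _ hf eH)).
have -> : schr N (mkHJ (oner_neq0 R) 0 0 z) f = e2pi (NR * z) *: (f : hcar L).
  apply/funext => x; rewrite /schr /wop /schr_phase /= normr1 powR1 mul0r mulr0 !addr0.
  by rewrite !mul1r.
apply: heq_HNd; first exact: (hmemZ LP).
by apply: (heq_trans HP (iso_heqZ LP HP WI _ hf)); exact: (heqZ HP).
Qed.

End RhoJ.

Lemma e2pi_half (R : realType) : e2pi (2^-1 : R) = -1.
Proof.
rewrite /e2pi (_ : 2 * pi * 2^-1 = pi); last by field.
by rewrite cospi sinpi; apply: complex_eq => //=; rewrite oppr0.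
Qed.

Theorem theorem7p3 (R : realType) :
  (forall (N : int) (d : nat) (chi : int -> R[i]),
     N != 0 -> (0 < d)%N -> (d%:Z %| N)%Z -> dirichlet_character d chi ->
     [/\ unitary_rep (@rhoJ R N d chi),
         irreducible_rep (@rhoJ R N d chi) &
         has_central_character N d chi]) /\
  (forall (N : int) (d : nat) (chi : int -> R[i])
          (N' : int) (d' : nat) (chi' : int -> R[i]),
     N != 0 -> (0 < d)%N -> (d%:Z %| N)%Z -> dirichlet_character d chi ->
     N' != 0 -> (0 < d')%N -> (d'%:Z %| N')%Z -> dirichlet_character d' chi' ->
     unitarily_equivalent (@rhoJ R N d chi) (@rhoJ R N' d' chi') <-> N = N').
Proof.
split=> [N d chi N0 d0 dN hchi|N d chi N' d' chi' N0 d0 dN hchi N'0 d'0 dN' hchi'].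
  by split; [exact: rhoJ_unitary_rep|exact: rhoJ_irreducible|exact: rhoJ_central].
split=> [[X [XI _] Xrho]|NN']; last first.
  (* Both representations are transported from the same [schr N], whatever d, chi, d' and chi'
     are. *)
  subst N'; apply: (@transport_equivalent R (HJ R) (L2R R) _ _ (schr N) _ _ _ _ (L2R_prehilbert R)
    (HNd_prehilbert N0 d0 dN hchi) (HNd_prehilbert N0 d'0 dN' hchi')
    (W_unitary N0 d0 dN hchi) (W_unitary N0 d'0 dN' hchi') (schr_unitary_rep R N)).
    exact: rhoJ_W.
  exact: rhoJ_W.
have P := HNd_prehilbert N0 d0 dN hchi; have P' := HNd_prehilbert N'0 d'0 dN' hchi'.
have [[F hF nF] _] := rhoJ_irreducible N0 d0 dN hchi.
have hX := hisometry_mem XI hF.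
(* The central element [1, 0, 0, z] acts by both scalars on X F, which has nonzero norm. *)
have E z : e2pi (N%:~R * z) = e2pi (N'%:~R * z) :> R[i].
  have c := rhoJ_central N0 d0 dN hchi z hF.
  have c' := rhoJ_central N'0 d'0 dN' hchi' z hX.
  have e := Xrho (mkHJ (oner_neq0 R) 0 0 z) F hF.
  have [_ _] : heq (e2pi (N%:~R * z) *: X F) (e2pi (N'%:~R * z) *: X F).
    apply: (heq_trans P' (heq_sym P' (iso_heqZ P P' XI _ hF))).
    apply: (heq_trans P' (iso_heq P P' XI (heq_sym P c))).
    exact: (heq_trans P' e c').
  rewrite -scalerBl (hnormZ P')// (iso_hnorm XI)// => /eqP; rewrite mulf_eq0.
  by move/eqP/negbTE : nF => ->; rewrite orbF => /eqP/ComplexField.Normc.eq0_normc/subr0_eq.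
have [//|NN'] := eqVneq N N'.
(* Then N z = N' z + 1/2, so the two characters differ by the factor -1. *)
pose z : R := (2 * (N%:~R - N'%:~R))^-1.
have D0 : N%:~R - N'%:~R != 0 :> R by rewrite -intrB intr_eq0 subr_eq0.
have := E z; have -> : N%:~R * z = 2^-1 + N'%:~R * z.
  by rewrite /z; field.
rewrite e2piD e2pi_half mulN1r => e.
have := e2piN (N'%:~R * z); have := e; set p := e2pi _ => pN pq; exfalso.
move: pq; have -> : p = 0 by apply/eqP; rewrite -eqNr pN.
by rewrite mul0r => /eqP; rewrite eq_sym oner_eq0.
Qed.
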